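(* Let $\gamma<1/2$ and let $F$ be a distribution function on $\mathbb{R}$ with finite variance that belongs to the maximum domain of attraction $\mathsf{MDA}(\gamma)$ with auxiliary function $a$. For each $n\ge 2$ let $X_{(1)}\ge\ldots\ge X_{(n)}$ be the order statistics of $n$ independent random variables distributed according to $F$. Then $$\lim_{n\to\infty}\frac{\mathbb{E}\left[(X_{(1)}-X_{(2)})^2\right]}{a(n)^2}=\frac{2\,\Gamma(2(1-\gamma))}{(1-\gamma)(1-2\gamma)}$$ and $$\lim_{n\to\infty}\frac{\operatorname{Var}(X_{(1)})}{a(n)^2}=\frac{1}{\gamma^2}\left(\Gamma(1-2\gamma)-\Gamma(1-\gamma)^2\right),$$ where for $\gamma=0$ the last expression is to be read as $\pi^2/6$.
   Context: The order statistics (which depend on $n$) are the non-increasing rearrangement of the sample. $\Gamma$ is Euler's Gamma function. $F^{\leftarrow}(y)=\inf\{x:F(x)\ge y\}$ is the generalized inverse of $F$. $F\in\mathsf{MDA}(\gamma)$ with auxiliary function $a$ means that $a$ is a non-negative function on $[1,\infty)$ such that, for $X_1,X_2,\ldots$ independent with distribution function $F$ and for all real $x$ with $1+\gamma x>0$, $$\lim_{n\to\infty}\mathbb{P}\left\{\frac{\max(X_1,\ldots,X_n)-F^{\leftarrow}(1-1/n)}{a(n)}\le x\right\}=\exp\left(-(1+\gamma x)^{-1/\gamma}\right),$$ where for $\gamma=0$ the quantity $(1+\gamma x)^{-1/\gamma}$ is read as $e^{-x}$. Equivalently, $U=(1/(1-F))^{\leftarrow}$, i.e. $U(t)=F^{\leftarrow}(1-1/t)$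 for $t>1$, satisfies $\lim_{t\to\infty}(U(tx)-U(t))/a(t)=(x^\gamma-1)/\gamma$ for all $x>0$ (read as $\log x$ when $\gamma=0$). *)

(* Defs.v *)
From HB Require Import structures.
From mathcomp Require Import all_boot all_order all_algebra.
From mathcomp Require Import finmap.
From mathcomp Require Import all_classical all_reals all_analysis.

Set Implicit Arguments.
Unset Strict Implicit.
Unset Printing Implicit Defensive.

Import Order.TTheory GRing.Theory Num.Theory.
Import numFieldNormedType.Exports.

Local Open Scope classical_set_scope.
Local Open Scope ring_scope.

(* A distribution function on the real line is a [cumulativeBounded 0 1]:
   nondecreasing, right-continuous, with limits 0 at -oo and 1 at +oo. *)

(* Euler's integral; it represents the Gamma function for 0 < s only. *)
Definition Gamma (R : realType) (s : R) : R :=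
  \int[@lebesgue_measure R]_(t in `]0, +oo[) (t `^ (s - 1) * expR (- t)).

(* Meaningful for 0 < y < 1, where the set is nonempty and bounded below. *)
Definition quantile (R : realType) (F : R -> R) (y : R) : R :=
  inf [set x | y <= F x].

Definition mutually_independent d (T : measurableType d) (R : realType)
    (P : probability T R) (I : choiceType) (X : I -> {RV P >-> R}) : Prop :=
  forall (J : {fset I}) (A : I -> set R), (forall i, measurable (A i)) ->
    P (\bigcap_(i in [set` J]) X i @^-1` A i)
    = (\prod_(i <- J) P (X i @^-1` A i))%E.

Definition iid_sample d (T : measurableType d) (R : realType)
    (P : probability T R) (F : R -> R) (n : nat)
    (X : 'I_n -> {RV P >-> R}) : Prop :=
  mutually_independent X /\ forall i x, cdf (X i) x = (F x)%:E.

Definition sample d (T : measurableType d) (R : realType)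
    (P : probability T R) (n : nat) (X : 'I_n -> {RV P >-> R}) (w : T) : seq R :=
  [seq X i w | i <- enum 'I_n].

(* The maximum of [s] when [s] is nonempty, and 0 when it is empty. *)
Definition seq_max (R : realType) (s : seq R) : R :=
  \big[Num.max/head 0 s]_(x <- s) x.

Definition sample_max d (T : measurableType d) (R : realType)
    (P : probability T R) (n : nat) (X : 'I_n -> {RV P >-> R}) (w : T) : R :=
  seq_max (sample X w).

(* Numbered from 1, in non-increasing order, so that [order_stat X 1] is the
   largest observation; meaningful for 1 <= k <= n. *)
Definition order_stat d (T : measurableType d) (R : realType)
    (P : probability T R) (n : nat) (X : 'I_n -> {RV P >-> R}) (k : nat)
    (w : T) : R :=
  nth 0 (sort (fun x y => y <= x) (sample X w)) k.-1.

(* [gev_exponent gamma x] is (1 + gamma x)^(-1/gamma). *)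
Definition gev_exponent (R : realType) (gamma x : R) : R :=
  if gamma == 0 then expR (- x) else (1 + gamma * x) `^ (- gamma^-1).

(* The law of the maximum of n independent variables with distribution
   function F depends on F and n only. The definition therefore leaves the
   probability space free, and even lets it change with n; n variables taken
   from a single infinite sequence are a special case. *)
Definition MDA (R : realType) (F : R -> R) (gamma : R) (a : R -> R) : Prop :=
  (forall t, 1 <= t -> 0 <= a t) /\
  forall (d : nat -> measure_display) (T : forall n, measurableType (d n))
    (P : forall n, probability (T n) R)
    (X : forall n, 'I_n -> {RV P n >-> R}),
    (forall n, iid_sample F (@X n)) ->
    forall x : R, 0 < 1 + gamma * x ->
      P n [set w | (sample_max (@X n) w - quantile F (1 - n%:R^-1)) / a n%:R <= x]
        @[n --> \oo] --> (expR (- gev_exponent gamma x))%:E.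

(* The library's variance, taken for the identity under the law of F. It is
   +oo as soon as the second moment is, because an infinite or undefined mean
   is then replaced by 0. *)
Definition finite_variance (R : realType) (F : cumulativeBounded (0 : R) (1 : R))
    : Prop :=
  ('V_(lebesgue_stieltjes_measure F)[fun x => x] < +oo)%E.

Definition gev_variance (R : realType) (gamma : R) : R :=
  if gamma == 0 then pi ^+ 2 / 6
  else gamma ^- 2 * (Gamma (1 - 2 * gamma) - Gamma (1 - gamma) ^+ 2).

(* Main.v *)
(* Put Z(s) = quantile F (exp (- s)), b(n) = quantile F (1 - 1/n) and
   h_n(s) = (Z(s/n) - b(n)) / a(n).  The MDA hypothesis amounts to
   h_n(s) --> h(s) = (s^-gamma - 1)/gamma, or - ln s when gamma = 0.
   Exact identities express the moments through Z: E (X(1) - c)^2 is the integral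
   of exp (- t) (Z(t/n) - c)^2, and E (X(1) - X(2))^2 is the integral over s, t > 0
   of (Z(s/n) - Z(t/n))_+^2 against an explicit product of exponential weights.
   A Potter-type argument on the dyadic increments of Z near 0, together with
   Chebyshev's inequality for large arguments, gives
   |h_n(s)| <= C (s^-p + exp (s/8)) with p < 1/2, so that dominated convergence
   applies.  The limit integrals are elementary, except that for gamma = 0 the
   variance of ln t under exp (- t) dt is the Basel sum pi^2/6. *)
Require Import Defs.
From HB Require Import structures.
From mathcomp Require Import all_boot all_order all_algebra.
From mathcomp Require Import finmap ring lra.
From mathcomp Require Import all_classical all_reals all_analysis.
From mathcomp Require Import measurable_realfun.

Set Implicit Arguments.
Unset Strict Implicit.
Unset Printing Implicit Defensive.

Import Order.TTheory GRing.Theory Num.Theory.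
Import numFieldNormedType.Exports.

Local Open Scope classical_set_scope.
Local Open Scope ring_scope.

(** [F] may have jumps, so X(1) and X(2) need have neither densities nor distinct values, and no
    change of variables in a joint law is available. Squares are therefore compared as areas, which
    requires only the probabilities of events such as X(2) <= x, y < X(1). The variance is not
    computed from a limit of means: the second moments about b(n) and b(n) + a(n) determine it, so
    only squares pass to the limit.

    The constants of the dominating function depend on each other. The square of s^-p must be
    integrable at 0, which forces p < 1/2, and an admissible p above gamma exists because gamma <
    1/2. Chebyshev gives |Z(u)| <= K exp (u/2) for u >= 1; at u = s/n with n >= 8 this growth is at
    most exp (s/16), and a second factor exp (s/16) absorbs a power of s, whence exp (s/8). Its
    square exp (s/4) has to be beaten by exp (- s) in the variance and, in the gap, by the weight
    for n = 2, which decays only like exp (- t/2) in the larger variable t. *)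

Section pointwise_derivatives.
Context {R : realType}.
Implicit Types (f g : R -> R) (x c df dg : R).

(** These rules keep the function written out pointwise, so that a primitive can be differentiated
    by assembling terms and the resulting value adjusted afterwards with [is_derive_eq]. *)
Lemma is_derive1D f g x df dg : is_derive x 1 f df -> is_derive x 1 g dg ->
  is_derive x 1 (fun t => f t + g t) (df + dg).
Proof. by move=> ? ?; exact: is_deriveD. Qed.

Lemma is_derive1B f g x df dg : is_derive x 1 f df -> is_derive x 1 g dg ->
  is_derive x 1 (fun t => f t - g t) (df - dg).
Proof. by move=> ? ?; exact: is_deriveB. Qed.

Lemma is_derive1M f g x df dg : is_derive x 1 f df -> is_derive x 1 g dg ->
  is_derive x 1 (fun t => f t * g t) (df * g x + f x * dg).
Proof.
move=> fx gx; have := is_deriveM fx gx.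
by rewrite /GRing.scale/= addrC (mulrC (g x)).
Qed.

Lemma is_derive1Z c f x df : is_derive x 1 f df ->
  is_derive x 1 (fun t => c * f t) (c * df).
Proof. by move=> ?; exact: is_deriveZ. Qed.

Lemma is_derive1X f n x df : is_derive x 1 f df ->
  is_derive x 1 (fun t => f t ^+ n) (n%:R * f x ^+ n.-1 * df).
Proof. by move=> fx; have := is_deriveX n fx; rewrite exprfctE. Qed.

Lemma is_derive1V f x df : f x != 0 -> is_derive x 1 f df ->
  is_derive x 1 (fun t => (f t)^-1) (- df / f x ^+ 2).
Proof.
move=> fx0 fx; have := is_deriveV fx0 fx.
by move/is_derive_eq; apply; rewrite /GRing.scale/= mulNr mulrC mulNr.
Qed.

Lemma is_derive1_continuous f x df : is_derive x 1 f df -> {for x, continuous f}.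
Proof.
by move=> fx; apply/differentiable_continuous/derivable1_diffP.
Qed.

Lemma is_derive1E f x df : is_derive x 1 f df -> (f^`()%classic x = df) * derivable f x 1.
Proof.
by move=> fx; split; [rewrite derive1E derive_val|].
Qed.
Lemma is_derive1_expRN x : is_derive x 1 (fun t : R => expR (- t)) (- expR (- x)).
Proof.
have d := is_deriveN (is_derive_id x (1 : R)).
have := is_derive1_comp (is_derive_expR (- x)) d.
by move/is_derive_eq; apply; rewrite mulrN1.
Qed.
End pointwise_derivatives.

(** * The limit law and its dominating function *)

Section potter.
Context {R : realType}.
Implicit Types (Z : R -> R) (r s rho p q : R).

(* Halving [r] multiplies the dyadic increment [Z r - Z (2 * r)] by at most
   [rho < 2 `^ p], so the increments sum to a power bound of exponent [p]. *)
Lemma dyadic_right Z r0 rho p :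
  {in [pred r | 0 < r] &, {homo Z : x y / x <= y >-> y <= x}} ->
  (forall r, 0 < r <= r0 -> Z (r / 2) - Z r <= rho * (Z r - Z (2 * r))) ->
  0 <= p -> 0 <= rho < 2 `^ p ->
  exists2 C, 0 <= C & forall r s, 0 < r <= r0 -> 0 < s <= 1 ->
    Z (r * s) - Z r <= C * (Z r - Z (2 * r)) * s `^ (- p).
Proof.
move=> Zni Zrho p0 /andP[rho0 rhop].
have a_ge0 r : 0 < r -> 0 <= Z r - Z (2 * r).
  by move=> r0'; rewrite subr_ge0; apply: Zni; rewrite ?inE; lra.
have t0 : 0 < 2 `^ p :> R by rewrite powR_gt0.
(* [C] solves C = rho + C * rho / 2^p: the first halving contributes [rho], and the induction
   hypothesis at [r / 2] and [2 * s] contributes the other term. *)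
pose C := rho / (1 - rho / 2 `^ p).
have D0 : 0 < 1 - rho / 2 `^ p by rewrite subr_gt0 ltr_pdivrMr// mul1r.
have C0 : 0 <= C by rewrite divr_ge0// ltW.
have Crho : C * (rho / 2 `^ p) + rho = C.
  by rewrite /C; field; apply/andP; split; lra.
exists C => // r s; move=> rr0 s01.
have s_ge1 (x : R) : 0 < x <= 1 -> 1 <= x `^ (- p).
  move=> /andP[x0 x1]; rewrite powRN -[leLHS]invr1 lef_pV2 ?posrE// ?powR_gt0//.
  by have := @ge0_ler_powR _ p p0 x 1; rewrite powR1 !nnegrE => ->//; exact: ltW.
have [k sk] : exists k, 2 ^- k <= s.
  exists (Num.trunc s^-1).
  have s0 : 0 < s by case/andP: s01.
  rewrite -[leRHS]invrK lef_pV2 ?posrE ?invr_gt0// ?exprn_gt0//.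
  apply: (@le_trans _ _ (Num.trunc s^-1).+1%:R).
    by apply/ltW/truncnS_gt.
  by rewrite -natrX ler_nat ltn_expl.
elim: k r s rr0 s01 sk => [|k IH] r s rr0 s01 sk.
  have -> : s = 1 by move: sk s01; rewrite expr0 invr1; lra.
  rewrite mulr1 subrr mulr_ge0 ?powR_ge0// mulr_ge0// a_ge0//; lra.
have Zr := Zrho r rr0.
have [s12|s12] := leP (1/2) s.
  apply: (@le_trans _ _ (C * (Z r - Z (2 * r)) * 1)); last first.
    apply: ler_wpM2l; last exact: s_ge1.
    by rewrite mulr_ge0// a_ge0//; lra.
  rewrite mulr1; apply: (@le_trans _ _ (rho * (Z r - Z (2 * r)))).
    apply: le_trans Zr; rewrite lerD2r; apply: Zni; rewrite ?inE; nra.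
  rewrite ler_wpM2r ?a_ge0//; first lra.
  rewrite -Crho lerDr mulr_ge0// divr_ge0//; lra.
have /IH {}IH : 0 < r / 2 <= r0 by lra.
have : 0 < 2 * s <= 1 by lra.
move=> /[dup] s2 /IH.
have -> : 2 ^- k <= 2 * s.
  by move: sk; rewrite exprS invfM => ?; lra.
move=> /(_ erefl).
rewrite (_ : r / 2 * (2 * s) = r * s); last by field.
rewrite (_ : 2 * (r / 2) = r); last by field.
have s0 : 0 < s by case/andP: s01.
rewrite powRM//; last lra.
rewrite (powRN 2 p) => IH'.
set x := s `^ (- p) in IH' *.
have x1 : 1 <= x by exact: s_ge1.
set A := Z r - Z (2 * r) in Zr *.
have A0 : 0 <= A by apply: a_ge0; lra.
rewrite -[leLHS](subrKA (Z (r / 2))).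
apply: (@le_trans _ _ (C * (rho * A) * ((2 `^ p)^-1 * x) + rho * A * x)).
  rewrite lerD//.
    apply: le_trans IH' _; rewrite ler_wpM2r ?mulr_ge0 ?invr_ge0 ?powR_ge0//.
    by rewrite ler_wpM2l.
  by apply: le_trans Zr _; rewrite ler_peMr// mulr_ge0.
rewrite (_ : _ + _ = (C * (rho / 2 `^ p) + rho) * A * x); last by ring.
by rewrite Crho.
Qed.

(** The same summation towards larger arguments: each doubling multiplies the increment by at most
    [sigma], and the constant solves C = 1 + C * sigma / 2^q. The ratio is controlled only up to
    [r0], hence the restriction on [r * s]. *)
Lemma dyadic_left Z r0 sigma q :
  {in [pred r | 0 < r] &, {homo Z : x y / x <= y >-> y <= x}} ->
  (forall r, 0 < r <= r0 -> Z (2 * r) - Z (4 * r) <= sigma * (Z r - Z (2 * r))) ->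
  0 <= q -> 0 <= sigma < 2 `^ q ->
  exists2 C, 0 <= C & forall r s, 0 < r -> 1 <= s -> r * s <= r0 ->
    Z r - Z (r * s) <= C * (Z r - Z (2 * r)) * s `^ q.
Proof.
move=> Zni Zsigma q0 /andP[sigma0 sigmaq].
have a_ge0 r : 0 < r -> 0 <= Z r - Z (2 * r).
  by move=> r0'; rewrite subr_ge0; apply: Zni; rewrite ?inE; lra.
have t0 : 0 < 2 `^ q :> R by rewrite powR_gt0.
pose C := (1 - sigma / 2 `^ q)^-1.
have D0 : 0 < 1 - sigma / 2 `^ q by rewrite subr_gt0 ltr_pdivrMr// mul1r.
have C0 : 0 <= C by rewrite invr_ge0 ltW.
have Csigma : C * (sigma / 2 `^ q) + 1 = C.
  by rewrite /C; field; apply/andP; split; lra.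
have C1 : 1 <= C.
  by rewrite -Csigma lerDr mulr_ge0// divr_ge0//; lra.
exists C => // r s r_gt0 s1.
have s_ge1 (x : R) : 1 <= x -> 1 <= x `^ q.
  move=> x1; have := @ge0_ler_powR _ q q0 1 x; rewrite powR1 !nnegrE => ->//; lra.
have [k sk] : exists k, s <= 2 ^+ k.
  exists (Num.trunc s).+1; apply: (@le_trans _ _ (Num.trunc s).+1%:R).
    by apply/ltW/truncnS_gt.
  by rewrite -natrX ler_nat ltnW// ltn_expl.
elim: k r s r_gt0 s1 sk => [|k IH] r s r_gt0 s1 sk rs.
  have -> : s = 1 by move: sk s1; rewrite expr0; lra.
  rewrite mulr1 subrr mulr_ge0 ?powR_ge0// mulr_ge0// a_ge0//; lra.
set A := Z r - Z (2 * r).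
have A0 : 0 <= A by exact: a_ge0.
have x1 := s_ge1 _ s1.
have [s12|s12] := leP s 2.
  apply: (@le_trans _ _ (C * A * 1)); last by rewrite ler_wpM2l// mulr_ge0.
  rewrite mulr1; apply: (@le_trans _ _ (1 * A)); last by rewrite ler_wpM2r.
  by rewrite mul1r lerD2l lerN2; apply: Zni; rewrite ?inE; nra.
have /Zsigma : 0 < r <= r0 by nra.
rewrite -/A => Zr.
have : Z (2 * r) - Z (2 * r * (s / 2)) <= C * (Z (2 * r) - Z (2 * (2 * r))) * (s / 2) `^ q.
  apply: IH; [lra|lra| |]; first by move: sk; rewrite exprS; lra.
  by rewrite (_ : 2 * r * (s / 2) = r * s)//; field.
rewrite (_ : 2 * r * (s / 2) = r * s); last by field.
rewrite (_ : 2 * (2 * r) = 4 * r); last by ring.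
rewrite powRM; [|lra|lra]; rewrite -(@powR_inv1 _ 2)//.
rewrite -powRrM mulN1r powRN.
set x := s `^ q in x1 *; set y := (2 `^ q) in Csigma t0 *.
move=> IH'.
rewrite -[leLHS](subrKA (Z (2 * r))) -/A.
apply: (@le_trans _ _ (A * x + C * (sigma * A) * (x * y^-1))).
  rewrite lerD//; first by rewrite ler_peMr.
  apply: le_trans IH' _; rewrite ler_wpM2r ?mulr_ge0 ?invr_ge0//; try lra.
  by rewrite ler_wpM2l.
rewrite (_ : _ + _ = (C * (sigma / y) + 1) * A * x); last by ring.
by rewrite Csigma.
Qed.
End potter.

(** * The limit h of the normalised quantiles *)

Section gev_inverse.
Context {R : realType}.
Implicit Types gamma s t lambda : R.

Definition gev_inverse gamma s : R :=
  if gamma == 0 then - ln s else (s `^ (- gamma) - 1) / gamma.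

Lemma gev_inverse1 gamma : gev_inverse gamma 1 = 0.
Proof. by rewrite /gev_inverse ln1 oppr0 powR1 subrr mul0r if_same. Qed.

Lemma gev_inverse_dom gamma s : 0 < s -> 0 < 1 + gamma * gev_inverse gamma s.
Proof.
move=> s0; rewrite /gev_inverse; case: eqVneq => [->|g0].
  by rewrite mul0r addr0.
by rewrite mulrC divfK// addrC subrK powR_gt0.
Qed.

Lemma gev_inverseK gamma s : 0 < s -> gev_exponent gamma (gev_inverse gamma s) = s.
Proof.
move=> s0; rewrite /gev_inverse /gev_exponent; case: eqVneq => [_|g0].
  by rewrite opprK lnK.
rewrite (mulrC gamma) divfK// addrC subrK -powRrM mulrNN divff// powRr1//.
exact: ltW.
Qed.

(** This homogeneity is the source of the limiting ratios of dyadic increments: 2^gamma under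
    halving and 2^-gamma under doubling. *)
Lemma gev_inverseB gamma lambda s t : 0 < lambda -> 0 < s -> 0 < t ->
  gev_inverse gamma (lambda * s) - gev_inverse gamma (lambda * t) =
  lambda `^ (- gamma) * (gev_inverse gamma s - gev_inverse gamma t).
Proof.
move=> l0 s0 t0; rewrite /gev_inverse; case: eqVneq => [->|g0].
  by rewrite oppr0 powRr0 mul1r !lnM ?posrE//; ring.
by rewrite !powRM ?ltW//; field.
Qed.

Lemma is_derive_gev_inverse gamma s : 0 < s ->
  is_derive s 1 (gev_inverse gamma) (- s `^ (- gamma - 1)).
Proof.
move=> s0; rewrite /gev_inverse; case: eqVneq => [->|g0].
  have := is_derive1_ln s0.
  rewrite oppr0 sub0r powR_inv1 ?ltW// => ?; exact: is_deriveN.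
have -> : (fun t => (t `^ (- gamma) - 1) / gamma) =
    (fun t => gamma^-1 * (t `^ (- gamma) - cst 1 t)).
  by apply/funext => t; rewrite mulrC.
have := is_derive1Z gamma^-1 (is_derive1B (is_derive1_powR (- gamma) s0) (is_derive_cst (1 : R) s 1)).
by move=> /is_derive_eq; apply; rewrite subr0; field.
Qed.

Lemma gev_inverse_continuous gamma s : 0 < s ->
  {for s, continuous (gev_inverse gamma)}.
Proof.
move=> /(is_derive_gev_inverse gamma) ds.
by apply/differentiable_continuous/derivable1_diffP.
Qed.

Lemma gev_inverse_decr gamma s t : 0 < s -> s < t ->
  gev_inverse gamma t < gev_inverse gamma s.
Proof.
move=> s0 st; have t0 := lt_trans s0 st.
rewrite /gev_inverse; case: eqVneq => [_|g0].
  by rewrite ltrN2 ltr_ln.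
have [g|g] := ltP 0 gamma.
  rewrite ltr_pM2r ?invr_gt0// ltrD2r !powRN ltf_pV2 ?posrE ?powR_gt0//.
  by apply: gt0_ltr_powR; rewrite ?nnegrE ?ltW.
have {g0} g : gamma < 0 by rewrite lt_neqAle g0.
rewrite ltr_nM2r ?invr_lt0// ltrD2r.
by apply: gt0_ltr_powR; rewrite ?oppr_gt0// ?nnegrE ?ltW.
Qed.

End gev_inverse.

Section real_scale.
Context {R : realType}.
Implicit Types gamma s t r p C : R.

Lemma truncV_cvg : Num.trunc r^-1 @[r --> (0 : R)^'+] --> \oo.
Proof.
apply/cvgnyPge => A; near=> r.
have r0 : 0 < r by [].
apply: (leq_trans (leqnSn A)).
rewrite leqNgt truncn_lt_nat ?invr_ge0 ?ltW//.
rewrite -leNgt -[leLHS]invrK lef_pV2 ?posrE ?invr_gt0//.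
by near: r; apply: nbhs_right_le; rewrite invr_gt0.
Unshelve. all: by end_near.
Qed.

(** The hypothesis concerns r = 1/n only, while the dyadic iteration visits arbitrary r. For N the
    integer part of 1/r, the product N r tends to 1 from below, so s r lies between s'/N and s/N for
    any s' < s once r is small. Monotonicity of [Z] and continuity of the limit close the gap
    between s' and s. *)
Lemma real_scale_cvg gamma (Z : R -> R) (a b : nat -> R) :
  {in [pred r | 0 < r] &, {homo Z : x y / x <= y >-> y <= x}} ->
  (\forall n \near \oo, 0 < a n) ->
  (forall s, 0 < s ->
    (Z (s / n%:R) - b n) / a n @[n --> \oo] --> gev_inverse gamma s) ->
  forall s, 0 < s ->
    (Z (s * r) - b (Num.trunc r^-1)) / a (Num.trunc r^-1) @[r --> 0^'+]
      --> gev_inverse gamma s.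
Proof.
move=> Zni a0 hcvg s s0.
have Ncvg := truncV_cvg.
apply/cvgrPdist_lt => /= e e0.
have [s' /andP[s'0 s's] hs'] : exists2 s', 0 < s' < s &
    gev_inverse gamma s' < gev_inverse gamma s + e.
  have /cvgrPdist_lt/(_ e e0) := @gev_inverse_continuous _ gamma _ s0.
  move=> [d /= d0 hd]; exists (s - Num.min (d / 2) (s / 2)).
    by rewrite subr_gt0 gt_min ltrBlDr ltrDl lt_min; lra.
  have := hd (s - Num.min (d / 2) (s / 2)).
  rewrite /ball /= opprB addrC subrK gtr0_norm; last by rewrite lt_min; lra.
  rewrite gt_min; have -> : d / 2 < d by lra.
  move=> /(_ erefl); rewrite ltr_norml => /andP[+ _]; lra.
have hs1 : \forall n \near \oo, gev_inverse gamma s - e < (Z (s / n%:R) - b n) / a n.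
  by apply: (cvgr_gt _ (hcvg s s0)); lra.
have hs2 : \forall n \near \oo, (Z (s' / n%:R) - b n) / a n < gev_inverse gamma s + e.
  exact: (cvgr_lt _ (hcvg s' s'0)).
near=> r.
have r0 : 0 < r by [].
have N0 : (0 < Num.trunc r^-1)%N.
  by near: r; exact: (cvgnyPge _).1 Ncvg 1%N.
have aN : 0 < a (Num.trunc r^-1) by near: r; exact: (Ncvg _ a0).
have hN : gev_inverse gamma s - e <
    (Z (s / (Num.trunc r^-1)%:R) - b (Num.trunc r^-1)) / a (Num.trunc r^-1).
  by near: r; exact: (Ncvg _ hs1).
have hN' : (Z (s' / (Num.trunc r^-1)%:R) - b (Num.trunc r^-1)) / a (Num.trunc r^-1) <
    gev_inverse gamma s + e.
  by near: r; exact: (Ncvg _ hs2).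
set N := Num.trunc r^-1 in N0 aN hN hN' *.
have NR0 : 0 < N%:R :> R by rewrite ltr0n.
have /andP[Nr rN] : N%:R <= r^-1 < N.+1%:R.
  by apply: truncn_itv; rewrite invr_ge0 ltW.
have Nr1 : N%:R * r <= 1 by rewrite -ler_pdivlMr// mul1r.
have Nr2 : 1 < N.+1%:R * r by rewrite -ltr_pdivrMr// mul1r.
have rs : r <= (s - s') / s.
  near: r; apply: nbhs_right_le; rewrite divr_gt0//; lra.
have G1 : gev_inverse gamma s - e < (Z (s * r) - b N) / a N.
  apply: lt_le_trans hN _; rewrite ler_pM2r ?invr_gt0// lerD2r.
  apply: Zni; rewrite ?inE ?mulr_gt0 ?invr_gt0//.
  by rewrite ler_pdivlMr// -mulrA (mulrC r) ler_piMr// ltW.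
have G2 : (Z (s * r) - b N) / a N < gev_inverse gamma s + e.
  apply: le_lt_trans hN'; rewrite ler_pM2r ?invr_gt0// lerD2r.
  apply: Zni; rewrite ?inE ?mulr_gt0 ?invr_gt0// ler_pdivrMr//.
  move: Nr2 rs; rewrite -natr1 ler_pdivlMr//; nra.
by rewrite ltr_norml; apply/andP; split; lra.
Unshelve. all: by end_near.
Qed.
End real_scale.

Section domination.
Context {R : realType}.
Implicit Types gamma s t r p q C : R.

Lemma powR_le_expR q : 0 <= q -> exists2 C : R, 0 <= C &
  forall s, 1 <= s -> s `^ q <= C * expR (s / 16).
Proof.
(* The constant is (16 (q + 1))^q. With t = s / (16 (q + 1)), the inequality ln t <= t gives q ln t
   <= s / 16; using q + 1 keeps the denominator positive at q = 0. *)
move=> q0; exists (expR (q * ln (16 * (q + 1)))); first exact: expR_ge0.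
move=> s s1; rewrite /powR gt_eqF; last lra.
rewrite -expRD ler_expR.
have -> : s = (s / (16 * (q + 1))) * (16 * (q + 1)) by field; lra.
rewrite lnM ?posrE ?divr_gt0; try lra.
set t := s / (16 * (q + 1)).
have t0 : 0 < t by rewrite divr_gt0; lra.
have lnt : ln t <= t.
  have := @le_ln1Dx _ (t - 1); rewrite addrCA subrr addr0; lra.
have : q * ln t <= (q + 1) * t by nra.
by rewrite (mulrDr q); nra.
Qed.

(** The ratios of consecutive increments tend to 2^gamma and 2^-gamma. Choosing p > gamma and q >
    -gamma leaves room for [rho] and [sigma], the midpoints to 2^p and 2^q, to bound these ratios
    for all small r. The positive increment over [r0 / 2, r0] is kept as a unit of comparison for
    arguments beyond [r0]. *)
Lemma gev_dyadic gamma (Z : R -> R) (a b : nat -> R) :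
  gamma < 1 / 2 ->
  {in [pred r | 0 < r] &, {homo Z : x y / x <= y >-> y <= x}} ->
  (\forall n \near \oo, 0 < a n) ->
  (forall s, 0 < s ->
    (Z (s / n%:R) - b n) / a n @[n --> \oo] --> gev_inverse gamma s) ->
  exists p q CR CL r0, [/\ 0 <= p < 1 / 2, 0 <= q, 0 <= CR /\ 0 <= CL &
    [/\ 0 < r0 < 1, 0 < Z (r0 / 2) - Z r0,
      forall r s, 0 < r <= r0 -> 0 < s <= 1 ->
        Z (r * s) - Z r <= CR * (Z r - Z (2 * r)) * s `^ (- p) &
      forall r s, 0 < r -> 1 <= s -> r * s <= r0 ->
        Z r - Z (r * s) <= CL * (Z r - Z (2 * r)) * s `^ q]].
Proof.
move=> gamma12 Zni a0 hcvg.
have Gcvg := real_scale_cvg Zni a0 hcvg.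
pose c1 := gev_inverse gamma 1 - gev_inverse gamma 2.
have c1_gt0 : 0 < c1 by rewrite subr_gt0 gev_inverse_decr//; lra.
have powlt (x y : R) : x < y -> 2 `^ x < 2 `^ y.
  by move=> xy; rewrite /powR gt_eqF// ltr_expR ltr_pM2r// ln_gt0//; lra.
pose p := (Num.max gamma 0 + 1 / 2) / 2.
have [p0 p12 pgamma] : [/\ 0 <= p, p < 1 / 2 & gamma < p].
  have := le_max gamma gamma 0; have := le_max 0 gamma 0; rewrite !lexx orbT/=.
  have : Num.max gamma 0 < 1 / 2 by rewrite gt_max gamma12/=; lra.
  by rewrite /p; split; lra.
pose q := Num.max (- gamma) 0 + 1.
have [q0 qgamma] : 0 <= q /\ - gamma < q.
  have := le_max (- gamma) (- gamma) 0; have := le_max 0 (- gamma) 0.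
  by rewrite !lexx orbT/= /q; split; lra.
pose rho := (2 `^ gamma + 2 `^ p) / 2.
pose sigma := (2 `^ (- gamma) + 2 `^ q) / 2.
have rhogamma : 2 `^ gamma < rho by have := powlt _ _ pgamma; rewrite /rho; lra.
have rhop : 0 <= rho < 2 `^ p.
  have := powlt _ _ pgamma; rewrite /rho; have := powR_ge0 2 gamma; lra.
have sigmagamma : 2 `^ (- gamma) < sigma.
  by have := powlt _ _ qgamma; rewrite /sigma; lra.
have sigmaq : 0 <= sigma < 2 `^ q.
  have := powlt _ _ qgamma; rewrite /sigma; have := powR_ge0 2 (- gamma); lra.
have small : \forall r \near 0^'+, [/\ r < 1, 0 < Z r - Z (2 * r),
    Z (r / 2) - Z r <= rho * (Z r - Z (2 * r)) &
    Z (2 * r) - Z (4 * r) <= sigma * (Z r - Z (2 * r))].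
  pose N r := Num.trunc r^-1.
  (* In differences of [G] the centring cancels, and the common factor 1 / a (N r) is positive, so
     strict inequalities between limits of [G] become inequalities between increments of [Z]. *)
  pose G s r := (Z (s * r) - b (N r)) / a (N r).
  have G12 : G 1 r - G 2 r @[r --> 0^'+] --> c1.
    by apply: cvgB; apply: Gcvg.
  have lim1 : rho * (G 1 r - G 2 r) - (G 2^-1 r - G 1 r) @[r --> 0^'+] -->
      rho * c1 - 2 `^ gamma * c1.
    rewrite -[X in _ - X * _](_ : 2^-1 `^ (- gamma) = 2 `^ gamma); last first.
      by rewrite -powR_inv1// -powRrM mulN1r opprK.
    rewrite /c1 -gev_inverseB//; try lra.
    rewrite mulr1 mulVf//; apply: cvgB; first exact: cvgMr.
    by apply: cvgB; apply: Gcvg.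
  have lim2 : sigma * (G 1 r - G 2 r) - (G 2 r - G 4 r) @[r --> 0^'+] -->
      sigma * c1 - 2 `^ (- gamma) * c1.
    rewrite {2}/c1 -gev_inverseB//; try lra.
    rewrite mulr1 -natrM; apply: cvgB; first exact: cvgMr.
    by apply: cvgB; apply: Gcvg.
  near=> r.
  have r0 : 0 < r by [].
  have aN : 0 < a (N r).
    by near: r; exact: (@truncV_cvg R _ a0).
  have e1 : 0 < G 1 r - G 2 r.
    by near: r; apply: (cvgr_gt _ G12).
  have e2 : 0 < rho * (G 1 r - G 2 r) - (G 2^-1 r - G 1 r).
    by near: r; apply: (cvgr_gt _ lim1); rewrite -mulrBl mulr_gt0// subr_gt0.
  have e3 : 0 < sigma * (G 1 r - G 2 r) - (G 2 r - G 4 r).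
    by near: r; apply: (cvgr_gt _ lim2); rewrite -mulrBl mulr_gt0// subr_gt0.
  have GB s t : G s r - G t r = (Z (s * r) - Z (t * r)) / a (N r).
    by rewrite /G -mulrBl; congr (_ / _); ring.
  move: e1 e2 e3; rewrite !GB mul1r !mulrA -!mulrBl !pmulr_lgt0 ?invr_gt0//.
  rewrite !subr_gt0 (mulrC 2^-1) => e1 e2 e3; split; [|exact: e1|exact: ltW|exact: ltW].
  by near: r; apply: nbhs_right_lt.
have [r0 /= r0_gt0 {}small] : exists2 r0 : R, 0 < r0 & forall r, 0 < r <= r0 ->
    [/\ r < 1, 0 < Z r - Z (2 * r),
    Z (r / 2) - Z r <= rho * (Z r - Z (2 * r)) &
    Z (2 * r) - Z (4 * r) <= sigma * (Z r - Z (2 * r))].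
  move: small => [e /= e0 He]; exists (e / 2); first lra.
  move=> r /andP[r_gt0 re]; apply: He => //.
  by rewrite /ball/= sub0r normrN gtr0_norm//; lra.
have [CR CR0 HR] : exists2 C : R, 0 <= C & forall r s, 0 < r <= r0 -> 0 < s <= 1 ->
    Z (r * s) - Z r <= C * (Z r - Z (2 * r)) * s `^ (- p).
  by apply: (@dyadic_right _ _ _ rho) => // r /small[].
have [CL CL0 HL] : exists2 C : R, 0 <= C & forall r s, 0 < r -> 1 <= s -> r * s <= r0 ->
    Z r - Z (r * s) <= C * (Z r - Z (2 * r)) * s `^ q.
  by apply: (@dyadic_left _ _ _ sigma) => // r /small[].
exists p, q, CR, CL, r0; split => //; first by rewrite p0.
split => //.
  by rewrite r0_gt0/=; have [|] := small r0; first by rewrite r0_gt0 lexx.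
have [|_] := small (r0 / 2); first lra.
by rewrite (_ : 2 * (r0 / 2) = r0) => [?|]; [|field].
Unshelve. all: by end_near.
Qed.

(** * Domination for one fixed n, with x = 1/n and A = a(n) *)

Section pointwise_domination.
Context (Z : R -> R) (p q CR CL r0 K Q D A x : R).
Context (Zni : {in [pred r | 0 < r] &, {homo Z : x y / x <= y >-> y <= x}})
  (HR : forall r s, 0 < r <= r0 -> 0 < s <= 1 ->
     Z (r * s) - Z r <= CR * (Z r - Z (2 * r)) * s `^ (- p))
  (HL : forall r s, 0 < r -> 1 <= s -> r * s <= r0 ->
     Z r - Z (r * s) <= CL * (Z r - Z (2 * r)) * s `^ q)
  (HQ : forall s, 1 <= s -> s `^ q <= Q * expR (s / 16))
  (HK : forall u, r0 <= u -> `|Z u| <= K * expR (u / 2))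
  (q0 : 0 <= q) (CR0 : 0 <= CR) (CL0 : 0 <= CL) (K0 : 0 <= K) (Q0 : 0 <= Q)
  (D0 : 0 <= D) (A0 : 0 < A) (x0 : 0 < x) (x8 : x <= 1 / 8) (xr0 : x <= r0 / 2)
  (r0_gt0 : 0 < r0) (delta0 : 0 < Z (r0 / 2) - Z r0)
  (ZD : Z x - Z (2 * x) <= D * A).

Lemma right_domination s : 0 < s <= 1 ->
  Z (x * s) - Z x <= CR * D * s `^ (- p) * A.
Proof.
move=> s01; have xr : 0 < x <= r0 by move: x0 xr0 r0_gt0; lra.
apply: le_trans (HR xr s01) _.
rewrite [leRHS](_ : _ = CR * (D * A) * s `^ (- p)); last by ring.
by rewrite ler_wpM2r ?powR_ge0// ler_wpM2l.
Qed.

Lemma left_domination s : 1 <= s -> x * s <= r0 ->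
  Z x - Z (x * s) <= CL * D * s `^ q * A.
Proof.
move=> s1 xs; apply: le_trans (HL x0 s1 xs) _.
rewrite [leRHS](_ : _ = CL * (D * A) * s `^ q); last by ring.
by rewrite ler_wpM2r ?powR_ge0// ler_wpM2l.
Qed.

Let delta := Z (r0 / 2) - Z r0.

(* Beyond [r0] the regular variation of [Z] at 0 says nothing; there the
   a priori bound [HK] is compared with the increment [delta > 0] of [Z] over
   [r0 / 2, r0], which is itself controlled by [left_domination]. *)
Lemma far_domination s : r0 < x * s ->
  Z x - Z (x * s) <= CL * D * Q * (1 + 2 * K / delta) * expR (s / 8) * A.
Proof.
move=> rs.
pose t := r0 / x; have xt : x * t = r0 by rewrite /t mulrCA divff ?mulr1// gt_eqF.
have ts : t < s by rewrite /t ltr_pdivrMr// mulrC.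
have t2 : 2 <= t by rewrite /t ler_pdivlMr//; move: xr0; lra.
have t1 : 1 <= t by apply: le_trans t2; lra.
have t0 : 0 <= t by apply: le_trans t1.
have s1 : 1 <= s by exact: le_trans t1 (ltW ts).
have s0 : 0 <= s by exact: le_trans t0 (ltW ts).
have E0 : 0 <= CL * D * s `^ q * A by rewrite !mulr_ge0 ?powR_ge0// ltW.
have Hr0 : Z x - Z r0 <= CL * D * s `^ q * A.
  rewrite -xt; apply: le_trans (left_domination t1 _) _; first by rewrite xt.
  rewrite ler_pM2r//; apply: ler_wpM2l; first exact: mulr_ge0.
  by apply: ge0_ler_powR; rewrite ?nnegrE// ltW.
have dE : delta <= CL * D * s `^ q * A.
  by apply: le_trans Hr0; rewrite lerD2r; apply: Zni; rewrite ?inE ?divr_gt0.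
(* Here [x <= 1 / 8] pays for the a priori growth with exp (s/16) only, leaving the other half of
   exp (s/8) for s^q. *)
have eu : expR (x * s / 2) <= expR (s / 16).
  rewrite ler_expR; have := ler_wpM2r s0 x8; lra.
have er0 : expR (r0 / 2) <= expR (x * s / 2).
  by rewrite ler_expR ler_pM2r// ltW.
have Zs : Z r0 - Z (x * s) <= 2 * K * expR (s / 16).
  have := HK (ltW rs); have := HK (lexx r0).
  have := ler_wpM2l K0 (le_trans er0 eu); have := ler_wpM2l K0 eu.
  have := ler_norm (Z r0); have := ler_norm (- Z (x * s)); rewrite normrN.
  lra.
have Kd : 0 <= 2 * K / delta by rewrite divr_ge0 ?mulr_ge0// ltW.
have e1 : 1 <= expR (s / 16).
  by apply: le_trans (expR_ge1Dx _); rewrite lerDl divr_ge0.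
have E1 : 2 * K * expR (s / 16) <= 2 * K / delta * expR (s / 16) * (CL * D * s `^ q * A).
  rewrite [leRHS](_ : _ = 2 * K * expR (s / 16) * (CL * D * s `^ q * A / delta)); last by ring.
  apply: ler_peMr; first by rewrite mulr_ge0 ?expR_ge0// mulr_ge0.
  by rewrite ler_pdivlMr// mul1r.
apply: (@le_trans _ _ ((1 + 2 * K / delta * expR (s / 16)) * (CL * D * s `^ q * A))).
  rewrite mulrDl mul1r -(subrKA (Z r0)) lerD//; exact: le_trans Zs E1.
apply: (@le_trans _ _ ((1 + 2 * K / delta) * expR (s / 16) * (CL * D * (Q * expR (s / 16)) * A))).
  apply: ler_pM => //.
  - by rewrite addr_ge0// mulr_ge0// expR_ge0.
  - by rewrite [leRHS]mulrDl mul1r lerD2r.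
  - rewrite ler_pM2r//; apply: ler_wpM2l; [exact: mulr_ge0|exact: HQ].
rewrite le_eqVlt; apply/orP; left; apply/eqP.
have -> : s / 8 = s / 16 + s / 16 by field.
by rewrite expRD; ring.
Qed.

(** Three ranges of s: below 1 the power s^-p governs; from 1 to r0 / x the power s^q, absorbed by
    the exponential; beyond that [far_domination]. The constants are added so that one bound covers
    all ranges. *)
Lemma pointwise_domination s : 0 < s -> `|Z (x * s) - Z x| <=
  (CR * D + CL * D * Q * (1 + 2 * K / delta)) * (s `^ (- p) + expR (s / 8)) * A.
Proof.
move=> s0; rewrite mulrAC mulrDr.
have Kd : 0 <= 2 * K / delta by rewrite divr_ge0 ?mulr_ge0// ltW.
have P0 : 0 <= CR * D by rewrite mulr_ge0.
have Q1 : 0 <= CL * D * Q * (1 + 2 * K / delta) by rewrite !mulr_ge0// addr_ge0.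
set B := _ * (1 + _) in Q1 *.
have e0 : 0 <= expR (s / 8) by exact: expR_ge0.
have xs0 : 0 < x * s by exact: mulr_gt0.
have ps : 0 <= s `^ (- p) by exact: powR_ge0.
have A0' := ltW A0.
have B1 : B * expR (s / 8) * A <= (CR * D + B) * A * s `^ (- p) + (CR * D + B) * A * expR (s / 8).
  have := mulr_ge0 (mulr_ge0 (addr_ge0 P0 Q1) A0') ps.
  have := mulr_ge0 (mulr_ge0 P0 A0') e0.
  by lra.
have [s1|s1] := leP s 1.
  rewrite ger0_norm; last first.
    by rewrite subr_ge0; apply: Zni; rewrite ?inE// ler_piMr// ltW.
  have := right_domination (_ : 0 < s <= 1); rewrite s0 s1 => /(_ isT).
  have := mulr_ge0 (mulr_ge0 Q1 A0') ps.
  have := mulr_ge0 (mulr_ge0 (addr_ge0 P0 Q1) A0') e0.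
  by lra.
rewrite distrC ger0_norm; last first.
  by rewrite subr_ge0; apply: Zni; rewrite ?inE// ler_peMr// ltW.
apply: le_trans B1; have [xs|xs] := leP (x * s) r0; last exact: far_domination.
apply: le_trans (left_domination (ltW s1) xs) _; rewrite ler_pM2r// /B.
rewrite -[leRHS](_ : CL * D * (Q * ((1 + 2 * K / delta) * expR (s / 8))) = _); last by ring.
apply: ler_wpM2l; first exact: mulr_ge0.
apply: le_trans (HQ (ltW s1)) _; apply: ler_wpM2l => //.
apply: (@le_trans _ _ (expR (s / 8))); last by rewrite ler_peMl// lerDl.
by rewrite ler_expR; move: (ltW s0); lra.
Qed.

End pointwise_domination.

(** [pointwise_domination] measures from Z(1/n), not from b(n). The difference is harmless because
    (Z(1/n) - b n) / a n tends to h(1) = 0. Convergence at s = 1 and s = 2 also bounds the increment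
    Z(1/n) - Z(2/n) by [D * a n], with [D] one more than the limit. *)
Lemma gev_domination gamma (Z : R -> R) (a b : nat -> R) (K : R) :
  gamma < 1 / 2 ->
  {in [pred r | 0 < r] &, {homo Z : x y / x <= y >-> y <= x}} ->
  (forall u, 1 <= u -> `|Z u| <= K * expR (u / 2)) ->
  (\forall n \near \oo, 0 < a n) ->
  (forall s, 0 < s ->
    (Z (s / n%:R) - b n) / a n @[n --> \oo] --> gev_inverse gamma s) ->
  exists p C, [/\ 0 <= p < 1 / 2, 0 <= C & \forall n \near \oo, forall s, 0 < s ->
    `|(Z (s / n%:R) - b n) / a n| <= C * (s `^ (- p) + expR (s / 8))].
Proof.
move=> gamma12 Zni ZK a0 hcvg.
have [p [q [CR [CL [r0 [/andP[p0 p12] q0 [CR0 CL0] [/andP[r0_gt0 r01]]]]]]]] :=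
  gev_dyadic gamma12 Zni a0 hcvg.
set delta := Z (r0 / 2) - Z r0 => delta0 HR HL.
pose c1 := gev_inverse gamma 1 - gev_inverse gamma 2.
have c1_gt0 : 0 < c1 by rewrite subr_gt0 gev_inverse_decr//; lra.
have [Q Q0 HQ] := powR_le_expR q0.
pose D := c1 + 1.
have D0 : 0 < D by rewrite /D; lra.
(* Since [r0 < 1], the bound assumed from 1 on is extended down to [r0], where monotonicity keeps
   [Z] between Z 1 and Z r0. *)
pose K' := `|K| + `|Z r0| + `|Z 1|.
have ZK' u : r0 <= u -> `|Z u| <= K' * expR (u / 2).
  move=> ru; have eu : 1 <= expR (u / 2).
    by apply: le_trans (expR_ge1Dx _); lra.
  have [u1|u1] := leP 1 u.
    apply: le_trans (ZK u u1) _; rewrite ler_wpM2r ?expR_ge0// /K'.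
    by have := ler_norm K; have := normr_ge0 (Z r0); have := normr_ge0 (Z 1); lra.
  have : Z u <= Z r0 by apply: Zni; rewrite ?inE//; lra.
  have : Z 1 <= Z u by apply: Zni; rewrite ?inE//; lra.
  move=> h1 h2; apply: (@le_trans _ _ K').
    rewrite /K' ler_norml; have := ler_norm (Z r0); have := ler_norm (- Z 1).
    by rewrite normrN; have := normr_ge0 K; have := normr_ge0 (Z r0);
      have := normr_ge0 (Z 1); lra.
  by rewrite ler_peMr// /K' !addr_ge0.
have K'0 : 0 <= K' by rewrite /K' !addr_ge0.
exists p, (1 + CR * D + CL * D * Q * (1 + 2 * K' / delta)).
have C0 : 0 <= CL * D * Q * (1 + 2 * K' / delta).
  have : 0 <= 2 * K' / delta by rewrite divr_ge0//; lra.
  by move=> ?; rewrite !mulr_ge0//; lra.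
split; [by rewrite p0|by rewrite !addr_ge0// mulr_ge0// ltW|].
have near1 : \forall n \near \oo, `|(Z (1 / n%:R) - b n) / a n| <= 1.
  by have := hcvg 1 ltr01; rewrite gev_inverse1 => /cvgr0Pnorm_le/(_ 1 ltr01).
have near12 : \forall n \near \oo,
    (Z (1 / n%:R) - b n) / a n - (Z (2 / n%:R) - b n) / a n <= D.
  by apply: (@cvgr_le _ _ _ _ _ c1); [apply: cvgB; apply: hcvg|rewrite /D; lra].
near=> n => s s0.
have an : 0 < a n by near: n.
have nr0 : 2 / r0 <= n%:R by near: n; exact: nbhs_infty_ger.
have n8 : 8%:R <= n%:R :> R by near: n; exact: nbhs_infty_ger.
have n_gt0 : 0 < n%:R :> R by apply: lt_le_trans n8.
have h1 : `|(Z (1 / n%:R) - b n) / a n| <= 1 by near: n; exact: near1.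
have h12 : (Z (1 / n%:R) - b n) / a n - (Z (2 / n%:R) - b n) / a n <= D.
  by near: n; exact: near12.
have n0 : 0 < n%:R^-1 :> R by rewrite invr_gt0.
have n1 : n%:R^-1 <= r0 / 2.
  by rewrite -[leRHS]invrK lef_pV2 ?posrE ?invr_gt0 ?divr_gt0// invf_div.
have n2 : n%:R^-1 <= 1 / 8 :> R by rewrite mul1r lef_pV2 ?posrE.
have Zan : Z n%:R^-1 - Z (2 * n%:R^-1) <= D * a n.
  move: h12; rewrite -mulrBl ler_pdivrMr// mul1r.
  by rewrite (_ : _ - b n - _ = Z n%:R^-1 - Z (2 * n%:R^-1))//; ring.
have := pointwise_domination Zni HR HL HQ ZK' q0 CR0 CL0 K'0 Q0 (ltW D0) an n0 n2 n1
  r0_gt0 delta0 Zan s0.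
rewrite -/delta -ler_pdivrMr// -{1}(gtr0_norm an) -normrV ?unitfE ?gt_eqF//.
rewrite -normrM (mulrC _ s) => H.
have -> : (Z (s / n%:R) - b n) / a n =
    (Z (s / n%:R) - Z n%:R^-1) / a n + (Z (1 / n%:R) - b n) / a n.
  by rewrite -mulrDl mul1r; congr (_ / _); ring.
apply: le_trans (ler_normD _ _) _.
have es : 1 <= expR (s / 8).
  by apply: le_trans (expR_ge1Dx _); rewrite lerDl divr_ge0// ltW.
have ps : 0 <= s `^ (- p) by exact: powR_ge0.
move: H h1 es ps; set c2 := CR * D + _; rewrite -addrA -/c2.
by clear; move: c2 (_ `^ _) (expR _) (`| _ |) (`| _ |) => *; lra.
Unshelve. all: by end_near.
Qed.
End domination.

(** * The Basel sum *)

Section ftc_wrappers.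
Context {R : realType}.
Notation mu := (@lebesgue_measure R).

Lemma FTC2_is_derive (f F : R -> R) (a b : R) : a < b ->
  (forall x, a <= x <= b -> is_derive x 1 F (f x)) ->
  (forall x, a <= x <= b -> {for x, continuous f}) ->
  (\int[mu]_(x in `[a, b]) (f x)%:E = (F b - F a)%:E)%E.
Proof.
move=> ab dF cf.
have Fc x : a <= x <= b -> {for x, continuous F}.
  by move=> /dF; exact: is_derive1_continuous.
rewrite (@continuous_FTC2 _ f F)//.
- apply: continuous_in_subspaceT => x /[!inE]/=.
  by rewrite in_itv/=; exact: cf.
- split.
  + by move=> x; rewrite in_itv/= => /andP[ax xb]; apply: (is_derive1E (dF x _)).2; rewrite !ltW.
  + by apply: cvg_at_right_filter; apply: Fc; rewrite lexx ltW.
  + by apply: cvg_at_left_filter; apply: Fc; rewrite lexx ltW.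
- move=> x; rewrite in_itv/= => /andP[ax xb].
  by rewrite (is_derive1E (dF x _)).1// !ltW.
Qed.
End ftc_wrappers.

Section basel.
Context {R : realType}.
Notation mu := (@lebesgue_measure R).
Let D : set R := `[0, pi / 2]%classic.

Definition wallis n : R := \int[mu]_(x in D) cos x ^+ n.*2.
Definition wallis2 n : R := \int[mu]_(x in D) (x ^+ 2 * cos x ^+ n.*2).

Let integrable_cont (f : R -> R) : continuous f -> mu.-integrable D (EFin \o f).
Proof.
move=> cf; apply: continuous_compact_integrable; first exact: segment_compact.
exact: continuous_subspaceT.
Qed.

Let mD : measurable D. Proof. exact: measurable_itv. Qed.

Let pi2 : 0 < pi / 2 :> R. Proof. by rewrite divr_gt0// pi_gt0. Qed.

Let dcosX n (x : R) : is_derive x 1 (fun x : R => cos x ^+ n) (n%:R * cos x ^+ n.-1 * - sin x).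
Proof. by apply: is_derive1X. Qed.

Let dX (x : R) : is_derive x 1 (fun x : R => x ^+ 2) (2 * x).
Proof. by have := is_derive1X 2 (is_derive_id x (1 : R)); rewrite expr1 mulr1. Qed.

Let ccosX n : continuous (fun x : R => cos x ^+ n).
Proof. by move=> x; apply: is_derive1_continuous. Qed.

Let cX : continuous (fun x : R => x ^+ 2).
Proof. by move=> x; apply: is_derive1_continuous. Qed.

Let Rint_FTC (f F : R -> R) : (forall x : R, is_derive x 1 F (f x)) -> continuous f ->
  \int[mu]_(x in D) f x = F (pi / 2) - F 0.
Proof.
move=> dF cf; rewrite /Rintegral (FTC2_is_derive pi2)//.
by move=> x _; exact: cf.
Qed.

Lemma wallis0 : wallis 0 = pi / 2.
Proof.
have dF (x : R) : is_derive x 1 id (cos x ^+ 0.*2) by rewrite expr0; exact: is_derive_id.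
by rewrite /wallis (Rint_FTC dF) ?subr0.
Qed.

Lemma wallis20 : wallis2 0 = (pi / 2) ^+ 3 / 3.
Proof.
have dF (x : R) : is_derive x 1 (fun x : R => 3^-1 * x ^+ 3) (x ^+ 2 * cos x ^+ 0.*2).
  have := is_derive1Z 3^-1 (is_derive1X 3 (is_derive_id x (1 : R))).
  by move/is_derive_eq; apply; rewrite /=; field.
rewrite /wallis2 (Rint_FTC dF); first by rewrite expr0n/= mulr0 subr0 mulrC.
by move=> x; apply: cvgM; [exact: cX|exact: ccosX].
Qed.

(** The combined integrand has the primitive sin x cos^(2n+1) x, which vanishes at 0 and at pi/2. *)
Lemma wallisS n : (n.*2.+2)%:R * wallis n.+1 = (n.*2.+1)%:R * wallis n.
Proof.
have : \int[mu]_(x in D) ((n.*2.+2)%:R * cos x ^+ n.*2.+2 - (n.*2.+1)%:R * cos x ^+ n.*2) = 0.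
  have dF (x : R) : is_derive x 1 (fun x : R => sin x * cos x ^+ n.*2.+1)
      ((n.*2.+2)%:R * cos x ^+ n.*2.+2 - (n.*2.+1)%:R * cos x ^+ n.*2).
    have := is_derive1M (is_derive_sin x) (dcosX n.*2.+1 x).
    move/is_derive_eq; apply; rewrite /= -!natr1 !exprS.
    have := cos2Dsin2 x; rewrite addrC => /(canRL (addrK _)).
    rewrite !expr2 => s2; set C := cos x ^+ n.*2.
    have : sin x * sin x * (n.*2%:R * C + C) = (1 - cos x * cos x) * (n.*2%:R * C + C).
      by rewrite s2.
    lra.
  rewrite (Rint_FTC dF).
  - by rewrite cos_pihalf sin0 expr0n/= mulr0 mul0r subrr.
  - move=> x; apply: cvgB; apply: cvgM; try exact: cvg_cst; exact: ccosX.
rewrite RintegralB//; last 2 first.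
- by apply: integrable_cont => x; apply: cvgM; [exact: cvg_cst|exact: ccosX].
- by apply: integrable_cont => x; apply: cvgM; [exact: cvg_cst|exact: ccosX].
rewrite !RintegralZl//; try by apply: integrable_cont; exact: ccosX.
by move/eqP; rewrite subr_eq0 => /eqP.
Qed.

Lemma wallis_gt0 n : 0 < wallis n.
Proof.
elim: n => [|n IH]; first by rewrite wallis0.
have := wallisS n; have : 0 < (n.*2.+2)%:R :> R by [].
have : 0 < (n.*2.+1)%:R * wallis n by rewrite mulr_gt0.
by move=> h1 h2 h3; move: h1; rewrite -h3 pmulr_rgt0.
Qed.

(** Two integrations by parts at once: the primitive is x cos^(2n+2) x + (n+1) x^2 sin x cos^(2n+1)
    x. Its mixed terms in x sin x cos^(2n+1) x cancel on differentiation, and it vanishes at both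
    ends. *)
Lemma wallis2S n :
  n.+1%:R * (n.*2.+1)%:R * wallis2 n - 2 * n.+1%:R ^+ 2 * wallis2 n.+1 = wallis n.+1.
Proof.
have cJ k : continuous (fun x : R => x ^+ 2 * cos x ^+ k).
  by move=> x; apply: cvgM; [exact: cX|exact: ccosX].
have : \int[mu]_(x in D) (cos x ^+ n.*2.+2 + (2 * n.+1%:R ^+ 2 * (x ^+ 2 * cos x ^+ n.*2.+2)
     - n.+1%:R * (n.*2.+1)%:R * (x ^+ 2 * cos x ^+ n.*2))) = 0.
  have dF (x : R) : is_derive x 1 (fun x : R => x * cos x ^+ n.*2.+2 +
      n.+1%:R * (x ^+ 2 * (sin x * cos x ^+ n.*2.+1)))
      (cos x ^+ n.*2.+2 + (2 * n.+1%:R ^+ 2 * (x ^+ 2 * cos x ^+ n.*2.+2)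
     - n.+1%:R * (n.*2.+1)%:R * (x ^+ 2 * cos x ^+ n.*2))).
    have d1 := is_derive1M (is_derive_id x (1 : R)) (dcosX n.*2.+2 x).
    have d2 := is_derive1M (is_derive_sin x) (dcosX n.*2.+1 x).
    have := is_derive1D d1 (is_derive1Z n.+1%:R (is_derive1M (dX x) d2)).
    move/is_derive_eq; apply; rewrite /= -!natr1 -!muln2 !natrM !exprS.
    have := cos2Dsin2 x; rewrite addrC => /(canRL (addrK _)).
    rewrite !expr2 => s2; set c := cos x in s2 *; set C := c ^+ _.
    have : sin x * sin x * (n%:R * C * x * x * (n%:R + 1)) = (1 - c * c) * (n%:R * C * x * x * (n%:R + 1)).
      by rewrite s2.
    have : sin x * sin x * (C * x * x * (n%:R + 1)) = (1 - c * c) * (C * x * x * (n%:R + 1)).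
      by rewrite s2.
    lra.
  rewrite (Rint_FTC dF).
  - by rewrite cos_pihalf sin0 !expr0n/= !(mulr0, mul0r) subrr.
  - by move=> x; apply: cvgD; [exact: ccosX|apply: cvgB; apply: cvgM;
      [exact: cvg_cst|exact: cJ|exact: cvg_cst|exact: cJ]].
have iJ c k : mu.-integrable D (EFin \o (fun x : R => c * (x ^+ 2 * cos x ^+ k))).
  by apply: integrable_cont => x; apply: cvgM; [exact: cvg_cst|exact: cJ].
rewrite RintegralD//; last 2 first.
- exact: integrable_cont.
- by apply: integrable_cont => x; apply: cvgB; apply: cvgM; (try exact: cvg_cst); exact: cJ.
rewrite RintegralB; [|exact: measurable_itv|exact: iJ|exact: iJ].
rewrite !RintegralZl//; try exact: integrable_cont.
by rewrite -/(wallis n.+1) -/(wallis2 n.+1) -/(wallis2 n); lra.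
Qed.

(** This is x <= tan x, multiplied by cos x to include pi/2; the difference sin x - x cos x has
    derivative x sin x. *)
Lemma x_cos_le_sin (x : R) : 0 <= x <= pi / 2 -> 0 <= x * cos x <= sin x.
Proof.
move=> /andP[x0 xpi].
have cx : 0 <= cos x.
  by apply: cos_ge0_pihalf; rewrite xpi andbT; lra.
rewrite mulr_ge0//=.
move: x0; rewrite le_eqVlt => /predU1P[<-|x0]; first by rewrite mul0r sin0.
have dF (y : R) : is_derive y 1 (fun x : R => sin x - x * cos x) (y * sin y).
  have := is_derive1B (is_derive_sin y) (is_derive1M (is_derive_id y (1 : R)) (is_derive_cos y)).
  by move/is_derive_eq; apply; rewrite /=; ring.
have [y] := @MVT _ (fun x => sin x - x * cos x) (fun y => y * sin y) _ _ x0
  (fun y _ => dF y) (continuous_subspaceT (fun y => is_derive1_continuous (dF y))).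
rewrite in_itv/= sin0 mul0r !subr0 => /andP[y0 yx] e.
rewrite -subr_ge0 e; apply: mulr_ge0; last exact: ltW.
apply: mulr_ge0; first exact: ltW.
by apply: sin_ge0_pi; rewrite (ltW y0)/=; have := pi_gt0 R; lra.
Qed.

(** By [x_cos_le_sin], x^2 cos^(2n+2) x <= sin^2 x cos^(2n) x, whose integral is a difference of
    consecutive Wallis integrals and is evaluated by [wallisS]. *)
Lemma wallis2_le n : wallis2 n.+1 <= wallis n.+1 / (n.*2.+1)%:R.
Proof.
have -> : wallis n.+1 / (n.*2.+1)%:R = wallis n - wallis n.+1.
  apply: (@mulfI _ (n.*2.+1)%:R) => //; rewrite mulrBr -wallisS mulrC divfK//.
  have -> : n.*2.+2%:R = n.*2.+1%:R + 1 :> R by rewrite natr1.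
  by ring.
rewrite /wallis /wallis2 -RintegralB//; last 2 first.
- exact: integrable_cont.
- exact: integrable_cont.
apply: le_Rintegral.
- exact: measurable_itv.
- by apply: integrable_cont => x; apply: cvgM; [exact: cX|exact: ccosX].
- by apply: integrable_cont => x; apply: cvgB; exact: ccosX.
- move=> x; rewrite /D /= in_itv/= => x0pi.
  have /andP[h1 h2] := x_cos_le_sin x0pi.
  rewrite doubleS (exprS _ n.*2.+1) (exprS _ n.*2); set C := cos x ^+ n.*2.
  have C0 : 0 <= C by rewrite /C -mul2n exprM exprn_ge0// sqr_ge0.
  have : (x * cos x) ^+ 2 <= sin x ^+ 2 by rewrite ler_sqr ?nnegrE//; lra.
  rewrite -[leRHS](addKr (cos x ^+ 2)) cos2Dsin2 => h.
  have -> : x ^+ 2 * (cos x * (cos x * C)) = (x * cos x) ^+ 2 * C by ring.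
  have -> : C - cos x * (cos x * C) = (- cos x ^+ 2 + 1) * C by ring.
  by rewrite ler_wpM2r.
Qed.

(* Matsuoka's sequence [2 * wallis2 n / wallis n] satisfies the same recurrence
   and also tends to 0, so both sequences agree at 0. *)
Lemma basel_recurrence (v : nat -> R) :
  (forall n, v n - v n.+1 = n.+1%:R ^- 2) -> v n @[n --> \oo] --> (0 : R) ->
  v 0%N = pi ^+ 2 / 6.
Proof.
move=> vS v0; pose w n := 2 * wallis2 n / wallis n.
have wS n : w n - w n.+1 = n.+1%:R ^- 2.
  have In := wallis_gt0 n.+1; have h1 := wallis2S n; have h2 := wallisS n.
  have n1 : n.*2.+1%:R != 0 :> R by [].
  have n2 : n.*2.+2%:R = 2 * n.+1%:R :> R by rewrite -natrM mul2n doubleS.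
  rewrite /w; have -> : wallis n = 2 * n.+1%:R * wallis n.+1 / n.*2.+1%:R.
    by rewrite -n2 h2 mulrC mulKf.
  move: h1 => /(canRL (subrK _)) h1.
  have n3 : n.+1%:R != 0 :> R by [].
  have I0 : wallis n.+1 != 0 by rewrite gt_eqF.
  have : wallis2 n = (wallis n.+1 + 2 * n.+1%:R ^+ 2 * wallis2 n.+1) / (n.+1%:R * n.*2.+1%:R).
    by rewrite -h1 mulrC mulKf// mulf_neq0.
  move=> ->; move: n1 n3 I0.
  move: (n.*2.+1%:R) (n.+1%:R) (wallis n.+1) (wallis2 n.+1) => A B I J A0 B0 I0.
  by field; rewrite I0 A0 B0.
have w0 : w n @[n --> \oo] --> (0 : R).
  rewrite -cvg_shiftS /=.
  apply: (@squeeze_cvgr _ _ _ _ (cst 0) (fun n => 2 * n.+1%:R^-1)).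
  - near=> n; have In := wallis_gt0 n.+1.
    apply/andP; split.
      rewrite /w divr_ge0 ?(ltW In)// mulr_ge0//.
      apply: Rintegral_ge0 => x _; rewrite mulr_ge0 ?sqr_ge0//.
      by rewrite -mul2n exprM exprn_ge0// sqr_ge0.
    rewrite /w -mulrA ler_pM2l// ler_pdivrMr//.
    apply: le_trans (wallis2_le n) _; rewrite mulrC ler_pM2r// lef_pV2 ?posrE//.
    by rewrite ler_nat ltnS -addnn leq_addr.
  - exact: cvg_cst.
  - by rewrite -[X in _ --> X](mulr0 2); apply: cvgM; [exact: cvg_cst|exact: cvg_harmonic].
have vw n : v 0%N - w 0%N = v n - w n.
  elim: n => // n ->; have := vS n; rewrite -wS; lra.
have : v n - w n @[n --> \oo] --> v 0%N - w 0%N.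
  by under eq_fun do rewrite -vw; exact: cvg_cst.
have : v n - w n @[n --> \oo] --> (0 - 0 : R) by exact: cvgB.
move=> /cvg_unique h /h{h}; rewrite subrr => /(_ (@Rhausdorff R))/esym/eqP.
rewrite subr_eq0 => /eqP ->; rewrite /w wallis0 wallis20.
have /gt_eqF/negbT := pi_gt0 R; move: (pi : R) => q q0.
by field.
Unshelve. all: by end_near.
Qed.
End basel.

(** * Improper integrals *)

Section real_integrable.
Context d (T : measurableType d) (R : realType) (mu : {measure set T -> \bar R}).
Context (D : set T) (mD : measurable D).
Implicit Types f g : T -> R.

Lemma integrable_RZ c f : mu.-integrable D (EFin \o f) ->
  mu.-integrable D (EFin \o (fun x => c * f x)).
Proof. by move=> fi; exact: (integrableZl mD c fi). Qed.

Lemma integrable_RD f g : mu.-integrable D (EFin \o f) ->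
  mu.-integrable D (EFin \o g) -> mu.-integrable D (EFin \o (fun x => f x + g x)).
Proof. by move=> fi gi; exact: (integrableD mD fi gi). Qed.

Lemma integrable_RB f g : mu.-integrable D (EFin \o f) ->
  mu.-integrable D (EFin \o g) -> mu.-integrable D (EFin \o (fun x => f x - g x)).
Proof. by move=> fi gi; exact: (integrableB mD fi gi). Qed.

Lemma integrable_dominated f g : measurable_fun D f ->
  (forall x, D x -> `|f x| <= g x) -> mu.-integrable D (EFin \o g) ->
  mu.-integrable D (EFin \o f).
Proof.
move=> mf fg; apply: le_integrable => //; first exact/measurable_EFinP.
move=> x Dx /=; rewrite lee_fin; apply: le_trans (fg x Dx) _; exact: ler_norm.
Qed.
End real_integrable.

Section improper_ftc.
Context {R : realType}.
Notation mu := (@lebesgue_measure R).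
Implicit Types (f F : R -> R) (u v : nat -> R) (D : set R).

Lemma measurable_fun_exhaust f u v D :
  D = \bigcup_k `[u k, v k]%classic ->
  (forall x : R, D x -> {for x, continuous f}) -> measurable_fun D f.
Proof.
move=> -> cf; apply/measurable_fun_bigcup => // k.
apply: subspace_continuous_measurable_fun => //.
apply: continuous_in_subspaceT => x /[!inE] xk.
by apply: cf; exists k.
Qed.

Lemma ge0_exhaust_cvg (f : R -> \bar R) u v D :
  {homo u : n m / (n <= m)%N >-> m <= n} -> {homo v : n m / (n <= m)%N >-> n <= m} ->
  D = \bigcup_k `[u k, v k]%classic ->
  measurable_fun D f -> (forall x : R, D x -> (0 <= f x)%E) ->
  (\int[mu]_(x in `[u k, v k]) f x)%E @[k --> \oo] --> (\int[mu]_(x in D) f x)%E.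
Proof.
move=> nu nv DE mf f0; rewrite DE; apply: ge0_nondecreasing_set_cvg_integral.
- move=> n m nm; apply/subsetPset => x /=; rewrite !in_itv/= => /andP[ux xv].
  by rewrite (le_trans (nu _ _ nm) ux) (le_trans xv (nv _ _ nm)).
- by [].
- move=> k; apply: measurable_funS mf => //.
    by rewrite DE; exact: bigcup_measurable.
  by rewrite DE => x xk; exists k.
- by move=> k x xk; apply: f0; rewrite DE; exists k.
Qed.

Lemma ge0_FTC_exhaust f F u v D (l : R) :
  {homo u : n m / (n <= m)%N >-> m <= n} -> {homo v : n m / (n <= m)%N >-> n <= m} ->
  (forall k, u k < v k) ->
  D = \bigcup_k `[u k, v k]%classic ->
  (forall x : R, D x -> is_derive x 1 F (f x)) ->
  (forall x : R, D x -> {for x, continuous f}) ->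
  (forall x : R, D x -> 0 <= f x) ->
  F (v k) - F (u k) @[k --> \oo] --> l ->
  (\int[mu]_(x in D) (f x)%:E = l%:E)%E.
Proof.
move=> nu nv uv DE dF cf f0 Fl.
have := @ge0_exhaust_cvg (EFin \o f) u v D nu nv DE.
move=> /(_ _ _)/cvg_unique; apply.
- exact: ereal_hausdorff.
- by apply/measurable_EFinP; exact: measurable_fun_exhaust DE cf.
- by move=> x Dx; rewrite lee_fin f0.
- rewrite (_ : (fun _ => _) = fun k => (F (v k) - F (u k))%:E).
    by apply: cvg_EFin Fl; exact: nearW.
  apply/funext => k /=; apply: FTC2_is_derive => // x xk.
    by apply: dF; rewrite DE; exists k.
  by apply: cf; rewrite DE; exists k.
Qed.

(** Without a sign, integrability takes over: the positive and negative parts are exhausted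
    separately, and their limits are finite, so they may be subtracted. *)
Lemma FTC_exhaust f F u v D (l : R) :
  {homo u : n m / (n <= m)%N >-> m <= n} -> {homo v : n m / (n <= m)%N >-> n <= m} ->
  (forall k, u k < v k) ->
  D = \bigcup_k `[u k, v k]%classic ->
  (forall x : R, D x -> is_derive x 1 F (f x)) ->
  (forall x : R, D x -> {for x, continuous f}) ->
  mu.-integrable D (EFin \o f) ->
  F (v k) - F (u k) @[k --> \oo] --> l ->
  (\int[mu]_(x in D) (f x)%:E = l%:E)%E.
Proof.
move=> nu nv uv DE dF cf intf Fl.
have mf := measurable_int _ intf.
have mD : measurable D by rewrite DE; exact: bigcup_measurable.
have hp := @ge0_exhaust_cvg (EFin \o f)^\+%E u v D nu nv DE (measurable_funepos mf) (fun x _ => funepos_ge0 _ x).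
have hn := @ge0_exhaust_cvg (EFin \o f)^\-%E u v D nu nv DE (measurable_funeneg mf) (fun x _ => funeneg_ge0 _ x).
have fp : (\int[mu]_(x in D) (EFin \o f)^\+ x \is a fin_num)%E.
  by apply: integrable_pos_fin_num.
have fn : (\int[mu]_(x in D) (EFin \o f)^\- x \is a fin_num)%E.
  by apply: integrable_neg_fin_num.
have h : (\int[mu]_(x in `[u k, v k]) (f x)%:E)%E @[k --> \oo] --> (\int[mu]_(x in D) (f x)%:E)%E.
  rewrite integralE; under eq_fun do rewrite integralE.
  by apply: cvgeB => //; rewrite fin_num_adde_defr.
apply: (cvg_unique _ h); first exact: ereal_hausdorff.
rewrite (_ : (fun _ => _) = fun k => (F (v k) - F (u k))%:E).
  by apply: cvg_EFin Fl; exact: nearW.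
apply/funext => k /=; apply: FTC2_is_derive => // x xk.
  by apply: dF; rewrite DE; exists k.
by apply: cf; rewrite DE; exists k.
Qed.

Lemma itv0y_exhaust : `]0, +oo[%classic =
  \bigcup_k `[k.+2%:R^-1, k.+2%:R : R]%classic.
Proof.
apply/seteqP; split=> /= x; last first.
  move=> [k _] /=; rewrite !in_itv/= andbT => /andP[+ _].
  by apply: lt_le_trans; rewrite invr_gt0.
rewrite /= in_itv/= andbT => x0.
have [k hk] : exists k : nat, Num.max x x^-1 <= k%:R.
  exists (Num.trunc (Num.max x x^-1)).+1; exact/ltW/truncnS_gt.
have k2 : k%:R <= k.+2%:R :> R by rewrite ler_nat -addn2 leq_addr.
have := le_trans hk k2; rewrite ge_max => /andP[h1 h2].
exists k => //=; rewrite in_itv/= h1 andbT -[leRHS]invrK lef_pV2 ?posrE ?invr_gt0//.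
Qed.

Lemma itv0c_exhaust (b : R) : 0 < b -> `]0, b]%classic =
  \bigcup_k `[b / k.+2%:R, b]%classic.
Proof.
move=> b0; apply/seteqP; split=> /= x; last first.
  move=> [k _] /=; rewrite !in_itv/= => /andP[+ ->]; rewrite andbT.
  by apply: lt_le_trans; rewrite divr_gt0.
rewrite /= in_itv/= => /andP[x0 xb].
exists (Num.trunc (b / x)) => //=; rewrite in_itv/= xb andbT.
rewrite ler_pdivrMr// mulrC -ler_pdivrMr//.
by apply: (@le_trans _ _ (Num.trunc (b / x)).+1%:R); [exact/ltW/truncnS_gt|rewrite ler_nat].
Qed.

Let nu : {homo (fun k => k.+2%:R^-1 : R) : n m / (n <= m)%N >-> m <= n}.
Proof. by move=> n m nm; rewrite lef_pV2 ?posrE// ler_nat !ltnS. Qed.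

Let nv : {homo (fun k => k.+2%:R : R) : n m / (n <= m)%N >-> n <= m}.
Proof. by move=> n m nm; rewrite ler_nat !ltnS. Qed.

Let uv (k : nat) : k.+2%:R^-1 < k.+2%:R :> R.
Proof.
by apply: (@lt_trans _ _ 1); rewrite ?invf_lt1// ltr1n.
Qed.

Lemma measurable_fun_itv0y f :
  (forall x : R, 0 < x -> {for x, continuous f}) -> measurable_fun (`]0, +oo[ : set R) f.
Proof.
move=> cf; apply: (measurable_fun_exhaust itv0y_exhaust) => x /=.
by rewrite in_itv/= andbT; exact: cf.
Qed.

Lemma ge0_FTC0y f F (l : R) : (forall x : R, 0 < x -> is_derive x 1 F (f x)) ->
  (forall x : R, 0 < x -> {for x, continuous f}) ->
  (forall x : R, 0 < x -> 0 <= f x) ->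
  F k.+2%:R - F k.+2%:R^-1 @[k --> \oo] --> l ->
  (\int[mu]_(x in `]0%R, +oo[) (f x)%:E = l%:E)%E.
Proof.
move=> dF cf f0 Fl; apply: (ge0_FTC_exhaust nu nv uv itv0y_exhaust _ _ _ Fl).
- by move=> x /=; rewrite in_itv/= andbT; exact: dF.
- by move=> x /=; rewrite in_itv/= andbT; exact: cf.
- by move=> x /=; rewrite in_itv/= andbT; exact: f0.
Qed.

Lemma FTC0y f F (l : R) : (forall x : R, 0 < x -> is_derive x 1 F (f x)) ->
  (forall x : R, 0 < x -> {for x, continuous f}) ->
  mu.-integrable `]0, +oo[ (EFin \o f) ->
  F k.+2%:R - F k.+2%:R^-1 @[k --> \oo] --> l ->
  (\int[mu]_(x in `]0%R, +oo[) (f x)%:E = l%:E)%E.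
Proof.
move=> dF cf f0 Fl; apply: (FTC_exhaust nu nv uv itv0y_exhaust _ _ f0 Fl).
- by move=> x /=; rewrite in_itv/= andbT; exact: dF.
- by move=> x /=; rewrite in_itv/= andbT; exact: cf.
Qed.

Lemma ge0_FTC0c f F (b l : R) : 0 < b ->
  (forall x : R, 0 < x <= b -> is_derive x 1 F (f x)) ->
  (forall x : R, 0 < x <= b -> {for x, continuous f}) ->
  (forall x : R, 0 < x <= b -> 0 <= f x) ->
  F b - F (b / k.+2%:R) @[k --> \oo] --> l ->
  (\int[mu]_(x in `]0%R, b]) (f x)%:E = l%:E)%E.
Proof.
move=> b0 dF cf f0 Fl.
have dF' x : `]0, b]%classic x -> is_derive x 1 F (f x).
  by rewrite /= in_itv/=; exact: dF.
apply: (ge0_FTC_exhaust (u := fun k => b / k.+2%:R) (v := cst b) _ _ _ (itv0c_exhaust b0) dF' _ _ Fl).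
- by move=> n m nm; rewrite ler_pM2l// lef_pV2 ?posrE// ler_nat !ltnS.
- by [].
- by move=> k; rewrite ltr_pdivrMr// ltr_pMr// ltr1n.
- by move=> x /=; rewrite in_itv/=; exact: cf.
- by move=> x /=; rewrite in_itv/=; exact: f0.
Qed.

(** With m = min(1/2, k/2) one has m (2 + s) <= 1 + k s/2 <= exp (k s/2); the square of this is the
    claim with C = m^-2. *)
Lemma expRN_sqr_bound (k : R) : 0 < k -> exists2 C : R, 0 < C &
  forall s : R, 0 < s -> expR (- (k * s)) * (2 + s) ^+ 2 <= C.
Proof.
move=> k0; pose m := Num.min (1 / 2) (k / 2).
have m0 : 0 < m by rewrite lt_min; apply/andP; split; lra.
exists (m ^- 2); first by rewrite invr_gt0 exprn_gt0.
move=> s s0; rewrite expRN -[leRHS]mul1r ler_pdivlMr ?exprn_gt0//.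
rewrite mulrAC -mulrA -exprMn ler_pdivrMl ?expR_gt0// mulr1.
have -> : k * s = 2%:R * (k * s / 2) by field.
rewrite expRM_natl; apply: (@le_trans _ _ ((1 + k * s / 2) ^+ 2)).
  rewrite ler_sqr ?nnegrE; [|nra|nra].
  have : m <= 1 / 2 by rewrite ge_min lexx.
  have : m <= k / 2 by rewrite ge_min lexx orbT.
  nra.
by rewrite ler_sqr ?nnegrE ?expR_ge0//; [exact: expR_ge1Dx|nra].
Qed.

(** The comparison function [g] is the derivative of -1 / (1 + s^(c+1)), so its integral is 1. Since
    0 < c + 1 <= 1, 1 + s^(c+1) <= 2 + s, and [expRN_sqr_bound] lets the exponential absorb the
    square of this. *)
Lemma integrable_powR_expRN (c k : R) : -1 < c <= 0 -> 0 < k ->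
  mu.-integrable `]0, +oo[ (EFin \o (fun s => s `^ c * expR (- (k * s)))).
Proof.
move=> /andP[c1 c0] k0; have [C C0 HC] := expRN_sqr_bound k0.
have e0 : 0 < c + 1 by lra.
pose g (s : R) := (c + 1) * s `^ c * ((1 + s `^ (c + 1)) ^- 2).
have p0 (s : R) : 0 < 1 + s `^ (c + 1) by have := powR_ge0 s (c + 1); lra.
have dG (s : R) : 0 < s -> is_derive s 1 (fun s => - (1 + s `^ (c + 1))^-1) (g s).
  move=> s0.
  have d1 := is_derive1D (is_derive_cst (1 : R) s 1) (is_derive1_powR (c + 1) s0).
  have := is_deriveN (@is_derive1V _ (fun t => cst 1 t + t `^ (c + 1)) s _ (lt0r_neq0 (p0 s)) d1).
  move/is_derive_eq; apply; rewrite /g add0r addrK /GRing.scale/=.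
  by rewrite mulNr opprK mulrC.
have cpow (e s : R) : 0 < s -> {for s, continuous (fun s : R => s `^ e)}.
  by move=> s0; exact: is_derive1_continuous (is_derive1_powR e s0).
have cg (s : R) : 0 < s -> {for s, continuous g}.
  move=> s0; apply: cvgM; first by apply: cvgM; [exact: cvg_cst|exact: cpow].
  apply: cvgV; first by rewrite expf_neq0// lt0r_neq0.
  by rewrite expr2; apply: cvgM; apply: cvgD; (try exact: cvg_cst); exact: cpow.
have g0 (s : R) : 0 <= g s.
  by rewrite /g mulr_ge0 ?mulr_ge0 ?powR_ge0 ?invr_ge0 ?sqr_ge0// ltW.
have Gl : - (1 + k.+2%:R `^ (c + 1))^-1 - - (1 + k.+2%:R^-1 `^ (c + 1))^-1
    @[k --> \oo] --> (1 : R).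
  have z0 : k.+2%:R^-1 `^ (c + 1) @[k --> \oo] --> (0 : R).
    apply: (cvg_at_rightP _ _ _).1 (powR_cvg0 e0) _ _; split => [i|]; first by rewrite invr_gt0.
    rewrite (_ : (fun i => i.+2%:R^-1) = (fun i => harmonic (i + 1)%N)); last first.
      by apply/funext => i; rewrite /harmonic/= addn1.
    by rewrite cvg_shiftn; exact: cvg_harmonic.
  rewrite (_ : (fun k => _) = (fun k => (1 - k.+2%:R^-1 `^ (c + 1)) / (1 + k.+2%:R^-1 `^ (c + 1)))).
    rewrite -[X in _ --> X](_ : (1 - 0) / (1 + 0) = 1 :> R); last by rewrite subr0 addr0 divr1.
    apply: cvgM; first by apply: cvgB => //; exact: cvg_cst.
    by apply: cvgV; [rewrite addr0 oner_eq0|apply: cvgD => //; exact: cvg_cst].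
  apply/funext => i; have := p0 i.+2%:R^-1.
  have -> : i.+2%:R `^ (c + 1) = (i.+2%:R^-1 `^ (c + 1))^-1.
    by rewrite -powRN -powR_inv1// -powRrM mulN1r opprK.
  have : 0 < i.+2%:R^-1 `^ (c + 1) :> R by rewrite powR_gt0// invr_gt0.
  move: (_ `^ _) => z z0' z1.
  by field; apply/andP; split; lra.
have ig : mu.-integrable `]0, +oo[ (EFin \o g).
  apply/integrableP; split.
    by apply/measurable_EFinP; exact: measurable_fun_itv0y.
  under eq_integral do rewrite /= ger0_norm//.
  by rewrite (ge0_FTC0y dG cg (fun x _ => g0 x) Gl) ltry.
have mf : measurable_fun (`]0, +oo[ : set R) (fun s : R => s `^ c * expR (- (k * s))).
  apply: measurable_fun_itv0y => s s0; apply: cvgM; first exact: cpow.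
  by apply: continuous_comp; [apply: cvgN; apply: cvgM; [exact: cvg_cst|exact: cvg_id]|exact: continuous_expR].
apply: (integrable_dominated _ _ _ (integrable_RZ _ (C / (c + 1)) ig)) => //.
move=> s /=; rewrite in_itv/= andbT => s0.
rewrite ger0_norm ?mulr_ge0 ?powR_ge0 ?expR_ge0//.
rewrite /g [leRHS](_ : _ = s `^ c * (C * (1 + s `^ (c + 1)) ^- 2)); last first.
  by field; rewrite ?lt0r_neq0.
rewrite ler_wpM2l ?powR_ge0// ler_pdivlMr ?exprn_gt0//.
apply: le_trans (HC s s0); rewrite ler_wpM2l ?expR_ge0//.
rewrite ler_sqr ?nnegrE; [|exact: ltW|lra].
have [s1|s1] := leP s 1.
  have := @ge0_ler_powR _ (c + 1) (ltW e0) s 1; rewrite powR1 !nnegrE (ltW s0) ler01 => /(_ isT isT s1).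
  lra.
have := @ler1_powR _ s (c + 1) (ltW s1); lra.
Qed.

End improper_ftc.

(** * Moments of the logarithm under the exponential law *)

Section log_moments.
Context {R : realType}.
Notation mu := (@lebesgue_measure R).
Notation D := (`]0%R, +oo[%classic : set R).

Definition lnexp j k (t : R) := ln t ^+ j * t ^+ k * expR (- t).

(** The first summand serves near 0, the second near infinity. The trivial power in the second gives
    it the shape required by [integrable_powR_expRN]. *)
Definition lnexp_dom (t : R) :=
  t `^ (- (1 / 2)) * expR (- (1 / 2 * t)) + t `^ 0 * expR (- (1 / 2 * t)).

Lemma lnexp_dom_integrable : mu.-integrable D (EFin \o lnexp_dom).
Proof.
by apply: integrable_RD => //; apply: integrable_powR_expRN; lra.
Qed.

(** Apply ln y <= y at x = t^(1/4) and at its inverse; ln t = 4 ln x accounts for the 16. *)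
Lemma ln_sqr_le (t : R) : 0 < t -> ln t ^+ 2 <= 16 * (t `^ (1 / 2) + t `^ (- (1 / 2))).
Proof.
move=> t0; pose x := t `^ (1 / 4); have x0 : 0 < x by rewrite powR_gt0.
have lnle (y : R) : 0 < y -> ln y <= y.
  move=> y0; have := @le_ln1Dx _ (y - 1); rewrite addrCA subrr addr0.
  by move=> h; apply: (le_trans (h _)); lra.
have -> : ln t = 4 * ln x by rewrite /x ln_powR; field.
have -> : t `^ (1 / 2) = x ^+ 2 by rewrite -powR_mulrn ?ltW// -powRrM; congr (_ `^ _); field.
have -> : t `^ (- (1 / 2)) = x^-1 ^+ 2.
  by rewrite /x -powRN -powR_mulrn ?powR_ge0// -powRrM; congr (_ `^ _); field.
have h1 := lnle x x0; have h2 : ln x^-1 <= x^-1 by apply: lnle; rewrite invr_gt0.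
rewrite lnV ?posrE// in h2.
have : ln x ^+ 2 <= x ^+ 2 + x^-1 ^+ 2.
  have [l0|l0] := leP 0 (ln x).
    have : ln x ^+ 2 <= x ^+ 2 by rewrite ler_sqr ?nnegrE// ltW.
    by have := sqr_ge0 x^-1; lra.
  have : (- ln x) ^+ 2 <= x^-1 ^+ 2 by rewrite ler_sqr ?nnegrE; [exact: h2|lra|rewrite invr_ge0 ltW].
  by rewrite sqrrN; have := sqr_ge0 x; lra.
rewrite exprMn; lra.
Qed.

Lemma lnexp_bound k : exists2 C : R, 0 < C &
  forall t : R, 0 < t -> (1 + ln t ^+ 2) * t ^+ k * expR (- t) <= C * lnexp_dom t.
Proof.
have [C0 C00 HC] := @powR_le_expR R k.+1%:R (ler0n _ _).
(* 33 is 1 + 2 * 16 from [ln_sqr_le]: below 1 everything is at most a multiple of t^(-1/2), above 1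
   a multiple of t. The resulting t^(k+1) is absorbed by the exponential through [C0]. *)
exists (33 + 33 * C0); first by rewrite ltr_wpDr// mulr_ge0.
move=> t t0; have t0' := ltW t0.
have lt := ln_sqr_le t0.
have e2 : expR (- t) <= expR (- (1 / 2 * t)) by rewrite ler_expR; lra.
rewrite /lnexp_dom powRr0 [1 * expR _]mul1r.
set p := t `^ (1 / 2) in lt; set m := t `^ (- (1 / 2)) in lt *.
set E := expR (- (1 / 2 * t)) in e2 *.
have E0 : 0 < E by exact: expR_gt0.
have m0 : 0 < m by exact: powR_gt0.
have pm : p * m = 1 by rewrite /p /m powRN divff// gt_eqF// powR_gt0.
have [t1|t1] := leP t 1.
  have p1 : p <= 1.
    by have := @ge0_ler_powR _ (1 / 2) _ t 1; rewrite powR1 !nnegrE; apply => //; lra.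
  have m1 : 1 <= m by rewrite -pm ler_piMl// ltW.
  have l33 : 1 + ln t ^+ 2 <= 33 * m by lra.
  have tk : t ^+ k <= 1 by apply: exprn_ile1.
  apply: (@le_trans _ _ (33 * m * 1 * E)).
    apply: ler_pM; [|exact: expR_ge0| |exact: e2].
      by rewrite mulr_ge0 ?exprn_ge0// addr_ge0// sqr_ge0.
    apply: ler_pM; [|exact: exprn_ge0|exact: l33|exact: tk].
    by rewrite addr_ge0// sqr_ge0.
  rewrite -/m -/E mulr1.
  have : 0 <= C0 * (m * E) by rewrite !mulr_ge0// ltW.
  have : 0 <= m * E by rewrite mulr_ge0// ltW.
  have : 0 <= C0 * E by rewrite mulr_ge0// ltW.
  by have := ltW E0; rewrite !mulrDl !mulrDr; lra.
have t1' := ltW t1.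
have p1 : p <= t by have := @ler1_powR _ t (1 / 2) t1'; apply; lra.
have m1 : m <= 1.
  have := @ger1_powR; rewrite /m powRN invf_le1 ?powR_gt0//.
  by have := @ge0_ler_powR _ (1 / 2) _ 1 t; rewrite powR1 !nnegrE; move=> + _; apply => //; lra.
have l33 : 1 + ln t ^+ 2 <= 33 * t by lra.
have := HC t t1'; rewrite powR_mulrn// => tk.
apply: (@le_trans _ _ (33 * (t ^+ k.+1 * expR (- t)))).
  rewrite mulrA ler_pM2r ?expR_gt0// (exprS t k) mulrA ler_wpM2r//; exact: exprn_ge0.
apply: (@le_trans _ _ (33 * (C0 * E))).
  rewrite ler_pM2l//; apply: (@le_trans _ _ (C0 * expR (t / 16) * expR (- t))).
    by rewrite ler_pM2r ?expR_gt0.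
  by rewrite -mulrA -expRD ler_wpM2l// ler_expR; lra.
have : 0 <= C0 * (m * E) by rewrite !mulr_ge0// ltW.
have : 0 <= m * E by rewrite mulr_ge0// ltW.
have : 0 <= C0 * E by rewrite mulr_ge0// ltW.
by have := ltW E0; rewrite !mulrDl !mulrDr; lra.
Qed.

Lemma lnexp_norm_le j k (t : R) : (j <= 2)%N -> 0 < t ->
  `|lnexp j k t| <= (1 + ln t ^+ 2) * t ^+ k * expR (- t).
Proof.
move=> j2 t0; rewrite /lnexp !normrM (ger0_norm (expR_ge0 _)) ler_pM2r ?expR_gt0//.
rewrite (@ger0_norm _ (t ^+ k)) ?exprn_ge0 ?(ltW t0)//.
rewrite ler_wpM2r ?exprn_ge0 ?(ltW t0)//.
case: j j2 => [|[|[|]]]// _.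
- by rewrite normr1 lerDl sqr_ge0.
- rewrite expr1 -[X in _ <= _ + X]real_normK ?num_real//.
  by have := sqr_ge0 (`|ln t| - 1); have := normr_ge0 (ln t); move: (`|ln t|) => y; lra.
- by rewrite ger0_norm ?sqr_ge0// lerDr.
Qed.

Lemma continuous_lnexp j k (t : R) : 0 < t -> {for t, continuous (lnexp j k)}.
Proof.
move=> t0; apply: cvgM; first apply: cvgM.
- by apply: (is_derive1_continuous (is_derive1X j (is_derive1_ln t0))).
- by apply: (is_derive1_continuous (is_derive1X k (is_derive_id t (1 : R)))).
- by apply: continuous_comp; [apply: cvgN; exact: cvg_id|exact: continuous_expR].
Qed.

Lemma integrable_lnexp j k : (j <= 2)%N -> mu.-integrable D (EFin \o lnexp j k).
Proof.
move=> j2; have [C C0 HC] := lnexp_bound k.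
apply: (integrable_dominated _ _ _ (integrable_RZ _ C lnexp_dom_integrable)) => //.
  by apply: measurable_fun_itv0y => t t0; exact: continuous_lnexp.
move=> t /=; rewrite in_itv/= andbT => t0.
by apply: le_trans (HC t t0); exact: lnexp_norm_le.
Qed.

Definition log_moment j k := \int[mu]_(t in D) lnexp j k t.

(** Integration by parts: [f] is the derivative of [lnexp j k.+1], whose boundary values vanish. At
    j = 0 the truncated predecessor is harmless, being multiplied by 0. *)
Lemma log_momentS j k : (j <= 2)%N ->
  log_moment j k.+1 = k.+1%:R * log_moment j k + j%:R * log_moment j.-1 k.
Proof.
move=> j2; have j1 : (j.-1 <= 2)%N by case: j j2 => [|[|[|]]].
have [C C0 HC] := lnexp_bound k.
pose f t := j%:R * lnexp j.-1 k t + k.+1%:R * lnexp j k t - lnexp j k.+1 t.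
have dF (t : R) : 0 < t -> is_derive t 1 (lnexp j k.+1) (f t).
  move=> t0; have d1 := is_derive1X j (is_derive1_ln t0).
  have d2 := is_derive1X k.+1 (is_derive_id t (1 : R)).
  have := is_derive1M (is_derive1M d1 d2) (is_derive1_expRN t).
  by move/is_derive_eq; apply; rewrite /f /lnexp /= !exprS; field; rewrite gt_eqF.
have iz c i l : (i <= 2)%N -> mu.-integrable D (EFin \o (fun t => c * lnexp i l t)).
  by move=> i2; apply: integrable_RZ => //; exact: integrable_lnexp.
have ifd : mu.-integrable D (EFin \o (fun t => j%:R * lnexp j.-1 k t + k.+1%:R * lnexp j k t)).
  by apply: integrable_RD => //; exact: iz.
have iF : mu.-integrable D (EFin \o f).
  by apply: integrable_RB => //; exact: integrable_lnexp.
have cf (t : R) : 0 < t -> {for t, continuous f}.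
  move=> t0; apply: cvgB; last exact: continuous_lnexp.
  by apply: cvgD; apply: cvgM; try exact: cvg_cst; exact: continuous_lnexp.
(* Bounding with index k and keeping the extra factor t apart is what makes the boundary terms
   vanish: t * [lnexp_dom t] tends to 0 at both ends. *)
have Fb (t : R) : 0 < t -> `|lnexp j k.+1 t| <= C * (t * lnexp_dom t).
  move=> t0; rewrite mulrCA; apply: le_trans (ler_wpM2l (ltW t0) (HC t t0)).
  apply: le_trans (lnexp_norm_le k.+1 j2 t0) _.
  by rewrite (exprS t) le_eqVlt; apply/orP; left; apply/eqP; ring.
have h0 : k.+2%:R^-1 @[k --> \oo] --> (0 : R).
  rewrite (_ : (fun k => k.+2%:R^-1) = (fun k => harmonic (k + 1)%N)); last first.
    by apply/funext => i; rewrite /harmonic/= addn1.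
  by rewrite cvg_shiftn; exact: cvg_harmonic.
have lim0 : lnexp j k.+1 i.+2%:R^-1 @[i --> \oo] --> (0 : R).
  have z0 : i.+2%:R^-1 `^ (1 / 2) @[i --> \oo] --> (0 : R).
    have e0 : 0 < 1 / 2 :> R by [].
    by apply: (cvg_at_rightP _ _ _).1 (powR_cvg0 e0) _ _; split => [i|//]; rewrite invr_gt0.
  apply/cvgr0Pnorm_le => /= e e0; near=> i.
  have u0 : 0 < i.+2%:R^-1 :> R by rewrite invr_gt0.
  apply: le_trans (Fb _ u0) _.
  apply: (@le_trans _ _ (C * (2 * i.+2%:R^-1 `^ (1 / 2)))); last first.
    rewrite mulrA mulrC -ler_pdivlMr ?mulr_gt0//.
    rewrite -[leLHS]ger0_norm ?powR_ge0//.
    by near: i; move/cvgr0Pnorm_le : z0; apply; rewrite divr_gt0// mulr_gt0.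
  rewrite ler_pM2l// /lnexp_dom powRr0 [1 * expR _]mul1r.
  have : i.+2%:R^-1 <= 1 :> R by rewrite invf_le1// ler1n.
  move: (i.+2%:R^-1) u0 => u u0 u1.
  have -> : u * (u `^ (- (1 / 2)) * expR (- (1 / 2 * u)) + expR (- (1 / 2 * u))) =
      (u `^ (1 / 2) + u) * expR (- (1 / 2 * u)).
    rewrite mulrDr mulrDl mulrA; congr (_ * _ + _).
    rewrite -{1}(powRr1 (ltW u0)) -powRD; last by apply/implyP => _; rewrite gt_eqF.
    by congr (_ `^ _); field.
  apply: (@le_trans _ _ (2 * u `^ (1 / 2) * 1)); last by rewrite mulr1.
  apply: ler_pM; [by rewrite addr_ge0 ?powR_ge0// ltW|exact: expR_ge0| |].
    by have := @ger1_powR _ u (1 / 2); rewrite u0 u1 => /(_ isT) h; have := h _; lra.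
  by rewrite -[leRHS]expR0 ler_expR; lra.
have limy : lnexp j k.+1 i.+2%:R @[i --> \oo] --> (0 : R).
  have [C' C'0 HC'] := @expRN_sqr_bound R (1 / 2) ltac:(lra).
  apply/cvgr0Pnorm_le => /= e e0; near=> i.
  have u0 : 0 < i.+2%:R :> R by [].
  apply: le_trans (Fb _ u0) _.
  apply: (@le_trans _ _ (C * (2 * C' * i.+2%:R^-1))); last first.
    rewrite mulrA mulrC -ler_pdivlMr ?mulr_gt0//.
    rewrite -[leLHS]ger0_norm ?invr_ge0//.
    by near: i; move/cvgr0Pnorm_le : h0; apply; rewrite divr_gt0// !mulr_gt0.
  rewrite ler_pM2l// /lnexp_dom powRr0 [1 * expR _]mul1r.
  have : 1 <= i.+2%:R :> R by rewrite ler1n.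
  move: (i.+2%:R) u0 => u u0 u1.
  rewrite ler_pdivlMr//; have := HC' u u0.
  have m1 : u `^ (- (1 / 2)) <= 1.
    rewrite powRN invf_le1 ?powR_gt0//.
    by have := @ge0_ler_powR _ (1 / 2) _ 1 u; rewrite powR1 !nnegrE; apply => //; lra.
  have E0 := expR_ge0 (- (1 / 2 * u)).
  move: m1 E0; move: (_ `^ _) (expR _) => m E m1 E0 h.
  have : m * E <= E by rewrite ler_piMl.
  have : u ^+ 2 * E <= C' by apply: le_trans h; rewrite mulrC ler_wpM2l// ler_sqr ?nnegrE; lra.
  move=> h1 h2; have : u ^+ 2 * (m * E) <= u ^+ 2 * E by rewrite ler_wpM2l// sqr_ge0.
  by lra.
have : \int[mu]_(t in D) f t = 0.
  rewrite /Rintegral (FTC0y dF cf iF (l := 0))//.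
  by rewrite -[X in _ --> X](subr0 0); exact: cvgB.
rewrite RintegralB//; last exact: integrable_lnexp.
rewrite RintegralD//; try exact: iz.
rewrite !RintegralZl//; try exact: integrable_lnexp.
by rewrite -/(log_moment j k) -/(log_moment j.-1 k) -/(log_moment j k.+1); lra.
Unshelve. all: by end_near.
Qed.

Lemma log_moment00 : log_moment 0 0 = 1.
Proof.
have dF (t : R) : 0 < t -> is_derive t 1 (fun t => - expR (- t)) (lnexp 0 0 t).
  move=> t0.
  have := is_deriveN (is_derive1_expRN t).
  by move/is_derive_eq; apply; rewrite /lnexp !expr0 opprK !mul1r.
have c0 (t : R) : 0 < t -> {for t, continuous (lnexp 0 0)} by exact: continuous_lnexp.
have f0 (t : R) : 0 < t -> 0 <= lnexp 0 0 t by rewrite /lnexp !expr0 !mul1r expR_ge0.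
rewrite /log_moment /Rintegral (ge0_FTC0y dF c0 f0 (l := 1))//.
have h0 : k.+2%:R^-1 @[k --> \oo] --> (0 : R).
  rewrite (_ : (fun k => k.+2%:R^-1) = (fun k => harmonic (k + 1)%N)); last first.
    by apply/funext => i; rewrite /harmonic/= addn1.
  by rewrite cvg_shiftn; exact: cvg_harmonic.
rewrite -[X in _ --> X](_ : - 0 - - expR (- 0) = 1); last by rewrite !oppr0 expR0 opprK add0r.
apply: cvgB; apply: cvgN; last first.
  by apply: (cvg_comp _ _ (cvgN h0)); exact: continuous_expR.
apply: (@squeeze_cvgr _ _ _ _ (cst 0) (fun k => k.+2%:R^-1)) => //; last exact: cvg_cst.
near=> k; rewrite expR_ge0/= expRN lef_pV2 ?posrE ?expR_gt0//.
by apply: le_trans (expR_ge1Dx _); rewrite lerDr.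
Unshelve. all: by end_near.
Qed.
End log_moments.

(** * The case gamma = 0 reduced to the Basel sum *)

Section gumbel_variance.
Context {R : realType}.
Notation mu := (@lebesgue_measure R).
Notation D := (`]0%R, +oo[%classic : set R).
Notation L := (@log_moment R).

Lemma log_moment0 k : L 0 k = k`!%:R.
Proof.
elim: k => [|k IH]; first by rewrite log_moment00.
by rewrite log_momentS// IH mul0r addr0 factS natrM.
Qed.

Let il j k : (j <= 2)%N -> mu.-integrable D (EFin \o @lnexp R j k).
Proof. exact: integrable_lnexp. Qed.

Let ilz c j k : (j <= 2)%N -> mu.-integrable D (EFin \o (fun t => c * @lnexp R j k t)).
Proof. by move=> j2; apply: integrable_RZ => //; exact: il. Qed.

Let ilzB c1 c2 j k l m : (j <= 2)%N -> (l <= 2)%N ->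
  mu.-integrable D (EFin \o (fun t => c1 * @lnexp R j k t - c2 * @lnexp R l m t)).
Proof. by move=> j2 l2; apply: integrable_RB => //; exact: ilz. Qed.

Lemma log_moment_sqr c k :
  \int[mu]_(t in D) ((ln t - c) ^+ 2 * t ^+ k * expR (- t)) =
  L 2 k - 2 * c * L 1 k + c ^+ 2 * k`!%:R.
Proof.
transitivity (\int[mu]_(t in D) ((1 * lnexp 2 k t - (2 * c) * lnexp 1 k t) + c ^+ 2 * lnexp 0 k t)).
  by apply: eq_Rintegral => t _; rewrite /lnexp; ring.
rewrite RintegralD//; [|exact: ilzB|exact: ilz].
rewrite RintegralB//; [|exact: ilz|exact: ilz].
by rewrite !RintegralZl//; [rewrite mul1r -log_moment0|exact: il..].
Qed.

(** ln t - ln c lies between (t - c) / t and (t - c) / c. Adding both squares avoids a case split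
    under the integral and leaves only powers of t, whose moments are factorials. *)
Lemma ln_sqr_dist_le (t c : R) : 0 < t -> 0 < c ->
  (ln t - ln c) ^+ 2 <= (t - c) ^+ 2 * (c ^- 2 + t ^- 2).
Proof.
move=> t0 c0; have lnle (y : R) : 0 < y -> ln y <= y - 1.
  by move=> y0; have := @le_ln1Dx _ (y - 1); rewrite addrCA subrr addr0; apply; lra.
have h1 := lnle _ (divr_gt0 t0 c0); have h2 := lnle _ (divr_gt0 c0 t0).
rewrite !ln_div ?posrE// in h1 h2.
have q1 : 0 <= ((t - c) / c) ^+ 2 by exact: sqr_ge0.
have q2 : 0 <= ((t - c) / t) ^+ 2 by exact: sqr_ge0.
have -> : (t - c) ^+ 2 * (c ^- 2 + t ^- 2) = ((t - c) / c) ^+ 2 + ((t - c) / t) ^+ 2.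
  by field; rewrite !gt_eqF.
have [tc|tc] := leP c t.
  have : (ln t - ln c) ^+ 2 <= ((t - c) / c) ^+ 2; last lra.
  rewrite ler_sqr ?nnegrE.
  - by apply: le_trans h1 _; rewrite le_eqVlt; apply/orP; left; apply/eqP; field; rewrite gt_eqF.
  - by rewrite subr_ge0 ler_ln.
  - by rewrite divr_ge0 ?subr_ge0// ltW.
have : (ln t - ln c) ^+ 2 <= ((t - c) / t) ^+ 2; last lra.
rewrite -sqrrN -[leRHS]sqrrN opprB ler_sqr ?nnegrE.
- by apply: le_trans h2 _; rewrite le_eqVlt; apply/orP; left; apply/eqP; field; rewrite gt_eqF.
- by rewrite subr_ge0 ler_ln// ltW.
- by rewrite -mulNr opprB divr_ge0 ?subr_ge0// ltW.
Qed.

(* [v k] is the variance of the logarithm of a Gamma(k + 1) variable; by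
   [log_momentS] it satisfies [v k - v k.+1 = k.+1%:R ^- 2]. *)
Let v k := L 2 k / k`!%:R - (L 1 k / k`!%:R) ^+ 2.

Let f0 k : 0 < k`!%:R :> R. Proof. by rewrite ltr0n fact_gt0. Qed.

Let v_ge0 k : 0 <= v k.
Proof.
have : 0 <= \int[mu]_(t in D) ((ln t - L 1 k / k`!%:R) ^+ 2 * t ^+ k * expR (- t)).
  apply: Rintegral_ge0 => t /=; rewrite in_itv/= andbT => t0.
  apply: mulr_ge0; last exact: expR_ge0.
  by apply: mulr_ge0; [exact: sqr_ge0|apply: exprn_ge0; exact: ltW].
rewrite log_moment_sqr /v => h; rewrite -(pmulr_lge0 _ (f0 k)).
suff -> : (L 2 k / k`!%:R - (L 1 k / k`!%:R) ^+ 2) * k`!%:R =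
  L 2 k - 2 * (L 1 k / k`!%:R) * L 1 k + (L 1 k / k`!%:R) ^+ 2 * k`!%:R by [].
have := f0 k; clear h; move: (k`!%:R) (L 2 k) (L 1 k) => a x y a0.
by field; rewrite gt_eqF.
Qed.

(** The variance of ln t is at most its second moment about ln k, and [ln_sqr_dist_le] bounds that
    by integrals of powers of t, that is by factorials. The index is m + 2 so that division by t^2
    still leaves the power t^m. *)
Let v_le m : v m.+2 <= 4 * m.+1%:R^-1.
Proof.
set k := m.+2; pose c : R := k%:R.
have c0 : 0 < c by rewrite ltr0n.
have h : \int[mu]_(t in D) ((ln t - ln c) ^+ 2 * t ^+ k * expR (- t)) <=
    \int[mu]_(t in D) (((c ^- 2 * lnexp 0 m.+4 t - 2 / c * lnexp 0 m.+3 t) +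
      (2 * lnexp 0 m.+2 t - 2 * c * lnexp 0 m.+1 t)) + c ^+ 2 * lnexp 0 m t).
  apply: le_Rintegral => //.
  - apply: (integrable_dominated _ _ _ (_ : mu.-integrable D
      (EFin \o (fun t => (1 * lnexp 2 k t - (2 * ln c) * lnexp 1 k t) + ln c ^+ 2 * lnexp 0 k t)))) => //.
    + apply: measurable_fun_itv0y => t t0; apply: cvgM; first apply: cvgM.
      * apply: (is_derive1_continuous (is_derive1X 2 (is_derive1B (is_derive1_ln t0) (is_derive_cst (ln c) t 1)))).
      * apply: (is_derive1_continuous (is_derive1X k (is_derive_id t (1 : R)))).
      * by apply: (is_derive1_continuous (is_derive1_expRN t)).
    + move=> t /=; rewrite in_itv/= andbT => t0; rewrite ger0_norm.
        by rewrite le_eqVlt; apply/orP; left; apply/eqP; rewrite /lnexp; ring.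
      apply: mulr_ge0; last exact: expR_ge0.
      by apply: mulr_ge0; [exact: sqr_ge0|apply: exprn_ge0; exact: ltW].
    + by apply: integrable_RD => //; [exact: ilzB|exact: ilz].
  - by do 2 (apply: integrable_RD => //; last (try exact: ilz)); exact: ilzB.
  - move=> t /=; rewrite in_itv/= andbT => t0.
    apply: (@le_trans _ _ ((t - c) ^+ 2 * (c ^- 2 + t ^- 2) * t ^+ k * expR (- t))).
      rewrite ler_wpM2r ?expR_ge0// ler_wpM2r ?exprn_ge0 ?(ltW t0)//.
      exact: ln_sqr_dist_le.
    rewrite le_eqVlt; apply/orP; left; apply/eqP; rewrite /lnexp /k !exprS.
    by field; rewrite !gt_eqF.
rewrite log_moment_sqr in h.
rewrite RintegralD// in h; [|by apply: integrable_RD => //; exact: ilzB|exact: ilz].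
rewrite RintegralD// in h; [|exact: ilzB|exact: ilzB].
rewrite !RintegralB// in h; try exact: ilz.
rewrite !RintegralZl// in h; try exact: il.
rewrite -!/(log_moment _ _) !log_moment0 in h.
have vle : v k * k`!%:R <= L 2 k - 2 * ln c * L 1 k + ln c ^+ 2 * k`!%:R.
  rewrite /v; have := f0 k; move: (k`!%:R) (L 2 k) (L 1 k) (ln c) => a x y z a0.
  have : 0 <= (y / a - z) ^+ 2 * a by rewrite mulr_ge0 ?sqr_ge0// ltW.
  have -> : (y / a - z) ^+ 2 * a = y / a * y - 2 * z * y + z ^+ 2 * a.
    by field; rewrite gt_eqF.
  have -> : (x / a - (y / a) ^+ 2) * a = x - y / a * y.
    by field; rewrite gt_eqF.
  lra.
have := le_trans vle h; rewrite -ler_pdivlMr// => /le_trans; apply.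
rewrite /k !factS !natrM -/k.
have m0 := f0 m; have m1 : 0 < m.+1%:R :> R by [].
have -> : m.+4%:R = c + 2 by rewrite /c /k -[m.+4]addn2 natrD.
have -> : m.+3%:R = c + 1 by rewrite /c /k -[m.+3]addn1 natrD.
rewrite -/c; have -> : m.+1%:R = c - 1 by rewrite /c /k -[m.+2]addn1 natrD addrK.
have c2 : 2 <= c by rewrite /c /k ler_nat.
move: c (m`!%:R) c0 c2 m0 {h vle m1} => {}c a c0 c2 a0.
have -> : (c ^- 2 * ((c + 2) * ((c + 1) * (c * ((c - 1) * a)))) -
   2 / c * ((c + 1) * (c * ((c - 1) * a))) +
   (2 * (c * ((c - 1) * a)) - 2 * c * ((c - 1) * a)) + c ^+ 2 * a) / (c * ((c - 1) * a)) =
   c^-1 + 2 * (c^-1 * c^-1) + (c - 1)^-1.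
  by field; rewrite !gt_eqF//; lra.
have i1 : c^-1 <= (c - 1)^-1 by rewrite lef_pV2 ?posrE//; lra.
have i2 : c^-1 <= 2^-1 by rewrite lef_pV2 ?posrE//; lra.
have i0 : 0 < c^-1 by rewrite invr_gt0.
have : c^-1 * c^-1 <= 2^-1 * c^-1 by rewrite ler_pM2r.
lra.
Qed.

Lemma gumbel_variance : L 2 0 - L 1 0 ^+ 2 = pi ^+ 2 / 6.
Proof.
have <- : v 0 = L 2 0 - L 1 0 ^+ 2 by rewrite /v fact0 !divr1.
apply: basel_recurrence => [n|].
  rewrite /v !log_momentS//= log_moment0 factS natrM.
  have := f0 n; have : 0 < n.+1%:R :> R by [].
  move: (n.+1%:R) (n`!%:R) (L 2 n) (L 1 n) => a b x y a0 b0.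
  by field; rewrite !gt_eqF.
rewrite -(cvg_shiftn 2) /=.
apply: (@squeeze_cvgr _ _ _ _ (cst 0) (fun m => 4 * m.+1%:R^-1)).
- by near=> m; rewrite addn2 v_ge0 v_le.
- exact: cvg_cst.
- by rewrite -[X in _ --> X](mulr0 4); apply: cvgM; [exact: cvg_cst|exact: cvg_harmonic].
Unshelve. all: by end_near.
Qed.
End gumbel_variance.

(** * Layer-cake identities *)

Section product_sigma_finite.
Context d1 d2 (T1 : measurableType d1) (T2 : measurableType d2) (R : realType).
Context (m1 : {sigma_finite_measure set T1 -> \bar R})
        (m2 : {sigma_finite_measure set T2 -> \bar R}).

Lemma sigma_finite_product_measure1 : sigma_finite setT (m1 \x m2)%E.
Proof.
have /sigma_finiteP[F [FT ndF mF]] := sigma_finiteT m1.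
have /sigma_finiteP[G [GT ndG mG]] := sigma_finiteT m2.
exists (fun n => F n `*` G n).
  apply/esym/seteqP; split => // -[x y] _.
  have [i _ Fx] : (\bigcup_i F i) x by rewrite -FT.
  have [j _ Gy] : (\bigcup_j G j) y by rewrite -GT.
  exists (maxn i j) => //; split => /=.
    by have /subsetPset := ndF _ _ (leq_maxl i j); exact.
  by have /subsetPset := ndG _ _ (leq_maxr i j); exact.
move=> i; split; first by apply: measurableX; [exact: (mF i).1|exact: (mG i).1].
rewrite [X in (X < _)%E]product_measure1E; [|exact: (mF i).1|exact: (mG i).1].
by apply: lte_mul_pinfty; [exact: measure_ge0|rewrite ge0_fin_numE ?measure_ge0; [exact: (mF i).2|]|exact: (mG i).2].
Qed.

(* A separate constant: the library keys the sigma-finite structure of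
   [m1 \x m2] on subprobabilities, which excludes Lebesgue measure. *)
Definition sigma_product := (m1 \x m2)%E.

HB.instance Definition _ := Measure.on sigma_product.
HB.instance Definition _ := @Measure_isSigmaFinite.Build _ _ _ sigma_product
  sigma_finite_product_measure1.

End product_sigma_finite.

Section layer_cake.
Context {R : realType}.
Notation mu := (@lebesgue_measure R).

(** Closed at [b] and strict at [a], so that for random endpoints the sections are the events B <= x
    and y < A, which a distribution function measures without left limits. *)
Definition straddle (b a : R) (z : R * R) : R :=
  if [&& b <= z.1, z.1 < z.2 & z.2 < a] then 1 else 0.

Lemma straddle_ge0 b a z : 0 <= straddle b a z.
Proof. by rewrite /straddle; case: ifP. Qed.

Lemma measurable_straddle d (T : measurableType d) (a b : T -> R) (z1 z2 : T -> R) :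
  measurable_fun setT a -> measurable_fun setT b ->
  measurable_fun setT z1 -> measurable_fun setT z2 ->
  measurable_fun setT (fun w => straddle (b w) (a w) (z1 w, z2 w)).
Proof.
move=> ma mb m1 m2; apply: measurable_fun_ifT => //=.
apply: measurable_and; first exact: measurable_fun_ler.
by apply: measurable_and; exact: measurable_fun_ltr.
Qed.

Lemma straddle_area (b a : R) :
  (\int[(sigma_product mu mu)]_z (straddle b a z)%:E = (Num.max (a - b) 0 ^+ 2 / 2)%:E)%E.
Proof.
rewrite /sigma_product fubini_tonelli1; last 2 first.
- apply/measurable_EFinP.
  rewrite (_ : straddle b a = (fun z => straddle (cst b z) (cst a z) (fst z, snd z))).
    apply: measurable_straddle; try exact: measurable_cst.
    - exact: measurable_fst.
    - exact: measurable_snd.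
  by apply/funext => -[].
- by move=> z; rewrite lee_fin straddle_ge0.
have inner x : (fubini_F mu (EFin \o straddle b a) x =
    (((fun x => a - x) \_ (`[b, a]%classic)) x)%:E)%E.
  rewrite /fubini_F patchE; have [bx|xb] := leP b x; last first.
    rewrite memNset/=; last by rewrite in_itv/= leNgt xb.
    by apply: integral0_eq => y _; rewrite /straddle/= leNgt xb.
  transitivity (\int[mu]_y (\1_(`]x, a[%classic) y)%:E)%E.
    apply: eq_integral => y _; rewrite /straddle/= bx/= indicE.
    by rewrite mem_setE in_itv/=; case: ifP.
  rewrite integral_indic// setIT.
  rewrite [X in X = _](lebesgue_measure_itv `]x, a[)/= lte_fin.
  have [xa|ax] := ltP x a.
    by rewrite mem_set/=; last by rewrite in_itv/= bx ltW.
  case: ifPn => // /set_mem/=; rewrite in_itv/= bx/= => xa.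
  by congr (_%:E); apply/esym/eqP; rewrite subr_eq0 eq_le ax xa.
transitivity (\int[mu]_x (((fun x => a - x) \_ (`[b, a]%classic)) x)%:E)%E.
  by apply: eq_integral => x _; exact: inner.
transitivity (\int[mu]_(x in `[b, a]) (a - x)%:E)%E.
  by rewrite [RHS]integral_mkcond; apply: eq_integral => x _; rewrite restrict_EFin.
have [ab|ba|->] := ltgtP a b.
- rewrite set_itv_ge ?integral_set0; last by rewrite bnd_simp -ltNge.
  by rewrite max_r ?expr0n/= ?mul0r// subr_le0 ltW.
- rewrite max_l ?subr_ge0 ?(ltW ba)//.
  have dF (x : R) : is_derive x 1 (fun x : R => - 2^-1 * (a - x) ^+ 2) (a - x).
    have := is_derive1Z (- 2^-1) (is_derive1X 2 (is_derive1B (is_derive_cst a x 1) (is_derive_id x (1 : R)))).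
    by move/is_derive_eq; apply; rewrite /= expr1 /cst; field.
  rewrite (FTC2_is_derive ba (fun x _ => dF x)); last first.
    by move=> x _; apply: cvgB; [exact: cvg_cst|exact: cvg_id].
  by congr (_%:E); rewrite subrr; field.
- by rewrite set_itv1 integral_set1 subrr maxxx expr0n/= mul0r.
Qed.

Lemma layer_cake d (T : measurableType d) (nu : {sigma_finite_measure set T -> \bar R})
    (rho A B : T -> R) :
  measurable_fun setT rho -> measurable_fun setT A -> measurable_fun setT B ->
  (forall w, 0 <= rho w) ->
  (\int[nu]_w (rho w * (Num.max (A w - B w) 0 ^+ 2 / 2))%:E =
   \int[(sigma_product mu mu)]_z \int[nu]_w (rho w * straddle (B w) (A w) z)%:E)%E.
Proof.
move=> mrho mA mB rho0.
pose f (p : T * (R * R)) := (rho p.1 * straddle (B p.1) (A p.1) p.2)%:E.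
have mf : measurable_fun setT f.
  apply/measurable_EFinP; apply: measurable_funM.
    by apply: measurableT_comp => //; exact: measurable_fst.
  under eq_fun do rewrite (surjective_pairing _.2).
  apply: measurable_straddle.
  - by apply: measurableT_comp => //; exact: measurable_fst.
  - by apply: measurableT_comp => //; exact: measurable_fst.
  - by apply: (measurableT_comp measurable_fst); exact: measurable_snd.
  - by apply: (measurableT_comp measurable_snd); exact: measurable_snd.
have f0 p : (0 <= f p)%E by rewrite lee_fin mulr_ge0// straddle_ge0.
have := @fubini_tonelli _ _ _ _ _ nu (sigma_product mu mu) f mf f0.
rewrite /fubini_F /fubini_G /f/= => <-.
apply: eq_integral => w _.
under eq_integral do rewrite EFinM.
rewrite ge0_integralZl//.
- by rewrite straddle_area -EFinM.
- apply/measurable_EFinP.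
  rewrite (_ : straddle _ _ = (fun z => straddle (cst (B w) z) (cst (A w) z) (fst z, snd z))).
    apply: measurable_straddle; try exact: measurable_cst.
    - exact: measurable_fst.
    - exact: measurable_snd.
  by apply/funext => -[].
- by move=> z _; rewrite lee_fin straddle_ge0.
- by rewrite lee_fin.
Qed.

(* [max(A - B, 0)^2 / 2] is the area of [{(x, y) | B <= x < y < A}], so its
   weighted integral only depends on the weights of the events [B <= x, y < A]. *)
Lemma layer_cake_transfer d (T : measurableType d) (nu : {sigma_finite_measure set T -> \bar R})
    (rho A B : T -> R) d' (T' : measurableType d')
    (nu' : {sigma_finite_measure set T' -> \bar R}) (rho' A' B' : T' -> R) :
  measurable_fun setT rho -> measurable_fun setT A -> measurable_fun setT B ->
  measurable_fun setT rho' -> measurable_fun setT A' -> measurable_fun setT B' ->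
  (forall w, 0 <= rho w) -> (forall w, 0 <= rho' w) ->
  (forall x y : R, (x < y)%R ->
    \int[nu]_w (rho w * (if (B w <= x) && (y < A w) then 1 else 0))%:E =
    \int[nu']_w (rho' w * (if (B' w <= x) && (y < A' w) then 1 else 0))%:E)%E ->
  (\int[nu]_w (rho w * Num.max (A w - B w) 0 ^+ 2)%:E =
   \int[nu']_w (rho' w * Num.max (A' w - B' w) 0 ^+ 2)%:E)%E.
Proof.
move=> mrho mA mB mrho' mA' mB' r0 r0' H.
have twice e (S : measurableType e) (m : {sigma_finite_measure set S -> \bar R}) (r C E : S -> R) :
    measurable_fun setT r -> measurable_fun setT C -> measurable_fun setT E ->
    (forall w, 0 <= r w) ->
    (\int[m]_w (r w * Num.max (C w - E w) 0 ^+ 2)%:E =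
     2%:E * \int[m]_w (r w * (Num.max (C w - E w) 0 ^+ 2 / 2))%:E)%E.
  move=> mr mC mE r0''; rewrite -ge0_integralZl//.
  - by apply: eq_integral => w _; rewrite -EFinM; congr (_%:E); field.
  - apply/measurable_EFinP; apply: measurable_funM => //; apply: measurable_funM => //.
    by apply: measurable_funX; apply: measurable_maxr => //; exact: measurable_funB.
  - by move=> w _; rewrite lee_fin mulr_ge0// divr_ge0// sqr_ge0.
rewrite !twice// !layer_cake//; congr (_ * _)%E.
apply: eq_integral => -[x y] _.
rewrite /straddle/=; have [xy|yx] := ltP x y; first by rewrite /=; exact: H.
by transitivity (0%E : \bar R); [|symmetry]; apply: integral0_eq => w _; rewrite /= andbF mulr0.
Qed.
End layer_cake.

(** * Exponential weights of powers of the distribution function *)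

Section exponential_weight.
Context {R : realType}.
Notation mu := (@lebesgue_measure R).
Notation D := (`]0%R, +oo[%classic : set R).

(** Extended by 0 to the whole line so that it can be the weight [rho] of [layer_cake_transfer] with
    respect to Lebesgue measure. *)
Definition expweight (k t : R) : R := if 0 < t then expR (- (k * t)) else 0.

Lemma expweight_ge0 k t : 0 <= expweight k t.
Proof. by rewrite /expweight; case: ifP => // _; exact: expR_ge0. Qed.

Lemma measurable_expweight k : measurable_fun setT (expweight k).
Proof.
apply: measurable_fun_ifT => //; first exact: measurable_fun_ltr.
apply: measurableT_comp => //; apply: measurable_funN; exact: measurable_funM.
Qed.

Lemma integral_expweight k (f : R -> R) :
  (\int[mu]_t (expweight k t * f t)%:E = \int[mu]_(t in D) (expR (- (k * t)) * f t)%:E)%E.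
Proof.
rewrite [RHS]integral_mkcond; apply: eq_integral => t _.
rewrite /expweight patchE; case: ifPn => t0.
  by rewrite mem_set//= in_itv/= andbT.
by rewrite mul0r memNset//= in_itv/= andbT; exact/negP.
Qed.

Lemma integral_expRN_tail (k t0 : R) : 0 < k -> 0 <= t0 ->
  (\int[mu]_(t in `]t0, +oo[) (expR (- (k * t)))%:E = (k^-1 * expR (- (k * t0)))%:E)%E.
Proof.
move=> k0 t00.
have cE : continuous (fun t : R => expR (- (k * t))).
  by move=> t; apply: continuous_comp; [apply: cvgN; apply: cvgM; [exact: cvg_cst|exact: cvg_id]|exact: continuous_expR].
have dF (t : R) : is_derive t 1 (fun t => - k^-1 * expR (- (k * t))) (expR (- (k * t))).
  have := is_derive1Z (- k^-1) (is_derive1_comp (is_derive1_expRN (k * t)) (is_derive1Z k (is_derive_id t (1 : R)))).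
  by move/is_derive_eq; apply; field; rewrite gt_eqF.
rewrite integral_itv_obnd_cbnd//; last first.
  by apply/measurable_EFinP; apply: measurable_funTS; exact: continuous_measurable_fun.
rewrite (@ge0_continuous_FTC2y _ _ (fun t => - k^-1 * expR (- (k * t))) _ 0)//.
- by rewrite sub0e -EFinN mulNr opprK.
- exact: continuous_subspaceT.
- rewrite -[X in _ --> X](mulr0 (- k^-1)); apply: cvgM; first exact: cvg_cst.
  apply: (@cvg_comp _ _ _ (fun t => k * t) (fun t => expR (- t)) _ (pinfty_nbhs R)); last exact: cvgr_expR.
  exact: gt0_cvgMry.
- by apply: cvg_at_right_filter; exact: (is_derive1_continuous (dF t0)).
- by move=> x _; rewrite (is_derive1E (dF x)).1.
Qed.

(** The condition reads t >= - n ln c, except that c = 0 has no logarithm and is treated apart. The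
    rates used later are k = 1, which yields c^n, the law of the maximum, and k = 1/n and k = 1 -
    1/n, which yield c and c^(n-1) for the two factors of [gap_weight]. *)
Lemma expweight_le (k n c : R) : 0 < k -> 0 < n -> 0 <= c <= 1 ->
  (\int[mu]_t (expweight k t * (if expR (- (t / n)) <= c then 1 else 0))%:E =
   (k^-1 * c `^ (n * k))%:E)%E.
Proof.
move=> k0 n0 /andP[c0 c1]; rewrite integral_expweight.
have [->|c_neq0] := eqVneq c 0.
  rewrite powR0 ?mulf_neq0 ?gt_eqF// mulr0; apply: integral0_eq => t _.
  by rewrite leNgt expR_gt0 mulr0.
have {c_neq0} c_gt0 : 0 < c by rewrite lt_neqAle eq_sym c_neq0.
pose t0 := - (n * ln c); have t00 : 0 <= t0.
  by rewrite oppr_ge0 mulr_ge0_le0 ?ln_le0// ltW.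
have tE t : (expR (- (t / n)) <= c) = (t0 <= t).
  rewrite -[in LHS](lnK (c_gt0 : c \is Num.pos)) ler_expR lerNl ler_pdivlMr//.
  by rewrite /t0 mulNr mulrC.
have -> : c `^ (n * k) = expR (- (k * t0)).
  by rewrite /powR gt_eqF// /t0 mulrN opprK mulrCA mulrA.
rewrite -integral_expRN_tail// integral_itv_obnd_cbnd; last first.
  apply/measurable_EFinP; apply: measurable_funTS; apply: measurableT_comp => //.
  by apply: measurable_funN; exact: measurable_funM.
have [t0_eq|t0_neq] := eqVneq t0 0.
  rewrite t0_eq -integral_itv_obnd_cbnd; last first.
    apply/measurable_EFinP; apply: measurable_funTS; apply: measurableT_comp => //.
    by apply: measurable_funN; exact: measurable_funM.
  apply: eq_integral => t /set_mem/=; rewrite in_itv/= andbT => t_gt0.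
  by rewrite tE t0_eq ltW// mulr1.
have t0_gt0 : 0 < t0 by rewrite lt_neqAle eq_sym t0_neq.
rewrite [LHS]integral_mkcond [RHS]integral_mkcond.
apply: eq_integral => t _; rewrite !patchE tE.
have [tt|tt] := leP t0 t.
  rewrite !mem_set/= ?in_itv/= ?tt// ?mulr1//.
  by rewrite andbT (lt_le_trans t0_gt0).
rewrite [in RHS]memNset/=; last by rewrite in_itv/= andbT leNgt tt.
by rewrite mulr0; case: ifP.
Qed.

Lemma expweight_gt (k n c : R) : 0 < k -> 0 < n -> 0 <= c <= 1 ->
  (\int[mu]_t (expweight k t * (if c < expR (- (t / n)) then 1 else 0))%:E =
   (k^-1 * (1 - c `^ (n * k)))%:E)%E.
Proof.
move=> k0 n0 c01.
have mw (b : R -> bool) : measurable_fun setT b ->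
    measurable_fun setT (fun t => expweight k t * (if b t then 1 else 0)).
  by move=> mb; apply: measurable_funM; [exact: measurable_expweight|exact: measurable_fun_ifT].
have me : measurable_fun setT (fun t : R => expR (- (t / n))).
  by apply: measurableT_comp => //; apply: measurable_funN; exact: measurable_funM.
have : (\int[mu]_t (expweight k t * (if expR (- (t / n)) <= c then 1 else 0))%:E +
  \int[mu]_t (expweight k t * (if c < expR (- (t / n)) then 1 else 0))%:E = (k^-1)%:E)%E.
  rewrite -ge0_integralD//.
  - transitivity (\int[mu]_t (expweight k t * 1)%:E)%E; last first.
      rewrite integral_expweight; under eq_integral do rewrite mulr1.
      by rewrite integral_expRN_tail// mulr0 oppr0 expR0 mulr1.
    apply: eq_integral => t _; rewrite -EFinD; congr (_%:E); rewrite ltNge.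
    by case: ifP => _; rewrite mulr0 mulr1 ?addr0 ?add0r.
  - by move=> t _; rewrite lee_fin mulr_ge0 ?expweight_ge0//; case: ifP.
  - by apply/measurable_EFinP; apply: mw; exact: measurable_fun_ler.
  - by move=> t _; rewrite lee_fin mulr_ge0 ?expweight_ge0//; case: ifP.
  - by apply/measurable_EFinP; apply: mw; exact: measurable_fun_ltr.
rewrite expweight_le// => h.
have -> : (k^-1 * (1 - c `^ (n * k)))%:E = (k^-1%:E - (k^-1 * c `^ (n * k))%:E)%E.
  by rewrite -EFinB; congr (_%:E); ring.
by rewrite -h addeAC subee// add0e.
Qed.
End exponential_weight.

(** * Order statistics and quantiles *)

Section sorted_counting.
Context {R : realType}.
Implicit Types (s : seq R) (x : R).

Lemma nth_sorted_le s x k : sorted >=%R s -> (k < size s)%N ->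
  (nth 0 s k <= x)%R = (count (fun y : R => (x < y)%R) s <= k)%N.
Proof.
elim: s k => //= y s IH k ys ks.
have [yx|xy] := leP y x; last first.
  case: k ks => [|k] ks /=; first by rewrite leNgt xy.
  by rewrite IH ?(path_sorted ys).
have -> : count (fun z : R => x < z) s = 0%N.
  apply/eqP; rewrite -leqn0 leqNgt -has_count; apply/hasPn => z zs.
  rewrite -leNgt; apply: le_trans yx.
  by have /allP/(_ z zs) := order_path_min (rev_trans le_trans) ys.
case: k ks => [|k] ks /=; first by rewrite yx.
rewrite leq0n; apply: le_trans yx.
have /allP := order_path_min (rev_trans le_trans) ys; apply; exact: mem_nth.
Qed.

(** Counting is invariant under permutation, so the sort disappears from the right-hand side. *)
Lemma nth_sort_le s x k : (k < size s)%N ->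
  (nth 0 (sort (fun y z : R => (z <= y)%R) s) k <= x)%R = (count (fun y : R => (x < y)%R) s <= k)%N.
Proof.
move=> ks; rewrite nth_sorted_le ?size_sort//.
  by rewrite (permP (permEl (perm_sort _ _))).
by apply: sort_sorted => y z; rewrite le_total.
Qed.

Lemma seq_max_le s x : s != [::] -> (seq_max s <= x) = all (fun y => y <= x) s.
Proof.
case: s => // y s _; rewrite /seq_max/=.
have E (t : seq R) : (\big[Num.max/y]_(z <- t) z <= x) = (y <= x) && all (fun z => z <= x) t.
  elim: t => [|z t IH]; first by rewrite big_nil andbT.
  by rewrite big_cons ge_max IH /= andbCA.
by rewrite big_cons ge_max E andbA andbb.
Qed.
End sorted_counting.

Section order_statistics.
Context d (T : measurableType d) (R : realType) (P : probability T R).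
Context (n : nat) (X : 'I_n -> {RV P >-> R}).

Definition exceedances (x : R) (w : T) : nat := #|[pred i : 'I_n | x < X i w]|.

Lemma order_stat_le k x w : (0 < k <= n)%N ->
  (order_stat X k w <= x) = (exceedances x w < k)%N.
Proof.
case: k => // k /= kn; rewrite /order_stat /= nth_sort_le; last first.
  by rewrite size_map size_enum_ord.
by rewrite /sample count_map ltnS /exceedances cardE -size_filter /enum_mem filter_predT.
Qed.

Lemma order_stat1_le x w : (0 < n)%N ->
  (order_stat X 1 w <= x) = [forall i, X i w <= x].
Proof.
move=> n0; rewrite order_stat_le// ltnS leqn0 /exceedances.
apply/eqP/forallP => [/card0_eq h i|h]; first by have := h i; rewrite !inE ltNge => /negbFE.
by apply: eq_card0 => i; rewrite !inE ltNge h.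
Qed.

Lemma sample_max_order_stat w : (0 < n)%N -> sample_max X w = order_stat X 1 w.
Proof.
move=> n0.
have E x : (sample_max X w <= x) = (order_stat X 1 w <= x).
  rewrite order_stat1_le// /sample_max seq_max_le; last first.
    by rewrite -size_eq0 size_map size_enum_ord -lt0n.
  rewrite /sample all_map; apply/allP/forallP => [h i|h i _ /=]; last exact: h.
  by apply: h; rewrite mem_enum.
by apply/eqP; rewrite eq_le E lexx -E lexx.
Qed.

Lemma measurable_order_stat k : (0 < k <= n)%N -> measurable_fun setT (order_stat X k).
Proof.
move=> kn; apply: (measurability _ (RGenOInfty.measurableE R)) => //.
move=> _ [_ [x ->] <-].
pose f w := \sum_(i < n) (if x < X i w then 1 else 0) : R.
have mf : measurable_fun setT f.
  apply: measurable_sum => i; apply: measurable_fun_ifT => //.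
  by apply: measurable_fun_ltr => //; exact: measurable_funP.
have fE w : f w = (exceedances x w)%:R.
  by rewrite /f -big_mkcond/= sumr_const.
rewrite setTI.
(* At least k exceedances, written for the real-valued count [f] as k - 1 < f, an open ray. *)
rewrite (_ : _ @^-1` _ = f @^-1` `]k%:R - 1, +oo[).
  by rewrite -[X in measurable X]setTI; apply: mf.
have E w : (x < order_stat X k w) = (k%:R - 1 < f w).
  by rewrite ltNge order_stat_le// -leqNgt fE ltrBlDr natr1 ltr_nat ltnS.
by apply/seteqP; split => w /=; rewrite !in_itv/= !andbT E.
Qed.
End order_statistics.

Section iid_order_statistics.
Context d (T : measurableType d) (R : realType) (P : probability T R).
Context (F : cumulativeBounded (0 : R) (1 : R)) (n : nat) (X : 'I_n -> {RV P >-> R}).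
Context (hX : iid_sample F X).

Lemma probability_box (A : 'I_n -> set R) : (forall i, measurable (A i)) ->
  P [set w | forall i, A i (X i w)] = (\prod_(i < n) P (X i @^-1` A i))%E.
Proof.
move=> mA; pose J := [fset i | i in enum 'I_n]%fset.
have inJ i : i \in J by apply/imfsetP; exists i => //=; rewrite mem_enum.
have := hX.1 J A mA.
rewrite (perm_big (index_enum 'I_n)); last first.
  by apply: uniq_perm; [exact: fset_uniq|exact: index_enum_uniq|move=> i; rewrite mem_index_enum inJ].
by move=> <-; congr (P _); apply/seteqP; split => w /= h; [move=> i _; exact: h|move=> i; apply: (h i); exact: inJ].
Qed.

Lemma probability_sample_le i x : P (X i @^-1` `]-oo, x]) = (F x)%:E.
Proof. exact: hX.2 i x. Qed.

Lemma probability_sample_gt i y : P (X i @^-1` `]y, +oo[) = (1 - F y)%:E.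
Proof.
rewrite -setCitvl preimage_setC probability_setC ?probability_sample_le//.
exact: (measurable_funPTI (X i) (measurable_itv `]-oo, y])).
Qed.

Lemma probability_order_stat1_le x : (0 < n)%N ->
  P [set w | order_stat X 1 w <= x] = (F x ^+ n)%:E.
Proof.
move=> n0.
rewrite (_ : [set w | _] = [set w | forall i, `]-oo, x]%classic (X i w)]); last first.
  apply/seteqP; split => w /=; rewrite order_stat1_le//.
    by move=> /forallP h i; rewrite in_itv/=.
  by move=> h; apply/forallP => i; have := h i; rewrite in_itv.
rewrite (probability_box (fun=> measurable_itv `]-oo, x])).
under eq_bigr do rewrite probability_sample_le.
by rewrite prodEFin prodr_const card_ord.
Qed.

Lemma probability_order_stat1_gt y : (0 < n)%N ->
  P [set w | y < order_stat X 1 w] = (1 - F y ^+ n)%:E.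
Proof.
move=> n0; rewrite (_ : [set w | _] = ~` [set w | order_stat X 1 w <= y]).
  rewrite probability_setC ?probability_order_stat1_le//.
  have := @measurable_order_stat _ _ _ _ _ X 1%N; rewrite n0 => /(_ isT) m.
  rewrite (_ : [set w | _] = order_stat X 1 @^-1` `]-oo, y]); last first.
    by apply/seteqP; split => w /=; rewrite in_itv.
  by rewrite -[X in measurable X]setTI; exact: m.
by apply/seteqP; split => w /=; rewrite ltNge => /negP.
Qed.

(* The event is the disjoint union over [i] of
   "only observation [i] exceeds [y], all the others are at most [x]". *)
Lemma probability_order_stat_straddle (x y : R) : x < y -> (1 < n)%N ->
  P [set w | (order_stat X 2 w <= x) && (y < order_stat X 1 w)] =
  (n%:R * (F x ^+ n.-1 * (1 - F y)))%:E.
Proof.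
move=> xy n1; have n0 := ltnW n1.
pose A (i j : 'I_n) := if j == i then `]y, +oo[%classic else `]-oo, x]%classic : set R.
have mA i j : measurable (A i j) by rewrite /A; case: ifP.
pose E i := [set w | forall j, A i j (X j w)].
have -> : [set w | (order_stat X 2 w <= x) && (y < order_stat X 1 w)] =
    \big[setU/set0]_(i < n) E i.
  rewrite -bigcup_seq; apply/seteqP; split => [w /=|w [i _ /= Ei]].
    rewrite order_stat_le// ltNge order_stat_le// -leqNgt => /andP[].
    rewrite ltnS => /card_le1_eqP ex /card_gt0P[i]; rewrite inE => yi.
    have xi := lt_trans xy yi.
    exists i; first by rewrite /= mem_index_enum.
    move=> j; rewrite /A; case: eqP => [->|ji] /=; rewrite in_itv/= ?andbT//.
    by rewrite leNgt; apply/negP => xj; apply: ji; apply: ex.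
  have Xi : y < X i w by have := Ei i; rewrite /A eqxx/= in_itv/= andbT.
  have Xj j : x < X j w -> j = i.
    by move=> xj; apply/eqP; apply: contraTT xj => /negPf ji; have := Ei j; rewrite /A ji/= in_itv/= leNgt.
  rewrite order_stat_le// ltNge order_stat_le// -leqNgt; apply/andP; split.
    by rewrite ltnS; apply/card_le1_eqP => j k; rewrite !inE => /Xj-> /Xj->.
  by apply/card_gt0P; exists i; rewrite inE.
rewrite measure_bigsetU_ord.
- transitivity (\sum_(i < n) (F x ^+ n.-1 * (1 - F y))%:E)%E; last first.
    by rewrite sumEFin sumr_const card_ord mulr_natl.
  apply: eq_bigr => i _.
  transitivity (\prod_(j < n) P (X j @^-1` A i j))%E; first exact: (probability_box (mA i)).
  rewrite (bigD1 i)//=.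
  rewrite {1}/A eqxx probability_sample_gt.
  transitivity ((1 - F y)%:E * \prod_(j < n | j != i) (F x)%:E)%E.
    congr (_ * _)%E; apply: eq_bigr => j /negPf ji.
    by rewrite /A ji probability_sample_le.
  by rewrite prodEFin prodr_const cardC1 card_ord -EFinM mulrC.
- move=> i; rewrite (_ : E i = \big[setI/setT]_(j < n) (X j @^-1` A i j)).
    by apply: bigsetI_measurable => j _; exact: measurable_funPTI.
  by rewrite -bigcap_seq; apply/seteqP; split => w /= h j; [move=> _; exact: h|apply: (h j); rewrite /= mem_index_enum].
- move=> i j _ _ [w [/= hi hj]]; apply/eqP; apply: contraT => ij.
  have := hi i; have := hj i; rewrite /A eqxx (negPf ij)/= !in_itv/= andbT => h1 h2.
  by have := lt_le_trans (lt_trans xy h2) h1; rewrite ltxx.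
Qed.
End iid_order_statistics.

Section integral_indicator.
Context d (T : measurableType d) (R : realType) (P : probability T R).

Lemma integral_indicator (b : T -> bool) : measurable_fun setT b ->
  (\int[P]_w (1 * (if b w then 1 else 0))%:E = P [set w | b w])%E.
Proof.
move=> mb.
have mE : measurable [set w | b w].
  rewrite (_ : [set w | b w] = b @^-1` [set true]).
    by rewrite -[X in measurable X]setTI; exact: mb.
  by apply/seteqP; split => w /= ->.
rewrite -[[set w | b w]]setIT -integral_indic//; apply: eq_integral => w _.
rewrite indicE mul1r; congr (_%:E); case: ifPn => bw.
  by rewrite mem_set.
by rewrite memNset//; exact/negP.
Qed.
End integral_indicator.

(** * Quantiles as the inverse of the distribution function *)

Section quantile.
Context {R : realType} (F : cumulativeBounded (0 : R) (1 : R)).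
Notation mu := (@lebesgue_measure R).

Lemma cumulative01 x : 0 <= F x <= 1.
Proof.
have nd : {homo F : u v / u <= v} by exact: cumulative_is_nondecreasing.
apply/andP; split.
- by apply: (cvgr_to_le (cumulativeNy F)); exists x; split; [exact: num_real|move=> z /ltW/nd].
- by apply: (cvgr_to_ge (cumulativey F)); exists x; split; [exact: num_real|move=> z /ltW/nd].
Qed.

(** The Galois connection between [F] and its quantile. The bounds on y make the set nonempty and
    bounded below, and right continuity makes its infimum a member. *)
Lemma quantile_le (y x : R) : 0 < y < 1 -> (quantile F y <= x) = (y <= F x).
Proof.
move=> /andP[y0 y1].
have nd : {homo F : u v / u <= v} by exact: cumulative_is_nondecreasing.
have ne : [set x | y <= F x] !=set0.
  have [M [_ HM]] := cvgr_ge _ (cumulativey F) _ y1.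
  by exists (M + 1); apply: HM; rewrite ltrDl.
have lb : has_lbound [set x | y <= F x].
  have [M [_ HM]] := cvgr_lt _ (cumulativeNy F) _ y0.
  exists M => z /= yz; rewrite leNgt; apply/negP => /HM.
  by rewrite ltNge yz.
apply/idP/idP => [qx|yx]; last by apply: ge_inf.
have h e : 0 < e -> y <= F (x + e).
  move=> e0; have [z /= yz zlt] := inf_adherent e0 (conj ne lb).
  by apply: le_trans yz _; apply: nd; rewrite (le_trans (ltW zlt))// lerD2r.
apply: (cvgr_to_ge (cumulative_is_right_continuous F x)).
near=> z; rewrite -(subrKC x z); apply: h; rewrite subr_gt0.
by near: z; exact: nbhs_right_gt.
Unshelve. all: by end_near.
Qed.

(* [tail_quantile (t / n)] for an exponential variable [t] of mean 1 has the law
   of the maximum of [n] observations. *)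
Definition tail_quantile (s : R) : R := if 0 < s then quantile F (expR (- s)) else 0.

Lemma tail_quantile_le s x : 0 < s -> (tail_quantile s <= x) = (expR (- s) <= F x).
Proof.
by move=> s0; rewrite /tail_quantile s0 quantile_le// expR_gt0/= expR_lt1 oppr_lt0.
Qed.

Lemma tail_quantile_gt s x : 0 < s -> (x < tail_quantile s) = (F x < expR (- s)).
Proof. by move=> s0; rewrite !ltNge tail_quantile_le. Qed.

Lemma tail_quantile_antitone :
  {in [pred r | 0 < r] &, {homo tail_quantile : x y / x <= y >-> y <= x}}.
Proof.
move=> s t; rewrite !inE => s0 t0 st; rewrite tail_quantile_le//.
apply: (@le_trans _ _ (expR (- s))); first by rewrite ler_expR lerN2.
by rewrite -tail_quantile_le.
Qed.

Lemma measurable_tail_quantile : measurable_fun setT tail_quantile.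
Proof.
apply: (measurability _ (RGenOInfty.measurableE R)) => //.
move=> _ [_ [x ->] <-].
pose b (s : R) := (0 < s) && (F x < expR (- s)) || ~~ (0 < s) && (x < 0).
have mb : measurable_fun setT b.
  apply: measurable_or; apply: measurable_and => //.
  - exact: measurable_fun_ltr.
  - apply: measurable_fun_ltr => //; apply: measurableT_comp => //.
  - by apply: measurable_neg; exact: measurable_fun_ltr.
rewrite setTI (_ : _ @^-1` _ = b @^-1` [set true]).
  by rewrite -[X in measurable X]setTI; exact: mb.
have E s : (x < tail_quantile s) = b s.
  rewrite /b; case: (ltP 0 s) => s0 /=; first by rewrite tail_quantile_gt ?orbF.
  by rewrite /tail_quantile (ltNge 0 s) s0.
by apply/seteqP; split => s /=; rewrite in_itv/= andbT E.
Qed.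
End quantile.

Section product_weight.
Context {R : realType}.
Notation mu := (@lebesgue_measure R).

Lemma integral_product_weight (f g : R -> R) (If Ig : R) :
  measurable_fun setT f -> measurable_fun setT g ->
  (forall t, 0 <= f t) -> (forall t, 0 <= g t) ->
  (\int[mu]_t (f t)%:E = If%:E)%E -> (\int[mu]_t (g t)%:E = Ig%:E)%E ->
  (\int[(sigma_product mu mu)]_p (f p.1 * g p.2)%:E = (If * Ig)%:E)%E.
Proof.
move=> mf mg f0 g0 hf hg; rewrite /sigma_product fubini_tonelli1; last 2 first.
- apply/measurable_EFinP; apply: measurable_funM.
    by apply: measurableT_comp => //; exact: measurable_fst.
  by apply: measurableT_comp => //; exact: measurable_snd.
- by move=> p; rewrite lee_fin mulr_ge0.
transitivity (\int[mu]_s (Ig%:E * (f s)%:E))%E; last first.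
  rewrite ge0_integralZl//.
  - by rewrite hf -EFinM mulrC.
  - exact/measurable_EFinP.
  - by move=> t _; rewrite lee_fin.
  - by rewrite -hg; apply: integral_ge0 => t _; rewrite lee_fin.
apply: eq_integral => s _; rewrite /fubini_F/=.
under eq_integral do rewrite EFinM.
rewrite ge0_integralZl//; last 3 first.
- exact/measurable_EFinP.
- by move=> t _; rewrite lee_fin.
- by rewrite lee_fin.
by rewrite hg muleC.
Qed.
End product_weight.

(** * Second moments of order statistics as integrals of the quantile *)

Section transfer.
Context d (T : measurableType d) (R : realType) (P : probability T R).
Context (F : cumulativeBounded (0 : R) (1 : R)) (n : nat) (X : 'I_n -> {RV P >-> R}).
Context (hX : iid_sample F X).
Notation mu := (@lebesgue_measure R).
Let Z (t : R) := tail_quantile F (t / n%:R).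

Lemma measurable_scaled_quantile : measurable_fun setT Z.
Proof.
by apply: measurableT_comp; [exact: measurable_tail_quantile|exact: measurable_funM].
Qed.

Let c01 x : 0 <= F x <= 1. Proof. exact: cumulative01. Qed.

Lemma order_stat2_le1 w : (1 < n)%N -> order_stat X 2 w <= order_stat X 1 w.
Proof.
move=> n1; rewrite order_stat_le//.
have h : (0 < 1 <= n)%N by rewrite /= ltnW.
by have := order_stat_le X (order_stat X 1 w) w h; rewrite lexx => /esym/ltnW.
Qed.

Let expweight_le_quantile (k t x : R) : (0 < n)%N ->
  expweight k t * (if Z t <= x then 1 else 0) =
  expweight k t * (if expR (- (t / n%:R)) <= F x then 1 else 0).
Proof.
move=> n0; rewrite /expweight; case: ifP => t0; last by rewrite !mul0r.
by rewrite tail_quantile_le// divr_gt0// ltr0n.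
Qed.

Let expweight_gt_quantile (k t x : R) : (0 < n)%N ->
  expweight k t * (if x < Z t then 1 else 0) =
  expweight k t * (if F x < expR (- (t / n%:R)) then 1 else 0).
Proof.
move=> n0; rewrite /expweight; case: ifP => t0; last by rewrite !mul0r.
by rewrite tail_quantile_gt// divr_gt0// ltr0n.
Qed.

Let measurable_max : (0 < n)%N -> measurable_fun setT (order_stat X 1).
Proof. by move=> n0; exact: measurable_order_stat. Qed.

(** The area argument handles positive parts only, so the square is split at [c]. In each half one
    of the two functions is the constant [c], and the event concerns the maximum alone. *)
Lemma max_sqr_transfer c : (0 < n)%N ->
  (\int[P]_w ((order_stat X 1 w - c) ^+ 2)%:E =
   \int[mu]_t (expweight 1 t * (Z t - c) ^+ 2)%:E)%E.
Proof.
move=> n0; have nR : 0 < n%:R :> R by rewrite ltr0n.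
have mM := measurable_max n0; have mZ := measurable_scaled_quantile.
have up : (\int[P]_w (1 * Num.max (order_stat X 1 w - c) 0 ^+ 2)%:E =
   \int[mu]_t (expweight 1 t * Num.max (Z t - c) 0 ^+ 2)%:E)%E.
  apply: (@layer_cake_transfer _ _ _ P (cst 1) (order_stat X 1) (cst c) _ _ mu (expweight 1) Z (cst c)) => //.
  - exact: measurable_expweight.
  - by move=> t; exact: expweight_ge0.
  move=> x y xy; rewrite /cst/=; case: (leP c x) => cx /=; last first.
    by transitivity (0%E : \bar R); [|symmetry]; apply: integral0_eq => w _; rewrite mulr0.
  rewrite integral_indicator; last exact: measurable_fun_ltr.
  rewrite (probability_order_stat1_gt hX)//.
  under eq_integral do rewrite expweight_gt_quantile//.
  by rewrite expweight_gt// invr1 mul1r mulr1 powR_mulrn//; case/andP: (c01 y).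
have dn : (\int[P]_w (1 * Num.max (c - order_stat X 1 w) 0 ^+ 2)%:E =
   \int[mu]_t (expweight 1 t * Num.max (c - Z t) 0 ^+ 2)%:E)%E.
  apply: (@layer_cake_transfer _ _ _ P (cst 1) (cst c) (order_stat X 1) _ _ mu (expweight 1) (cst c) Z) => //.
  - exact: measurable_expweight.
  - by move=> t; exact: expweight_ge0.
  move=> x y xy; rewrite /cst/=; case: (ltP y c) => cx /=; last first.
    by transitivity (0%E : \bar R); [|symmetry]; apply: integral0_eq => w _; rewrite andbF mulr0.
  under eq_integral do rewrite andbT.
  rewrite integral_indicator; last exact: measurable_fun_ler.
  rewrite (probability_order_stat1_le hX)//.
  under eq_integral do rewrite andbT expweight_le_quantile//.
  by rewrite expweight_le// invr1 mul1r mulr1 powR_mulrn//; case/andP: (c01 x).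
have split (r : R) (z : R) : 0 <= r -> r * (z - c) ^+ 2 =
    r * Num.max (z - c) 0 ^+ 2 + r * Num.max (c - z) 0 ^+ 2.
  move=> r0; rewrite -mulrDr; congr (_ * _).
  case: (leP z c) => zc.
    by rewrite max_r ?subr_le0// max_l ?subr_ge0// expr0n add0r -sqrrN opprB.
  by rewrite max_l ?subr_ge0 1?ltW// max_r ?subr_le0 1?ltW// expr0n addr0.
have mmax e (S : measurableType e) (f g r : S -> R) : measurable_fun setT f ->
    measurable_fun setT g -> measurable_fun setT r ->
    measurable_fun setT (fun w => (r w * Num.max (f w - g w) 0 ^+ 2)%:E).
  move=> mf mg mr; apply/measurable_EFinP; apply: measurable_funM => //.
  by apply: measurable_funX; apply: measurable_maxr => //; exact: measurable_funB.
transitivity (\int[P]_w ((1 * Num.max (order_stat X 1 w - c) 0 ^+ 2)%:E + (1 * Num.max (c - order_stat X 1 w) 0 ^+ 2)%:E))%E.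
  by apply: eq_integral => w _; rewrite -EFinD -split// mul1r.
rewrite ge0_integralD//; last 4 first.
- by move=> w _; rewrite lee_fin mulr_ge0 ?sqr_ge0.
- exact: (mmax _ _ _ (cst c) (cst 1)).
- by move=> w _; rewrite lee_fin mulr_ge0 ?sqr_ge0.
- exact: (mmax _ _ (cst c) _ (cst 1)).
rewrite up dn -ge0_integralD//.
- by apply: eq_integral => t _; rewrite -EFinD -split ?expweight_ge0.
- by move=> w _; rewrite lee_fin mulr_ge0 ?sqr_ge0 ?expweight_ge0.
- by apply: (mmax _ _ _ (cst c)) => //; exact: measurable_expweight.
- by move=> w _; rewrite lee_fin mulr_ge0 ?sqr_ge0 ?expweight_ge0.
- by apply: (mmax _ _ (cst c)) => //; exact: measurable_expweight.
Qed.

(* Not the joint law of the two largest observations: this weight only gives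
   the events [X(2) <= x, y < X(1)] with [x < y] their probability
   [n F(x)^(n-1) (1 - F y)], which is all that [layer_cake_transfer] needs. *)
Definition gap_weight (p : R * R) : R :=
  (1 - n%:R^-1) * (expweight n%:R^-1 p.1 * expweight (1 - n%:R^-1) p.2).

Lemma gap_weight_ge0 p : (0 < n)%N -> 0 <= gap_weight p.
Proof.
move=> n0; rewrite /gap_weight !mulr_ge0 ?expweight_ge0//.
by rewrite subr_ge0 invf_le1 ?ltr0n// ler1n.
Qed.

Lemma measurable_gap_weight : measurable_fun setT gap_weight.
Proof.
apply: measurable_funM => //; apply: measurable_funM.
  by apply: (measurableT_comp (@measurable_expweight R _)); exact: measurable_fst.
by apply: (measurableT_comp (@measurable_expweight R _)); exact: measurable_snd.
Qed.

Lemma gap_sqr_transfer : (1 < n)%N ->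
  (\int[P]_w ((order_stat X 1 w - order_stat X 2 w) ^+ 2)%:E =
   \int[(sigma_product mu mu)]_p (gap_weight p * Num.max (Z p.1 - Z p.2) 0 ^+ 2)%:E)%E.
Proof.
move=> n1; have n0 := ltnW n1; have nR : 0 < n%:R :> R by rewrite ltr0n.
have k0 : 0 < n%:R^-1 :> R by rewrite invr_gt0.
have k1 : 0 < 1 - n%:R^-1 :> R by rewrite subr_gt0 invf_lt1// ltr1n.
have mM := measurable_max n0; have mZ := measurable_scaled_quantile.
have m2 : measurable_fun setT (order_stat X 2) by exact: measurable_order_stat.
transitivity (\int[P]_w (1 * Num.max (order_stat X 1 w - order_stat X 2 w) 0 ^+ 2)%:E)%E.
  by apply: eq_integral => w _; rewrite mul1r max_l// subr_ge0 order_stat2_le1.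
apply: (@layer_cake_transfer _ _ _ P (cst 1) (order_stat X 1) (order_stat X 2) _ _ (sigma_product mu mu) gap_weight (fun p => Z p.1) (fun p => Z p.2)) => //.
- exact: measurable_gap_weight.
- by apply: (measurableT_comp mZ); exact: measurable_fst.
- by apply: (measurableT_comp mZ); exact: measurable_snd.
- by move=> p; exact: gap_weight_ge0.
move=> x y xy; rewrite /cst/= integral_indicator; last first.
  by apply: measurable_and; [exact: measurable_fun_ler|exact: measurable_fun_ltr].
rewrite (probability_order_stat_straddle hX)//.
transitivity (\int[(sigma_product mu mu)]_p
   (((1 - n%:R^-1) * (expweight n%:R^-1 p.1 * (if F y < expR (- (p.1 / n%:R)) then 1 else 0))) *
    (expweight (1 - n%:R^-1) p.2 * (if expR (- (p.2 / n%:R)) <= F x then 1 else 0)))%:E)%E; last first.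
  apply: eq_integral => p _; congr (_%:E).
  rewrite -expweight_gt_quantile// -expweight_le_quantile// /gap_weight.
  by case: (Z p.2 <= x); case: (y < Z p.1); rewrite /= ?mulr0 ?mul0r ?mulr1// mulrA.
have me : measurable_fun setT (fun t : R => expR (- (t / n%:R))).
  by apply: measurableT_comp => //; apply: measurable_funN; exact: measurable_funM.
have mw (k : R) (b : R -> bool) : measurable_fun setT b ->
    measurable_fun setT (fun t => expweight k t * (if b t then 1 else 0)).
  by move=> mb; apply: measurable_funM; [exact: measurable_expweight|exact: measurable_fun_ifT].
(* Rate 1/n gives n (1 - F y) and rate 1 - 1/n gives F(x)^(n-1) / (1 - 1/n); the prefactor of
   [gap_weight] cancels this last denominator. *)
rewrite (@integral_product_weight _
  (fun t => (1 - n%:R^-1) * (expweight n%:R^-1 t * (if F y < expR (- (t / n%:R)) then 1 else 0)))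
  (fun t => expweight (1 - n%:R^-1) t * (if expR (- (t / n%:R)) <= F x then 1 else 0))
  ((1 - n%:R^-1) * (n%:R * (1 - F y))) ((1 - n%:R^-1)^-1 * F x ^+ n.-1)).
- congr (_%:E); have : (1 - n%:R^-1 : R) != 0 by rewrite gt_eqF.
  by move: (1 - n%:R^-1 : R) => k kn; field.
- by apply: measurable_funM => //; apply: mw; exact: measurable_fun_ltr.
- by apply: mw; exact: measurable_fun_ler.
- by move=> t; rewrite mulr_ge0 ?(ltW k1)// mulr_ge0 ?expweight_ge0//; case: ifP.
- by move=> t; rewrite mulr_ge0 ?expweight_ge0//; case: ifP.
- under eq_integral do rewrite EFinM.
  rewrite ge0_integralZl//.
  + rewrite expweight_gt// invrK mulfV ?gt_eqF// powRr1 ?EFinM//.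
    by case/andP: (c01 y).
  + by apply/measurable_EFinP; apply: mw; exact: measurable_fun_ltr.
  + by move=> t _; rewrite lee_fin mulr_ge0 ?expweight_ge0//; case: ifP.
  + by rewrite lee_fin ltW.
- rewrite expweight_le//; congr (_ * _)%:E.
  rewrite mulrBr mulr1 mulfV ?gt_eqF// -powR_mulrn; last by case/andP: (c01 x).
  by rewrite -[in LHS](prednK n0) -natr1 addrK.
Qed.
End transfer.

Section linear_combination.
Context d (T : measurableType d) (R : realType) (mu : {measure set T -> \bar R}).
Context (D : set T) (mD : measurable D).
Implicit Types f g h : T -> R.

Let integralRD f g (I J : R) : mu.-integrable D (EFin \o f) ->
  mu.-integrable D (EFin \o g) ->
  (\int[mu]_(x in D) (f x)%:E = I%:E)%E -> (\int[mu]_(x in D) (g x)%:E = J%:E)%E ->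
  (\int[mu]_(x in D) (f x + g x)%:E = (I + J)%:E)%E.
Proof.
move=> fi gi fI gJ.
transitivity (\int[mu]_(x in D) ((EFin \o f) x + (EFin \o g) x))%E; first exact: eq_integral.
by rewrite (integralD mD fi gi) fI gJ.
Qed.

Let integralRZ f (c I : R) : mu.-integrable D (EFin \o f) ->
  (\int[mu]_(x in D) (f x)%:E = I%:E)%E ->
  (\int[mu]_(x in D) (c * f x)%:E = (c * I)%:E)%E.
Proof.
move=> fi fI.
transitivity (\int[mu]_(x in D) (c%:E * (EFin \o f) x))%E; first exact: eq_integral.
by rewrite (integralZl mD fi) fI.
Qed.

Lemma integral_linear3 f g h (A B C I J K : R) : mu.-integrable D (EFin \o f) ->
  mu.-integrable D (EFin \o g) -> mu.-integrable D (EFin \o h) ->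
  (\int[mu]_(x in D) (f x)%:E = I%:E)%E -> (\int[mu]_(x in D) (g x)%:E = J%:E)%E ->
  (\int[mu]_(x in D) (h x)%:E = K%:E)%E ->
  (\int[mu]_(x in D) (A * f x + B * g x + C * h x)%:E = (A * I + B * J + C * K)%:E)%E.
Proof.
move=> fi gi hi fI gJ hK.
have iA := integrable_RZ mD A fi; have iB := integrable_RZ mD B gi.
have iC := integrable_RZ mD C hi.
apply: (integralRD (integrable_RD mD iA iB) iC); last exact: integralRZ.
by apply: (integralRD iA iB); exact: integralRZ.
Qed.
End linear_combination.

Section two_point_variance.
Context d (T : measurableType d) (R : realType) (P : probability T R).

(* [M] is an affine combination of [(M - b)^2] and [(M - b - a)^2], so two
   second moments determine the variance. *)
Lemma variance_two_points (M : T -> R) (a b K0 K1 : R) : a != 0 ->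
  measurable_fun setT M ->
  (\int[P]_w ((M w - b) ^+ 2)%:E = (a ^+ 2 * K0)%:E)%E ->
  (\int[P]_w ((M w - (b + a)) ^+ 2)%:E = (a ^+ 2 * K1)%:E)%E ->
  ('V_P[M] = (a ^+ 2 * (K0 - ((K0 - K1 + 1) / 2) ^+ 2))%:E)%E.
Proof.
move=> a0 mM H0 H1.
pose f (c : R) w := (M w - c) ^+ 2.
have mf c : measurable_fun setT (f c).
  by apply: measurable_funX; exact: measurable_funB.
have intf c K : (\int[P]_w (f c w)%:E = K%:E)%E -> P.-integrable setT (EFin \o f c).
  move=> h; apply/integrableP; split; first exact/measurable_EFinP.
  under eq_integral do rewrite /= ger0_norm ?sqr_ge0//.
  by rewrite h ltry.
have i0 := intf _ _ H0; have i1 := intf _ _ H1.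
have i1' : P.-integrable setT (EFin \o cst 1) by exact: finite_measure_integrable_cst.
have I1 : (\int[P]_w (cst 1 w : R)%:E = 1%:E)%E 
  by rewrite -[RHS](probability_setT P) -[RHS]mul1e; exact: (integral_cst P measurableT 1%:E).
have lin (A B C : R) := integral_linear3 measurableT A B C i0 i1 i1' H0 H1 I1.
(* From (M - b)^2 - (M - b - a)^2 = 2 a (M - b) - a^2, integrated. *)
pose m := b + a * ((K0 - K1 + 1) / 2).
have EM : ('E_P[M] = m%:E)%E.
  rewrite unlock -(_ : (2 * a)^-1 * (a ^+ 2 * K0) + - (2 * a)^-1 * (a ^+ 2 * K1) + (b + a / 2) = m); last first.
    by rewrite /m; field.
  rewrite -[b + a / 2]mulr1 -lin; apply: eq_integral => w _; congr (_%:E); rewrite /f /cst; field.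
  exact: a0.
rewrite /variance unlock EM /= [in LHS]unlock.
pose q := m - b.
(* With x = M - b this is (x - q)^2 = (1 - q/a) x^2 + (q/a) (x - a)^2 + q^2 - q a: the weights of
   the squares add up to 1 and match the linear term. *)
transitivity (\int[P]_w ((1 - q / a) * f b w + (q / a) * f (b + a) w + (q ^+ 2 - q * a) * cst 1 w)%:E)%E.
  apply: eq_integral => w _; congr (_%:E).
  change ((M w - m) * (M w - m) = (1 - q / a) * (M w - b) ^+ 2 +
    q / a * (M w - (b + a)) ^+ 2 + (q ^+ 2 - q * a) * 1).
  by rewrite /q; field.
by rewrite lin; congr (_%:E); rewrite /q /m; field.
Qed.
End two_point_variance.

(** * The domain of attraction *)

Section restriction.
Context d (T : measurableType d) (R : realType) (P : probability T R).
Context (F : R -> R) (n m : nat) (nm : (n <= m)%N) (X : 'I_m -> {RV P >-> R}).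

Lemma iid_sample_widen : iid_sample F X -> iid_sample F (fun i => X (widen_ord nm i)).
Proof.
move=> [ind idd]; split=> [J A mA|i x]; last exact: idd.
pose f := widen_ord nm; have f_inj : injective f by move=> i j /(congr1 val) /= /val_inj.
(* Independence is applied to a family indexed by all of ['I_m], so [A] is transported along the
   injection and completed by the whole line. *)
pose B (j : 'I_m) : set R := if insub (val j) is Some i then A i else setT.
have BE i : B (f i) = A i.
  by rewrite /B; case: insubP => [k _ /= ki|]; [congr A; exact: val_inj|rewrite /= ltn_ord].
have mB j : measurable (B j) by rewrite /B; case: insub.
have := ind [fset f i | i in J]%fset B mB.
rewrite big_imfset/=; last by move=> i j _ _; exact: f_inj.
under eq_bigr do rewrite BE.
move=> <-; congr (P _); apply/seteqP; split => w /= h.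
  by move=> j /imfsetP[i /= iJ ->] /=; rewrite BE; exact: h.
by move=> i /= iJ; rewrite -BE; apply: (h (f i)); apply/imfsetP; exists i.
Qed.
End restriction.

Section max_domain.
Context (R : realType) (gamma : R) (F : cumulativeBounded (0 : R) (1 : R)) (a : R -> R).
Context (d : nat -> measure_display) (T : forall n : nat, measurableType (d n))
    (P : forall n : nat, probability (T n) R)
    (X : forall n : nat, 'I_n -> {RV P n >-> R}).
Context (hF : MDA F gamma a) (hX : forall n : nat, (2 <= n)%N -> iid_sample F (@X n)).

Let b (n : nat) := quantile F (1 - n%:R^-1).

Let le2 (n : nat) : (n <= n.+2)%N. Proof. by rewrite -addn2 leq_addr. Qed.

(** [MDA] quantifies over families that are iid for every n, 0 and 1 included, whereas [hX] starts
    at 2. The first n members of the sample of size n + 2 supply such a family. *)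
Let Y (n : nat) (i : 'I_n) := X (widen_ord (le2 n) i).

Let iidY (n : nat) : iid_sample F (@Y n).
Proof. by apply: iid_sample_widen; exact: hX. Qed.

(** [MDA] grants only a >= 0. If a n = 0, division by zero returns 0, so the event at x = 0 is the
    whole space; but its probability tends to exp (-1) < 1. *)
Lemma MDA_norming_gt0 : \forall n \near \oo, 0 < a n%:R.
Proof.
have h0 : 0 < 1 + gamma * 0 by rewrite mulr0 addr0.
have := hF.2 _ _ _ _ iidY 0 h0.
have -> : gev_exponent gamma 0 = 1.
  by rewrite /gev_exponent; case: ifP => _; rewrite ?oppr0 ?expR0// mulr0 addr0 powR1.
have e1 : expR (- 1) < 1 :> R by rewrite expR_lt1 oppr_lt0.
move=> /fine_cvg/cvgr_lt/(_ _ e1) H.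
near=> n.
rewrite lt_neqAle eq_sym hF.1 ?andbT; last by rewrite ler1n; near: n; exact: nbhs_infty_gt.
apply/negP => /eqP a0.
have : fine (P n.+2 [set w | (sample_max (@Y n) w - quantile F (1 - n%:R^-1)) / a n%:R <= 0]) < 1.
  by near: n.
rewrite (_ : [set w | _] = setT) ?probability_setT ?ltxx//.
by apply/seteqP; split => w //= _; rewrite a0 invr0 mulr0.
Unshelve. all: by end_near. Qed.

Lemma MDA_cdf_cvg (x : R) : 0 < 1 + gamma * x ->
  F (b n + a n%:R * x) ^+ n @[n --> \oo] --> expR (- gev_exponent gamma x).
Proof.
move=> hx; have := hF.2 _ _ _ _ iidY x hx => /fine_cvg.
apply: cvg_trans; apply: near_eq_cvg.
have an := MDA_norming_gt0.
near=> n.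
have n0 : (0 < n)%N by near: n; exact: nbhs_infty_gt.
have an0 : 0 < a n%:R by near: n; exact: an.
rewrite /= -[RHS]/(fine (F (b n + a n%:R * x) ^+ n)%:E) -(probability_order_stat1_le (iidY n))//.
congr (fine (P n.+2 _)); apply/seteqP; split => w /=;
  by rewrite ler_pdivrMr// lerBlDl sample_max_order_stat// mulrC.
Unshelve. all: by end_near. Qed.

(** h_n(s) <= x is equivalent to exp (- s) <= F(b n + a n x)^n. At x = h(s - u) and x = h(s + u) the
    right-hand side tends to exp (- (s - u)) and exp (- (s + u)), strictly on either side of exp (-
    s), and continuity of h makes the two values of x close to h(s). *)
Lemma tail_quantile_cvg (s : R) : 0 < s ->
  (tail_quantile F (s / n%:R) - b n) / a n%:R @[n --> \oo] --> gev_inverse gamma s.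
Proof.
move=> s0.
have le_iff n x : (0 < n)%N -> 0 < a n%:R ->
    ((tail_quantile F (s / n%:R) - b n) / a n%:R <= x) = (expR (- s) <= F (b n + a n%:R * x) ^+ n).
  move=> n0 an0; have nR : 0 < n%:R :> R by rewrite ltr0n.
  rewrite ler_pdivrMr// lerBlDl tail_quantile_le ?divr_gt0// [x * _]mulrC.
  have -> : expR (- s) = expR (- (s / n%:R)) ^+ n.
    by rewrite -expRM_natl; congr expR; field; rewrite gt_eqF.
  rewrite ler_pXn2r// ?nnegrE ?expR_ge0//.
  by have /andP[] := cumulative01 F (b n + a n%:R * x).
apply/cvgrPdist_le => e e0.
have /nbhs_ballP[r /= r0 gr] : \forall t \near s, `|gev_inverse gamma s - gev_inverse gamma t| < e.
  by move/cvgrPdist_lt: (gev_inverse_continuous (gamma := gamma) s0); exact.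
pose u := Num.min r s / 2; have u0 : 0 < u by rewrite divr_gt0// lt_min r0.
have ur : u < r.
  rewrite ltr_pdivrMr//.
  have : Num.min r s <= r by rewrite ge_min lexx.
  by rewrite /u; move: (Num.min r s) r0 s0 => v h1 h2 h3; lra.
have us : u < s.
  rewrite ltr_pdivrMr//.
  have : Num.min r s <= s by rewrite ge_min lexx orbT.
  by rewrite /u; move: (Num.min r s) r0 s0 => v h1 h2 h3; lra.
have lo0 : 0 < s - u by rewrite subr_gt0.
have hi0 : 0 < s + u by rewrite addr_gt0.
have glo : gev_inverse gamma (s - u) <= gev_inverse gamma s + e.
  have /gr : ball s r (s - u) by rewrite /ball/= opprB addrC subrK gtr0_norm.
  by rewrite ltr_distlC => /andP[_ /ltW].
have ghi : gev_inverse gamma s - e <= gev_inverse gamma (s + u).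
  have /gr : ball s r (s + u) by rewrite /ball/= opprD addNKr normrN gtr0_norm.
  by rewrite ltr_distlC => /andP[/ltW].
have Flo := MDA_cdf_cvg (gev_inverse_dom gamma lo0).
have Fhi := MDA_cdf_cvg (gev_inverse_dom gamma hi0).
rewrite gev_inverseK// in Flo; rewrite gev_inverseK// in Fhi.
have elo : expR (- s) < expR (- (s - u)) by rewrite ltr_expR ltrN2 ltrBlDr ltrDl.
have ehi : expR (- (s + u)) < expR (- s) by rewrite ltr_expR ltrN2 ltrDl.
have {}Flo := cvgr_gt _ Flo _ elo; have {}Fhi := cvgr_lt _ Fhi _ ehi.
have an := MDA_norming_gt0.
near=> n.
have n0 : (0 < n)%N by near: n; exact: nbhs_infty_gt.
have an0 : 0 < a n%:R by near: n; exact: an.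
rewrite ler_distlC; apply/andP; split.
  apply: (le_trans ghi); apply/ltW; rewrite ltNge le_iff// -ltNge.
  by near: n; exact: Fhi.
by apply: le_trans glo; rewrite le_iff//; apply/ltW; near: n; exact: Flo.
Unshelve. all: by end_near. Qed.
End max_domain.

(** * Growth of the quantile in the lower tail *)

Section tail_bound.
Context (R : realType) (F : cumulativeBounded (0 : R) (1 : R)).

Let id_variable : measurableTypeR R -> R := idfun.

#[local] HB.instance Definition _ :=
  @isMeasurableFun.Build _ _ _ _ id_variable (@measurable_id _ _ setT).

Lemma cdf_chebyshev : finite_variance F ->
  exists m V : R, 0 <= V /\ forall x, x < m -> F x * (m - x) ^+ 2 <= V.
Proof.
move=> fV; pose I := id_variable : {RV (lebesgue_stieltjes_measure F) >-> R}.
pose m := fine 'E_(lebesgue_stieltjes_measure F)[I].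
pose V := fine 'V_(lebesgue_stieltjes_measure F)[I].
exists m, V.
have VE : V%:E = 'V_(lebesgue_stieltjes_measure F)[I].
  by rewrite /V fineK// ge0_fin_numE ?variance_ge0.
split=> [|x xm]; first by rewrite -lee_fin VE variance_ge0.
have d0 : 0 < m - x by rewrite subr_gt0.
have := chebyshev I d0.
rewrite -VE -EFinM => ch.
have : ((F x)%:E <= ((m - x) ^- 2 * V)%:E)%E.
  apply: le_trans ch; rewrite -(cdf_lebesgue_stieltjes_id F x) /cdf /distribution /pushforward.
  apply: (@le_measure _ _ _ (lebesgue_stieltjes_measure F)).
  - by rewrite inE; exact: measurable_itv.
  - rewrite inE.
    have mf : measurable_fun setT (fun y : R => m - x <= `|y - m|).
      apply: measurable_fun_ler => //; apply: measurableT_comp => //.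
      exact: measurable_funB.
    rewrite (_ : [set y | _] = (fun y : R => m - x <= `|y - m|) @^-1` [set true]).
      by rewrite -[X in measurable X]setTI; exact: mf.
    by apply/seteqP; split.
  - move=> y /=; rewrite in_itv/= => yx.
    by rewrite distrC ler_normr lerD2l lerN2 yx.
rewrite lee_fin mulrC => h.
by rewrite -ler_pdivlMr ?exprn_gt0.
Qed.

(** Above, monotonicity bounds Z(u) by Z(1). Below, suppose Z(u) < m - D exp (u/2); as F(Z(u)) >=
    exp (- u), the Chebyshev bound at x = Z(u) would give D^2 <= V, contrary to the choice D > sqrt
    V. *)
Lemma tail_quantile_bound : finite_variance F ->
  exists K, forall u, 1 <= u -> `|tail_quantile F u| <= K * expR (u / 2).
Proof.
move=> /cdf_chebyshev[m [V [V0 H]]].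
pose D := Num.sqrt V + 1; have D0 : 0 < D by rewrite ltr_wpDl ?sqrtr_ge0.
have VD : V < D ^+ 2.
  by rewrite -{1}[V]sqr_sqrtr// ltr_pXn2r ?nnegrE ?sqrtr_ge0 ?(ltW D0)// ltrDl.
exists (`|m| + D + `|tail_quantile F 1|) => u u1.
have u0 : 0 < u by rewrite (lt_le_trans _ u1).
have E1 : 1 <= expR (u / 2) by rewrite -[leLHS]expR0 ler_expR divr_ge0 ?ltW.
have up : tail_quantile F u <= tail_quantile F 1 by apply: tail_quantile_antitone; rewrite ?inE.
have lo : m - D * expR (u / 2) <= tail_quantile F u.
  rewrite leNgt; apply/negP => lt.
  have Q0 : 0 < m - tail_quantile F u by rewrite subr_gt0 (lt_trans lt)// ltrBlDr ltrDl mulr_gt0 ?expR_gt0.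
  have := H (tail_quantile F u); rewrite -subr_gt0 => /(_ Q0).
  have h1 : expR (- u) <= F (tail_quantile F u) by rewrite -tail_quantile_le.
  have h2 : D * expR (u / 2) < m - tail_quantile F u by rewrite ltrBrDl -ltrBrDr.
  rewrite leNgt => /negP; apply.
  apply: (lt_le_trans VD); apply: (@le_trans _ _ (expR (- u) * (D * expR (u / 2)) ^+ 2)).
    rewrite exprMn -expRM_natl [2%:R * _]mulrC divfK// mulrCA -expRD addNr expR0 mulr1//.
  apply: ler_pM => //; rewrite ?expR_ge0 ?sqr_ge0//.
  by rewrite ler_pXn2r ?nnegrE ?(ltW h2) ?(ltW Q0)// mulr_ge0 ?expR_ge0 ?ltW.
have A1 : `|m| <= `|m| * expR (u / 2) by rewrite ler_peMr.
have A2 : `|tail_quantile F 1| <= `|tail_quantile F 1| * expR (u / 2) by rewrite ler_peMr.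
have A3 : 0 <= D * expR (u / 2) by rewrite mulr_ge0 ?expR_ge0 ?ltW.
have A4 := ler_norm (tail_quantile F 1); have A5 := ler_norm (- m); rewrite normrN in A5.
rewrite ler_norml (mulrDl (`|m| + D)) (mulrDl `|m|).
have B1 := normr_ge0 m; have B2 := normr_ge0 (tail_quantile F 1).
by clear VD H; clearbody D; apply/andP; split; lra.
Qed.
End tail_bound.

(** * Limits of the moments *)

Section dominated.
Context d (T : measurableType d) (R : realType) (mu : {measure set T -> \bar R}).

(** Domination is only eventual, so the sequence is shifted past the exceptional indices. *)
Lemma dominated_cvg_near (D : set T) (f_ : nat -> T -> R) (f g : T -> R) :
  measurable D -> (forall n, measurable_fun D (f_ n)) ->
  (forall x, D x -> f_ n x @[n --> \oo] --> f x) ->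
  mu.-integrable D (EFin \o g) ->
  (\forall n \near \oo, forall x, D x -> `|f_ n x| <= g x) ->
  mu.-integrable D (EFin \o f) /\
  (\int[mu]_(x in D) (f_ n x)%:E @[n --> \oo] --> \int[mu]_(x in D) (f x)%:E)%E.
Proof.
move=> mD mf_ f_f ig [N _ HN].
have mf : measurable_fun D f by exact: measurable_fun_cvg mf_ f_f.
have mFn n : measurable_fun D (EFin \o f_ (n + N)%N) by exact/measurable_EFinP.
have mF : measurable_fun D (EFin \o f) by exact/measurable_EFinP.
have FF : {ae mu, forall x, D x -> (EFin \o f_ (n + N)%N) x @[n --> \oo] --> (EFin \o f) x}.
  apply: aeW => x Dx; apply: cvg_EFin; first exact: nearW.
  by have := f_f x Dx; rewrite -(cvg_shiftn N).
have FG : {ae mu, forall x, forall n, D x -> (`|(EFin \o f_ (n + N)%N) x| <= (EFin \o g) x)%E}.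
  by apply: aeW => x n Dx; rewrite /= lee_fin; apply: HN => //=; exact: leq_addl.
have [fi _ fc] := dominated_convergence mD mFn mF FF ig FG.
by split=> //; rewrite -(cvg_shiftn N); exact: fc.
Qed.
End dominated.

Section second_moment.
Context {R : realType}.
Notation mu := (@lebesgue_measure R).
Notation D := (`]0%R, +oo[%classic : set R).
Context (u : nat -> R -> R) (v : R -> R) (p C : R).
Context (mu_ : forall n, measurable_fun setT (u n)).
Context (p01 : 0 <= p < 1 / 2) (C0 : 0 <= C).
Context (uC : \forall n \near \oo, forall s, 0 < s ->
  `|u n s| <= C * (s `^ (- p) + expR (s / 8))).
Context (uv : forall s, 0 < s -> u n s @[n --> \oo] --> v s).

Lemma limit_bound s : 0 < s -> `|v s| <= C * (s `^ (- p) + expR (s / 8)).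
Proof.
move=> s0; have h : `|u n s| @[n --> \oo] --> `|v s| by apply: cvg_norm; exact: uv.
apply: (cvgr_to_le h).
by apply: filterS uC => n; exact.
Qed.

Let sqr_bound (x s c : R) : 0 < s -> `|x| <= C * (s `^ (- p) + expR (s / 8)) ->
  (x - c) ^+ 2 <= 3 * C ^+ 2 * s `^ (- (2 * p)) + 3 * C ^+ 2 * expR (s / 4) + 3 * c ^+ 2.
Proof.
move=> s0.
have -> : s `^ (- (2 * p)) = (s `^ (- p)) ^+ 2.
  by rewrite -powR_mulrn ?powR_ge0// -powRrM; congr (_ `^ _); ring.
have -> : expR (s / 4) = expR (s / 8) ^+ 2.
  by rewrite -expRM_natl; congr expR; field.
have := powR_ge0 s (- p); have := expR_ge0 (s / 8).
move: (s `^ _) (expR _) => y z z0 y0.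
have Cy : 0 <= C * y by rewrite mulr_ge0.
have Cz : 0 <= C * z by rewrite mulr_ge0.
move: Cy Cz; rewrite mulrDr -!(mulrA 3) -!exprMn.
move: (C * y) (C * z) => {y z y0 z0} y z y0 z0 xyz.
have h : `|x - c| <= y + z + `|c| by rewrite (le_trans (ler_normB _ _))// lerD2r.
rewrite -[(x - c) ^+ 2]real_normK ?num_real// -[c ^+ 2]real_normK ?num_real//.
apply: (@le_trans _ _ ((y + z + `|c|) ^+ 2)).
  by rewrite ler_sqr// nnegrE addr_ge0// addr_ge0.
move: `|c| => e; have := sqr_ge0 (y - z); have := sqr_ge0 (y - e); have := sqr_ge0 (z - e).
rewrite !sqrrB !sqrrD; lra.
Qed.

Lemma second_moment_cvg (c : R) :
  mu.-integrable D (EFin \o (fun s => expR (- s) * (v s - c) ^+ 2)) /\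
  (\int[mu]_t (expweight 1 t * (u n t - c) ^+ 2)%:E @[n --> \oo] -->
   \int[mu]_(t in D) (expR (- t) * (v t - c) ^+ 2)%:E)%E.
Proof.
have mD : measurable D by exact: measurable_itv.
have /andP[p0 p12] := p01.
(* The factor exp (- s) reduces both exp (s/4) and the constant term of [sqr_bound] to at most exp
   (- s/2), while s^(-2p) is integrable at 0 since 2p < 1. *)
pose g (s : R) := 3 * C ^+ 2 * (s `^ (- (2 * p)) * expR (- (1 * s))) +
  (3 * C ^+ 2 + 3 * c ^+ 2) * (s `^ 0 * expR (- (2^-1 * s))).
have ig : mu.-integrable D (EFin \o g).
  by apply: integrable_RD => //; apply: integrable_RZ => //; apply: integrable_powR_expRN => //; lra.
have E n : (\int[mu]_t (expweight 1 t * (u n t - c) ^+ 2)%:E =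
    \int[mu]_(t in D) (expR (- t) * (u n t - c) ^+ 2)%:E)%E.
  rewrite (integral_expweight 1 (fun t => (u n t - c) ^+ 2)).
  by apply: eq_integral => t _; rewrite mul1r.
have -> : (fun n => \int[mu]_t (expweight 1 t * (u n t - c) ^+ 2)%:E)%E =
    (fun n => \int[mu]_(t in D) (expR (- t) * (u n t - c) ^+ 2)%:E)%E.
  by apply/funext => n; exact: E.
apply: (@dominated_cvg_near _ _ _ mu D _ _ g) => //.
- move=> n; apply: measurable_funTS; apply: measurable_funM.
    by apply: measurableT_comp => //; exact: measurable_funN.
  by apply: measurable_funX; apply: measurable_funB; [exact: mu_|exact: measurable_cst].
- move=> s /=; rewrite in_itv/= andbT => s0.
  apply: cvgM; first exact: cvg_cst.
  rewrite expr2; under eq_fun do rewrite expr2.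
  by apply: cvgM; apply: cvgB => //; (try exact: uv); exact: cvg_cst.
- apply: filterS uC => n H s /=; rewrite in_itv/= andbT => s0.
  rewrite ger0_norm; last by apply: mulr_ge0; [exact: expR_ge0|exact: sqr_ge0].
  apply: (le_trans (ler_wpM2l (expR_ge0 _) (sqr_bound c s0 (H _ s0)))).
  rewrite /g powRr0 ![1 * _]mul1r.
  have e1 : expR (- s) * expR (s / 4) <= expR (- (2^-1 * s)).
    by rewrite -expRD ler_expR; lra.
  have e2 : expR (- s) <= expR (- (2^-1 * s)) by rewrite ler_expR; lra.
  have c0 := sqr_ge0 c; have CC0 := sqr_ge0 C.
  move: (s `^ _) (expR (- s)) (expR (s / 4)) (expR (- (2^-1 * s))) e1 e2 => a1 a2 a3 a4 e1 e2.
  rewrite !mulrDr.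
  have f1 : C ^+ 2 * (a2 * a3) <= C ^+ 2 * a4 by exact: ler_wpM2l.
  have f2 : c ^+ 2 * a2 <= c ^+ 2 * a4 by exact: ler_wpM2l.
  lra.
Qed.
End second_moment.

Lemma gev_sqr_continuous (R : realType) (gamma c s : R) : 0 < s ->
  {for s, continuous (fun x => (gev_inverse gamma x - c) ^+ 2)}.
Proof.
move=> s0; have dk := is_derive1B (is_derive_gev_inverse gamma s0) (is_derive_cst c s 1).
exact: is_derive1_continuous (is_derive1X 2 dk).
Qed.

(** * The inner integral of the limiting gap *)

Section inner_integral.
Context {R : realType}.
Notation mu := (@lebesgue_measure R).
Context (gamma p C : R) (gamma12 : gamma < 1 / 2) (p01 : 0 <= p < 1 / 2).
Notation v := (gev_inverse gamma).
Context (vC : forall s, 0 < s -> `|v s| <= C * (s `^ (- p) + expR (s / 8))).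

(* Obtained from the ansatz [s * (A k^2 + B k + C)] with [k = v s - v t], since
   [s * v' s = - (t^-gamma + gamma * k)] is affine in [k]. *)
Let antiderivative (t s : R) : R :=
  s * ((1 - 2 * gamma)^-1 * (v s - v t) ^+ 2
    + 2 * (1 - 2 * gamma)^-1 * t `^ (- gamma) / (1 - gamma) * (v s - v t)
    + 2 * (1 - 2 * gamma)^-1 * (t `^ (- gamma)) ^+ 2 / (1 - gamma)).

Let gamma1 : 1 - gamma != 0.
Proof. have h : 0 < 1 - gamma by move: gamma12; lra. by rewrite gt_eqF. Qed.

Let gamma2 : 1 - 2 * gamma != 0.
Proof. have h : 0 < 1 - 2 * gamma by move: gamma12; lra. by rewrite gt_eqF. Qed.

Let powRN_gev (s : R) : 0 < s -> s `^ (- gamma) = 1 + gamma * v s.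
Proof.
move=> s0; rewrite /gev_inverse; case: eqVneq => [->|g0].
  by rewrite oppr0 powRr0 mul0r addr0.
by field.
Qed.

Let is_derive_antiderivative (t s : R) : 0 < t -> 0 < s ->
  is_derive s 1 (antiderivative t) ((v s - v t) ^+ 2).
Proof.
move=> t0 s0.
have dk := is_derive1B (is_derive_gev_inverse gamma s0) (is_derive_cst (v t) s 1).
have dk2 := is_derive1X 2 dk.
have d1 := is_derive1D (is_derive1D (is_derive1Z (1 - 2 * gamma)^-1 dk2)
  (is_derive1Z (2 * (1 - 2 * gamma)^-1 * t `^ (- gamma) / (1 - gamma)) dk))
  (is_derive_cst (2 * (1 - 2 * gamma)^-1 * (t `^ (- gamma)) ^+ 2 / (1 - gamma)) s 1).
have := is_derive1M (is_derive_id s (1 : R)) d1.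
move/is_derive_eq; apply.
have -> : s `^ (- gamma - 1) = s `^ (- gamma) / s.
  by rewrite powRB ?powRr1 ?(ltW s0)// (gt_eqF s0) implybT.
rewrite /cst !powRN_gev// expr1.
by field; rewrite gamma1 gamma2 (gt_eqF s0).
Qed.

(** The bracket is quadratic in v x - v t, hence of order x^(-2p) near 0 by [vC], and the outer
    factor x makes this x^(1 - 2p) with positive exponent. Using [vC] avoids a discussion of the
    sign of gamma. *)
Let antiderivative_cvg0 (t : R) : 0 < t ->
  antiderivative t (t / k.+2%:R) @[k --> \oo] --> (0 : R).
Proof.
move=> t0; have /andP[p0 p12] := p01.
rewrite /antiderivative.
set A := (1 - 2 * gamma)^-1; set B := 2 * A * _ / _; set E := 2 * A * _ / _.
pose M1 := (`|A| + `|B|) * (4 * C ^+ 2).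
pose M2 := (`|A| + `|B|) * (4 * C ^+ 2 * expR (t / 4) + 2 * v t ^+ 2) + `|B| + `|E|.
have bnd (x : R) : 0 < x <= t ->
    `|x * (A * (v x - v t) ^+ 2 + B * (v x - v t) + E)| <= M1 * x `^ (1 - 2 * p) + M2 * x.
  move=> /andP[x0 xt].
  have -> : x `^ (1 - 2 * p) = x * (x `^ (- p)) ^+ 2.
    rewrite -powR_mulrn ?powR_ge0// -powRrM -{2}[x]powRr1 ?ltW// -powRD.
      by congr (_ `^ _); ring.
    by rewrite (gt_eqF x0) implybT.
  have kb : (v x - v t) ^+ 2 <= 4 * C ^+ 2 * (x `^ (- p)) ^+ 2 + (4 * C ^+ 2 * expR (t / 4) + 2 * v t ^+ 2).
    have e1 : expR (x / 8) ^+ 2 <= expR (t / 4) by rewrite -expRM_natl ler_expR; lra.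
    have := vC x0; have := powR_ge0 x (- p); have := expR_ge0 (x / 8).
    move: (x `^ _) (expR (x / 8)) e1 => y z e1 z0 y0.
    rewrite ler_norml => /andP[h1 h2].
    have h : v x ^+ 2 <= (C * (y + z)) ^+ 2 by nra.
    have h3 := sqr_ge0 (v x + v t); have h4 := mulr_ge0 (sqr_ge0 C) (sqr_ge0 (y - z)).
    have h5 := ler_wpM2l (sqr_ge0 C) e1.
    rewrite !sqrrB !sqrrD exprMn sqrrD in h h3 h4 *; lra.
  have -> : M1 * (x * x `^ (- p) ^+ 2) + M2 * x = x * (M1 * x `^ (- p) ^+ 2 + M2) by ring.
  rewrite normrM (gtr0_norm x0) ler_wpM2l ?(ltW x0)//.
  apply: (le_trans (ler_normD _ _)); rewrite /M2 addrA lerD2r.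
  apply: (le_trans (ler_normD _ _)); rewrite (normrM A) (normrM B) normrX real_normK ?num_real//.
  have k1 : `|v x - v t| <= 1 + (v x - v t) ^+ 2.
    rewrite -[(v x - v t) ^+ 2]real_normK ?num_real//.
    by move: `|v x - v t| => k; have := sqr_ge0 (k - 2^-1); rewrite sqrrB; lra.
  have h1 := ler_wpM2l (normr_ge0 B) k1.
  have h2 := ler_wpM2l (addr_ge0 (normr_ge0 A) (normr_ge0 B)) kb.
  rewrite /M1; lra.
pose x k : R := t / k.+2%:R.
have x0 k : 0 < x k by rewrite divr_gt0// ltr0n.
have xt k : x k <= t by rewrite ler_pdivrMr ?ltr0n// ler_peMr// ?ler1n// ltW.
have xc : x k @[k --> \oo] --> (0 : R).
  rewrite -[X in _ --> X](mulr0 t); apply: cvgM; first exact: cvg_cst.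
  have -> : (fun k => k.+2%:R^-1 : R) = (fun k => harmonic (k + 1)%N).
    by apply/funext => k; rewrite /harmonic/= addn1.
  by rewrite (cvg_shiftn 1 (@harmonic R)); exact: cvg_harmonic.
have e0 : 0 < 1 - 2 * p by lra.
have pc : x k `^ (1 - 2 * p) @[k --> \oo] --> (0 : R).
  by apply: (cvg_at_rightP _ _ _).1 (powR_cvg0 e0) _ _; split.
have bc : M1 * x k `^ (1 - 2 * p) + M2 * x k @[k --> \oo] --> (0 : R).
  rewrite -[X in _ --> X](_ : M1 * 0 + M2 * 0 = 0); last by rewrite !mulr0 addr0.
  by apply: cvgD; apply: cvgM; (try exact: cvg_cst).
have nbc : - (M1 * x k `^ (1 - 2 * p) + M2 * x k) @[k --> \oo] --> (0 : R).
  by rewrite -[X in _ --> X]oppr0; exact: cvgN.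
apply: (squeeze_cvgr _ nbc bc); apply: nearW => k.
by rewrite -ler_norml; apply: bnd; rewrite x0 xt.
Qed.

(** At s = t only the constant term of the bracket in [antiderivative] survives, and at 0 nothing
    does. *)
Lemma gev_inner_integral (t : R) : 0 < t ->
  (\int[mu]_(s in `]0%R, t]) ((v s - v t) ^+ 2)%:E =
   (2 / ((1 - gamma) * (1 - 2 * gamma)) * t `^ (1 - 2 * gamma))%:E)%E.
Proof.
move=> t0.
have tE : 2 / ((1 - gamma) * (1 - 2 * gamma)) * t `^ (1 - 2 * gamma) = antiderivative t t.
  rewrite /antiderivative subrr expr0n/= !mulr0 !add0r.
  have -> : t `^ (1 - 2 * gamma) = t * (t `^ (- gamma)) ^+ 2.
    rewrite -powR_mulrn ?powR_ge0// -powRrM -{2}[t]powRr1 ?ltW// -powRD.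
      by congr (_ `^ _); ring.
    by rewrite (gt_eqF t0) implybT.
  by field; rewrite gamma1 gamma2.
have dF (s : R) : 0 < s <= t -> is_derive s 1 (antiderivative t) ((v s - v t) ^+ 2).
  by move=> /andP[s0 _]; exact: is_derive_antiderivative.
have cf (s : R) : 0 < s <= t -> {for s, continuous (fun s => (v s - v t) ^+ 2)}.
  by move=> /andP[s0 _]; exact: gev_sqr_continuous.
have f0 (s : R) : 0 < s <= t -> 0 <= (v s - v t) ^+ 2 by move=> _; exact: sqr_ge0.
rewrite tE.
have Fl : antiderivative t t - antiderivative t (t / k.+2%:R) @[k --> \oo] --> antiderivative t t.
  by rewrite -[X in _ --> X]subr0; apply: cvgB; [exact: cvg_cst|exact: antiderivative_cvg0].
exact: (ge0_FTC0c t0 dF cf f0 Fl).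
Qed.
End inner_integral.

(** * Limit of the expected squared gap *)

Section gap_limit.
Context {R : realType}.
Notation mu := (@lebesgue_measure R).
Notation D := (`]0%R, +oo[%classic : set R).
Context (gamma p C : R) (gamma12 : gamma < 1 / 2).
Notation v := (gev_inverse gamma).
Context (u : nat -> R -> R).
Context (mu_ : forall n, measurable_fun setT (u n)).
Context (p01 : 0 <= p < 1 / 2) (C0 : 0 <= C).
Context (uC : \forall n \near \oo, forall s, 0 < s ->
  `|u n s| <= C * (s `^ (- p) + expR (s / 8))).
Context (uv : forall s, 0 < s -> u n s @[n --> \oo] --> v s).
Context (u_anti : \forall n \near \oo, forall s t, 0 < s -> s <= t -> u n t <= u n s).

Let cvg_max0 (w : nat -> R) (l : R) : w n @[n --> \oo] --> l ->
  Num.max (w n) 0 @[n --> \oo] --> Num.max l 0.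
Proof.
have E (x : R) : Num.max x 0 = (x + `|x|) / 2.
  case: (leP x 0) => x0; first by rewrite ?max_r// ler0_norm// subrr mul0r.
  by rewrite ?max_l ?ltW// gtr0_norm//; field.
move=> wl; rewrite E; under eq_fun do rewrite E.
by apply: cvgM; [apply: cvgD => //; exact: cvg_norm|exact: cvg_cst].
Qed.

Let positive (s : R) : R := if 0 < s then 1 else 0.
(** The pointwise limit of the gap integrand: exp (- s/n) tends to 1 and exp (- (1 - 1/n) t) to exp
    (- t). The factor [positive] keeps the restriction s > 0 that the first limit inherits from
    [expweight]. *)
Let limit_weight (z : R * R) : R :=
  positive z.1 * expweight 1 z.2 * Num.max (v z.1 - v z.2) 0 ^+ 2.
(** As the weight in s flattens out with n, decay in s has to come from t. Where s <= t, exp (- t/2)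
    times the squared growth exp (t/4) is at most exp (- s/8) exp (- t/8), which gives an integrable
    product. *)
Let g1 (s : R) : R := expweight (1 / 8) s * (s `^ (- (2 * p)) + 1).
Let g2 (t : R) : R := expweight (1 / 8) t.

Let integrable_g : (sigma_product mu mu).-integrable setT
  (EFin \o (fun z => 8 * C ^+ 2 * (g1 z.1 * g2 z.2))).
Proof.
have mD : measurable D by exact: measurable_itv.
have /andP[p0 p12] := p01.
have m1 : measurable_fun setT g1.
  apply: measurable_funM; first exact: measurable_expweight.
  by apply: measurable_funD => //; exact: measurable_powR.
have m2 : measurable_fun setT g2 by exact: measurable_expweight.
have g10 t : 0 <= g1 t by rewrite mulr_ge0 ?expweight_ge0// addr_ge0 ?powR_ge0.
have g20 t : 0 <= g2 t by exact: expweight_ge0.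
pose h (s : R) := s `^ (- (2 * p)) * expR (- (1 / 8 * s)) + s `^ 0 * expR (- (1 / 8 * s)).
have ih : mu.-integrable D (EFin \o h).
  by apply: integrable_RD => //; apply: integrable_powR_expRN => //; lra.
have I1 : (\int[mu]_s (g1 s)%:E = (fine (\int[mu]_(s in D) (h s)%:E))%:E)%E.
  rewrite fineK; last exact: integrable_fin_num ih.
  rewrite (integral_expweight (1 / 8) (fun s => s `^ (- (2 * p)) + 1)).
  by apply: eq_integral => s _; rewrite /h powRr0; congr (_%:E); ring.
have I2 : (\int[mu]_t (g2 t)%:E = ((1 / 8)^-1 * expR (- (1 / 8 * 0)))%:E)%E.
  rewrite -integral_expRN_tail// -[RHS](eq_integral _ _ (fun t _ => congr1 EFin (mulr1 _))).
  by rewrite -(integral_expweight (1 / 8) (fun=> 1)); apply: eq_integral => t _; rewrite mulr1.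
apply: integrable_RZ => //; apply/integrableP; split.
  apply/measurable_EFinP; apply: measurable_funM.
    by apply: (measurableT_comp m1); exact: measurable_fst.
  by apply: (measurableT_comp m2); exact: measurable_snd.
have <- : (\int[(sigma_product mu mu)]_z (g1 z.1 * g2 z.2)%:E =
    \int[(sigma_product mu mu)]_z `|(EFin \o (fun z => g1 z.1 * g2 z.2)%R) z|)%E.
  by apply: eq_integral => z _; rewrite /= ger0_norm//; exact: mulr_ge0.
by rewrite (integral_product_weight m1 m2 g10 g20 I1 I2) ltry.
Qed.

Let gap_bound n (s t : R) : (2 <= n)%N -> 0 < s -> s <= t -> u n t <= u n s ->
  `|u n s| <= C * (s `^ (- p) + expR (s / 8)) ->
  `|u n t| <= C * (t `^ (- p) + expR (t / 8)) ->
  gap_weight n (s, t) * (u n s - u n t) ^+ 2 <= 8 * C ^+ 2 * (g1 s * g2 t).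
Proof.
move=> n2 s0 st ust us ut.
have t0 : 0 < t by exact: lt_le_trans st.
have /andP[p0 p12] := p01.
have n0 : 0 < n%:R^-1 :> R by rewrite invr_gt0 ltr0n (leq_trans _ n2).
have nh : n%:R^-1 <= 2^-1 :> R by rewrite lef_pV2 ?posrE ?ltr0n ?(leq_trans _ n2)// ler_nat.
have w : gap_weight n (s, t) <= expR (- (t / 2)).
  rewrite /gap_weight/= /expweight s0 t0.
  have e1 : expR (- (n%:R^-1 * s)) <= 1 by rewrite -[leRHS]expR0 ler_expR oppr_le0 mulr_ge0// ltW.
  have e2 : expR (- ((1 - n%:R^-1) * t)) <= expR (- (t / 2)).
    by rewrite ler_expR lerN2 mulrC ler_wpM2r ?(ltW t0)//; lra.
  have e3 := expR_ge0 (- (n%:R^-1 * s)); have e4 := expR_ge0 (- ((1 - n%:R^-1) * t)).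
  have f1 : 0 <= 1 - n%:R^-1 :> R by lra.
  have f2 : 1 - n%:R^-1 <= 1 :> R by lra.
  have f3 : expR (- (n%:R^-1 * s)) * expR (- ((1 - n%:R^-1) * t)) <= expR (- (t / 2)).
    by rewrite -[leRHS]mul1r; exact: ler_pM.
  by rewrite -[leRHS]mul1r; apply: ler_pM => //; exact: mulr_ge0.
have w0 : 0 <= gap_weight n (s, t) by rewrite gap_weight_ge0// (leq_trans _ n2).
have -> : 8 * C ^+ 2 * (g1 s * g2 t) =
    8 * C ^+ 2 * (((s `^ (- p)) ^+ 2 + 1) * (expR (- (s / 8)) * expR (- (t / 8)))).
  rewrite /g1 /g2 /expweight s0 t0.
  have -> : (s `^ (- p)) ^+ 2 = s `^ (- (2 * p)).
    by rewrite -powR_mulrn ?powR_ge0// -powRrM; congr (_ `^ _); ring.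
  have -> : - (1 / 8 * s) = - (s / 8) by field.
  have -> : - (1 / 8 * t) = - (t / 8) by field.
  by ring.
have yy : t `^ (- p) <= s `^ (- p).
  rewrite !powRN lef_pV2 ?posrE ?powR_gt0//.
  by apply: ge0_ler_powR => //; rewrite ?nnegrE ltW.
have zz : expR (s / 8) <= expR (t / 8) by rewrite ler_expR; lra.
have x1 : expR (- (t / 2)) * (expR (t / 8)) ^+ 2 <= expR (- (s / 8)) * expR (- (t / 8)).
  by rewrite -expRM_natl -!expRD ler_expR; lra.
have x2 : expR (- (t / 2)) <= expR (- (s / 8)) * expR (- (t / 8)).
  by rewrite -expRD ler_expR; lra.
have q : (u n s - u n t) ^+ 2 <= 8 * C ^+ 2 * ((s `^ (- p)) ^+ 2 + (expR (t / 8)) ^+ 2).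
  have Cy : C * t `^ (- p) <= C * s `^ (- p) by exact: ler_wpM2l.
  have Cz : C * expR (s / 8) <= C * expR (t / 8) by exact: ler_wpM2l.
  have C1 : 0 <= C * s `^ (- p) by rewrite mulr_ge0 ?powR_ge0.
  have C2 : 0 <= C * expR (t / 8) by rewrite mulr_ge0 ?expR_ge0.
  rewrite mulrDr -!(mulrA 8) -!exprMn.
  move: us ut; rewrite !mulrDr.
  move: (C * s `^ (- p)) (C * expR (t / 8)) (C * t `^ (- p)) (C * expR (s / 8)) Cy Cz C1 C2 => y' z y z' Cy Cz C1 C2 us ut.
  have k : `|u n s - u n t| <= 2 * (y' + z).
    by apply: (le_trans (ler_normB _ _)); lra.
  rewrite -real_normK ?num_real//.
  apply: (@le_trans _ _ ((2 * (y' + z)) ^+ 2)).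
    by rewrite ler_sqr// nnegrE; lra.
  by have := sqr_ge0 (y' - z); rewrite exprMn sqrrB sqrrD; lra.
apply: (le_trans (ler_pM w0 (sqr_ge0 _) w q)); rewrite mulrCA ler_wpM2l ?mulr_ge0 ?sqr_ge0//.
have := sqr_ge0 (s `^ (- p)); move: ((s `^ (- p)) ^+ 2) => y y0.
rewrite mulrDr mulrDl [1 * _]mul1r lerD// mulrC; exact: ler_wpM2l.
Qed.

Lemma gap_cvg : (sigma_product mu mu).-integrable setT (EFin \o limit_weight) /\
  (\int[(sigma_product mu mu)]_z (gap_weight n z * Num.max (u n z.1 - u n z.2) 0 ^+ 2)%:E
    @[n --> \oo] --> \int[(sigma_product mu mu)]_z (limit_weight z)%:E)%E.
Proof.
apply: (dominated_cvg_near measurableT _ _ integrable_g).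
- move=> n; apply: measurable_funM; first exact: measurable_gap_weight.
  apply: measurable_funX; apply: measurable_maxr => //; apply: measurable_funB.
    by apply: (measurableT_comp (mu_ n)); exact: measurable_fst.
  by apply: (measurableT_comp (mu_ n)); exact: measurable_snd.
- move=> [s t] _; rewrite /limit_weight /gap_weight /positive /expweight/=.
  case: (ltP 0 s) => s0; last by rewrite !mul0r; under eq_fun do rewrite mul0r mulr0 mul0r; exact: cvg_cst.
  case: (ltP 0 t) => t0; last by rewrite mulr0 mul0r; under eq_fun do rewrite !mulr0 mul0r; exact: cvg_cst.
  have i0 : n%:R^-1 @[n --> \oo] --> (0 : R).
    by apply/gtr0_cvgV0; [near=> n; rewrite ltr0n; near: n; exact: nbhs_infty_gt|exact: cvgr_idn].
  apply: cvgM.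
    rewrite -[X in _ --> X](_ : (1 - 0) * (expR (- (0 * s)) * expR (- ((1 - 0) * t))) = _); last first.
      by rewrite subr0 mul0r oppr0 expR0 !mul1r.
    apply: cvgM; first by apply: cvgB => //; exact: cvg_cst.
    apply: cvgM.
      apply: (@cvg_comp _ _ _ (fun n => - (n%:R^-1 * s)) expR); last exact: continuous_expR.
      by apply: cvgN; apply: cvgM => //; exact: cvg_cst.
    apply: (@cvg_comp _ _ _ (fun n => - ((1 - n%:R^-1) * t)) expR); last exact: continuous_expR.
    apply: cvgN; apply: cvgM; last exact: cvg_cst.
    by apply: cvgB => //; exact: cvg_cst.
  rewrite expr2; under eq_fun do rewrite expr2.
  by apply: cvgM; apply: cvg_max0; apply: cvgB; exact: uv.
- near=> n; move=> [s t] _ /=.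
  have n2 : (2 <= n)%N by near: n; exact: nbhs_infty_ge.
  have G0 : 0 <= 8 * C ^+ 2 * (g1 s * g2 t).
    by rewrite !mulr_ge0 ?sqr_ge0 ?expweight_ge0// addr_ge0 ?powR_ge0.
  rewrite ger0_norm; last by rewrite mulr_ge0 ?sqr_ge0// gap_weight_ge0// ltnW.
  have [s0|s0] := ltP 0 s; last first.
    by rewrite /gap_weight/= {1}/expweight ltNge s0/= mul0r mulr0 mul0r.
  have [t0|t0] := ltP 0 t; last first.
    by rewrite /gap_weight/= {2}/expweight (ltNge 0 t) t0/= mulr0 mulr0 mul0r.
  have H : forall s, 0 < s -> `|u n s| <= C * (s `^ (- p) + expR (s / 8)) by near: n; exact: uC.
  have K : forall s t, 0 < s -> s <= t -> u n t <= u n s by near: n; exact: u_anti.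
  have [st|ts] := leP s t.
    have ust := K _ _ s0 st.
    rewrite max_l ?subr_ge0//; apply: gap_bound => //; exact: H.
  by rewrite max_r ?expr0n ?mulr0// subr_le0; exact: K _ _ t0 (ltW ts).
Unshelve. all: by end_near. Qed.

(** Integrating over s first, the positive part confines s to (0, t], because h decreases.
    [gev_inner_integral] then leaves a multiple of t^(1 - 2 gamma) exp (- t), the integrand of Gamma
    at 2 (1 - gamma). *)
Lemma gap_limit_integral :
  (\int[(sigma_product mu mu)]_z (limit_weight z)%:E =
   (2 * Gamma (2 * (1 - gamma)) / ((1 - gamma) * (1 - 2 * gamma)))%:E)%E.
Proof.
have mD : measurable D by exact: measurable_itv.
have [iw _] := gap_cvg.
have w0 z : (0 <= (limit_weight z)%:E)%E.
  by rewrite lee_fin mulr_ge0 ?sqr_ge0// mulr_ge0 ?expweight_ge0// /positive; case: ifP.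
pose c : R := 2 / ((1 - gamma) * (1 - 2 * gamma)).
have c0 : 0 < c by rewrite divr_gt0// mulr_gt0//; move: gamma12; lra.
pose g (t : R) : R := t `^ (2 * (1 - gamma) - 1) * expR (- t).
have mg : measurable_fun D g.
  apply: measurable_funM; first by apply: measurable_funTS; exact: measurable_powR.
  by apply: measurable_funTS; apply: measurableT_comp => //; exact: measurable_funN.
have g0 t : 0 <= g t by rewrite mulr_ge0 ?powR_ge0 ?expR_ge0.
have key : (\int[(sigma_product mu mu)]_z (limit_weight z)%:E =
    c%:E * \int[mu]_(t in D) (g t)%:E)%E.
  rewrite /sigma_product fubini_tonelli2//; last first.
    by have /measurable_EFinP := measurable_int _ iw; move/measurable_EFinP.
  rewrite -ge0_integralZl//; last 3 first.
  - exact/measurable_EFinP.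
  - by move=> t _; rewrite lee_fin.
  - by rewrite lee_fin ltW.
  rewrite [RHS]integral_mkcond; apply: eq_integral => t _.
  rewrite /fubini_G patchE; have [t0|t0] := ltP 0 t; last first.
    rewrite memNset/=; last by rewrite in_itv/= andbT ltNge t0.
    by apply: integral0_eq => s _; rewrite /limit_weight/= /expweight ltNge t0/= mulr0 mul0r.
  rewrite mem_set/=; last by rewrite in_itv/= andbT.
  transitivity (\int[mu]_(s in `]0%R, t]) ((expR (- t))%:E * ((v s - v t) ^+ 2)%:E))%E.
    rewrite [RHS]integral_mkcond; apply: eq_integral => s _.
    rewrite patchE /limit_weight /= /expweight t0 mul1r /positive.
    rewrite mem_setE in_itv/=; have [/andP[s0 st]|] := boolP (0 < s <= t).
      rewrite s0 mul1r max_l// subr_ge0.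
      move: st; rewrite le_eqVlt => /predU1P[->//|st].
      by rewrite ltW// gev_inverse_decr.
    rewrite negb_and -leNgt -ltNge => st.
    case: ifPn => s0; last by rewrite !mul0r.
    have ts : t < s by move: st; rewrite leNgt s0.
    by rewrite max_r ?expr0n ?mulr0// subr_le0 ltW// gev_inverse_decr.
  rewrite ge0_integralZl//.
  - rewrite (gev_inner_integral gamma12 p01 (limit_bound uC uv))//.
    rewrite -!EFinM; congr (_%:E); rewrite /c /g.
    have -> : 2 * (1 - gamma) - 1 = 1 - 2 * gamma by ring.
    by ring.
  - apply/measurable_EFinP; apply: (@measurable_funS _ _ _ _ D) => //.
      by move=> s /=; rewrite !in_itv/= andbT => /andP[].
    by apply: measurable_fun_itv0y => s s0; exact: gev_sqr_continuous.
  - by move=> s _; rewrite lee_fin sqr_ge0.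
(* [Gamma] is a real number obtained by [fine], so finiteness of Euler's integral is needed here. It
   is inherited from the integrability of the limit weight: c times an infinite integral would not
   be finite. *)
have := integrable_fin_num measurableT iw.
rewrite [X in X \is a fin_num]key [LHS]key.
have I0 : (0 <= \int[mu]_(t in D) (g t)%:E)%E by apply: integral_ge0 => t _; rewrite lee_fin.
have -> : 2 * Gamma (2 * (1 - gamma)) / ((1 - gamma) * (1 - 2 * gamma)) =
    c * fine (\int[mu]_(t in D) (g t)%:E)%E.
  by rewrite /c /Gamma /Rintegral; ring.
case: (\int[mu]_(t in D) (g t)%:E)%E I0 => [r|//|//] _ //.
by rewrite gt0_muley ?lte_fin.
Qed.
End gap_limit.

(** * Evaluation of the limiting variance *)

Section variance_limit.
Context {R : realType} (gamma : R).
Notation mu := (@lebesgue_measure R).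
Notation D := (`]0%R, +oo[%classic : set R).
Notation v := (gev_inverse gamma).
Let f (c t : R) : R := expR (- t) * (v t - c) ^+ 2.
Let k c := fine (\int[mu]_(t in D) (f c t)%:E)%E.
Context (fi : forall c, mu.-integrable D (EFin \o f c)).

(** [k c] is the second moment of h about c under the exponential law. The identity v = (v^2 - (v -
    1)^2 + 1) / 2 makes ln t, or t^(- gamma) = 1 + gamma v, and its square affine combinations of
    the integrands of [k 0] and [k 1] and of the weight; this is where the coefficients given to
    [RI] come from. *)
Lemma gev_variance_moments : k 0 - ((k 0 - k 1 + 1) / 2) ^+ 2 = gev_variance gamma.
Proof.
have mD : measurable D by exact: measurable_itv.
have kE c : (\int[mu]_(t in D) (f c t)%:E = (k c)%:E)%E.
  by rewrite /k fineK//; exact: integrable_fin_num (fi c).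
pose w (t : R) := expR (- t).
have wi : mu.-integrable D (EFin \o w).
  rewrite (_ : w = fun t => t `^ 0 * expR (- (1 * t))).
    by apply: integrable_powR_expRN => //; lra.
  by apply/funext => t; rewrite powRr0 !mul1r.
have wE : (\int[mu]_(t in D) (w t)%:E = 1%:E)%E.
  have := @integral_expRN_tail R 1 0 ltr01 (lexx 0).
  rewrite invr1 mul1r mulr0 oppr0 expR0 => <-.
  by apply: eq_integral => t _; rewrite mul1r.
have lin (A B C : R) : (\int[mu]_(t in D) (A * f 0 t + B * f 1 t + C * w t)%:E =
    (A * k 0 + B * k 1 + C * 1)%:E)%E.
  by apply: (integral_linear3 _ A B C (fi 0) (fi 1) wi (kE 0) (kE 1) wE); exact: measurable_itv.
have RI (g : R -> R) (A B C : R) : (forall t, 0 < t -> g t = A * f 0 t + B * f 1 t + C * w t) ->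
    \int[mu]_(t in D) g t = A * k 0 + B * k 1 + C.
  move=> gE; rewrite /Rintegral -[RHS]/(fine (A * k 0 + B * k 1 + C)%:E).
  rewrite -[C in RHS]mulr1 -lin; congr fine; apply: eq_integral => t.
  by rewrite inE/= in_itv/= andbT => t0; rewrite gE.
have [g0|g0] := eqVneq gamma 0.
  rewrite /gev_variance g0 eqxx -gumbel_variance /log_moment.
  have vE t : v t = - ln t by rewrite /gev_inverse g0 eqxx.
  rewrite (RI (lnexp 2 0) 1 0 0); last first.
    by move=> t t0; rewrite /lnexp /f vE expr0; ring.
  rewrite (RI (lnexp 1 0) (- 2^-1) (2^-1) (- 2^-1)); last first.
    by move=> t t0; rewrite /lnexp /f /w vE expr0 expr1; field.
  by field.
have pE t : 0 < t -> t `^ (- gamma) = 1 + gamma * v t.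
  by move=> t0; rewrite /gev_inverse (negPf g0); field.
rewrite /gev_variance (negPf g0) /Gamma.
rewrite (RI _ (gamma ^+ 2 + gamma) (- gamma) (1 + gamma)); last first.
  move=> t t0.
  have -> : 1 - 2 * gamma - 1 = - gamma * 2 by ring.
  by rewrite powRrM powR_mulrn ?powR_ge0// pE// /f /w; ring.
rewrite (RI _ (gamma / 2) (- gamma / 2) (1 + gamma / 2)); last first.
  move=> t t0.
  have -> : 1 - gamma - 1 = - gamma by ring.
  by rewrite pE// /f /w; field.
by field.
Qed.
End variance_limit.

Theorem proposition3p2 (R : realType) (gamma : R) (hgamma : gamma < 1 / 2)
    (F : cumulativeBounded (0 : R) (1 : R)) (hvar : finite_variance F)
    (a : R -> R) (hF : MDA F gamma a)
    (d : nat -> measure_display) (T : forall n : nat, measurableType (d n))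
    (P : forall n : nat, probability (T n) R)
    (X : forall n : nat, 'I_n -> {RV P n >-> R})
    (hX : forall n : nat, (2 <= n)%N -> iid_sample F (@X n)) :
  ('E_(P n)[fun w => ((order_stat (@X n) 1 w - order_stat (@X n) 2 w) ^+ 2)%R]
     * (a n%:R ^- 2)%:E)%E @[n --> \oo]
    --> (2 * Gamma (2 * (1 - gamma)) / ((1 - gamma) * (1 - 2 * gamma)))%:E
  /\
  ('V_(P n)[order_stat (@X n) 1] * (a n%:R ^- 2)%:E)%E @[n --> \oo]
    --> (gev_variance gamma)%:E.
Proof.
have an := MDA_norming_gt0 hF hX.
have tq := tail_quantile_cvg hF hX.
have [K HK] := tail_quantile_bound hvar.
have [p [C [p01 C0 uC]]] := gev_domination hgamma (tail_quantile_antitone F) HK an tq.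
pose b n : R := quantile F (1 - n%:R^-1).
pose u n s : R := (tail_quantile F (s / n%:R) - b n) / a n%:R.
have mu_ n : measurable_fun setT (u n).
  apply: measurable_funM => //; apply: measurable_funB => //.
  exact: measurable_scaled_quantile.
have uE n s : 0 < a n%:R -> tail_quantile F (s / n%:R) = b n + a n%:R * u n s.
  by move=> a0; rewrite /u; field; rewrite gt_eqF.
have u_anti : \forall n \near \oo, forall s t, 0 < s -> s <= t -> u n t <= u n s.
  near=> n; move=> s t s0 st.
  have n0 : 0 < n%:R^-1 :> R by rewrite invr_gt0 ltr0n; near: n; exact: nbhs_infty_gt.
  have a0 : 0 < a n%:R by near: n; exact: an.
  rewrite /u ler_pM2r ?invr_gt0// lerD2r; apply: tail_quantile_antitone.
  - by rewrite inE mulr_gt0.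
  - by rewrite inE mulr_gt0// (lt_le_trans s0).
  - by rewrite ler_pM2r.
split.
  rewrite -(gap_limit_integral hgamma mu_ p01 C0 uC tq u_anti).
  have [_ gc] := gap_cvg mu_ p01 C0 uC tq u_anti.
  apply: cvg_trans gc; apply: near_eq_cvg; near=> n.
  have n2 : (2 <= n)%N by near: n; exact: nbhs_infty_ge.
  have a0 : 0 < a n%:R by near: n; exact: an.
  apply/esym; rewrite unlock (gap_sqr_transfer (hX _ n2))//.
  (* Writing Z(s/n) as b n + a n * u n s, the centring drops out of the gap and a(n)^2 comes out of
     the integral. *)
  transitivity (((a n%:R ^+ 2)%:E * \int[sigma_product lebesgue_measure lebesgue_measure]_z
    (gap_weight n z * Num.max (u n z.1 - u n z.2) 0 ^+ 2)%:E) * (a n%:R ^- 2)%:E)%E.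
  - congr (_ * _)%E; rewrite -ge0_integralZl//.
    + apply: eq_integral => z _; rewrite -EFinM !uE//; congr (_%:E).
      rewrite [RHS]mulrCA -exprMn; congr (_ * _ ^+ 2).
      by rewrite maxr_pMr ?(ltW a0)// mulr0 mulrBr; congr (Num.max _ 0); ring.
    + apply/measurable_EFinP; apply: measurable_funM; first exact: measurable_gap_weight.
      apply: measurable_funX; apply: measurable_maxr => //; apply: measurable_funB.
        by apply: (measurableT_comp (mu_ n)); exact: measurable_fst.
      by apply: (measurableT_comp (mu_ n)); exact: measurable_snd.
    + by move=> z _; rewrite lee_fin mulr_ge0 ?sqr_ge0// gap_weight_ge0// ltnW.
    + by rewrite lee_fin sqr_ge0.
  - by rewrite muleAC -EFinM mulfV ?mul1e// expf_neq0// gt_eqF.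
have smc := second_moment_cvg mu_ p01 C0 uC tq.
have fi c := (smc c).1.
rewrite -(gev_variance_moments fi).
pose I n c := (\int[lebesgue_measure]_t (expweight 1 t * (u n t - c) ^+ 2)%:E)%E.
pose k (c : R) := fine (\int[lebesgue_measure]_(t in (`]0%R, +oo[ : set R))
  (expR (- t) * (gev_inverse gamma t - c) ^+ 2)%:E)%E.
rewrite -/(k 0) -/(k 1).
have kc c : I n c @[n --> \oo] --> (k c)%:E.
  rewrite /k fineK; first exact: (smc c).2.
  exact: integrable_fin_num (fi c).
(* Convergence to a finite limit makes the two second moments finite for large n, as
   [variance_two_points] requires. *)
have [f0 c0] := (fine_cvgP _ _).1 (kc 0).
have [f1 c1] := (fine_cvgP _ _).1 (kc 1).
have lim : fine (I n 0) - ((fine (I n 0) - fine (I n 1) + 1) / 2) ^+ 2 @[n --> \oo] -->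
    k 0 - ((k 0 - k 1 + 1) / 2) ^+ 2.
  have h : (fine (I n 0) - fine (I n 1) + 1) / 2 @[n --> \oo] --> (k 0 - k 1 + 1) / 2.
    apply: cvgM; last exact: cvg_cst.
    by apply: cvgD; [exact: cvgB|exact: cvg_cst].
  apply: cvgB => //; rewrite expr2; under eq_fun do rewrite expr2.
  exact: cvgM.
have elim : (fine (I n 0) - ((fine (I n 0) - fine (I n 1) + 1) / 2) ^+ 2)%:E @[n --> \oo] -->
    (k 0 - ((k 0 - k 1 + 1) / 2) ^+ 2)%:E.
  by apply: cvg_EFin lim; exact: nearW.
apply: cvg_trans elim.
apply: near_eq_cvg; near=> n.
have n2 : (2 <= n)%N by near: n; exact: nbhs_infty_ge.
have a0 : 0 < a n%:R by near: n; exact: an.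
have F0 : I n 0 \is a fin_num by near: n; exact: f0.
have F1 : I n 1 \is a fin_num by near: n; exact: f1.
(* Centring the maximum at b(n) + a(n) c corresponds to centring [u n] at c; the values c = 0 and c
   = 1 supply the two points. *)
have moment c : (\int[P n]_w ((order_stat (@X n) 1 w - (b n + a n%:R * c)) ^+ 2)%:E =
    (a n%:R ^+ 2)%:E * I n c)%E.
  rewrite (max_sqr_transfer (hX _ n2)) ?(ltnW n2)// -ge0_integralZl//.
  - apply: eq_integral => t _; rewrite -EFinM uE//; congr (_%:E); ring.
  - apply/measurable_EFinP; apply: measurable_funM; first exact: measurable_expweight.
    by apply: measurable_funX; apply: measurable_funB; [exact: mu_|exact: measurable_cst].
  - by move=> t _; rewrite lee_fin; apply: mulr_ge0; [exact: expweight_ge0|exact: sqr_ge0].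
  - by rewrite lee_fin sqr_ge0.
have m0 := moment 0; have m1 := moment 1; rewrite mulr0 addr0 in m0; rewrite mulr1 in m1.
rewrite -(fineK F0) -EFinM in m0; rewrite -(fineK F1) -EFinM in m1.
have mM : measurable_fun setT (order_stat (@X n) 1).
  by apply: measurable_order_stat; rewrite /= ltnW.
have an0 : a n%:R != 0 by rewrite gt_eqF.
rewrite (variance_two_points an0 mM m0 m1).
by rewrite -EFinM/= mulrAC mulfV ?mul1r// expf_neq0.
Unshelve. all: by end_near. Qed.
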